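(* Consider subsets $R_n,R\subset\mathbb R^+$ ($n\in\mathbb N$), enumerated by increasing sequences $(\beta_{n,k})_k$ and $(\beta_k)_k$ respectively. Consider a logarithmic half-plane $H$ and bounded functions $g_n,g\in E_0(H)$. Suppose that $g_n\to g$ uniformly, that $\beta_{n,k}\to\beta_k$ as $n\to\infty$ for each $k$, and that the support of the hyperfunction $\mathcal Lg_n$ is contained in $R_n$ for each $n$. Then the support of $\mathcal Lg$ is contained in $R$. Moreover, for each $\beta_1,\beta_2\notin R$ (here $\beta_1,\beta_2$ denote real cutting points, not terms of the sequence $(\beta_k)_k$), the partial sums $S_{[\beta_1,\beta_2]}g_n$ are well defined for $n$ big enough, and $S_{[\beta_1,\beta_2]}g_n\to S_{[\beta_1,\beta_2]}g$ uniformly on $-1+H$.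
   Context: Notation. $\mathbb R^+=[0,\infty)$, $R(w_0,v)=\{w_0+tv:t\ge0\}$, $C_-(w_0,\theta)=w_0-\{w\in\mathbb C^*:|\mathrm{Arg}(w)|<\theta\}$. A neighborhood of $-\infty$ is a set $H\subset\mathbb C$ such that for every $\theta\in[0,\pi/2[$ there is $w_0\in H$ with $C_-(w_0,\theta)\subset H$, and such that $H=\bigcup_{w_0\in H\cap\mathbb R}C_-(w_0,\theta(w_0))$, where $\theta(w_0)\le\pi/2$ is the biggest angle with $C_-(w_0,\theta(w_0))\subset H$. Its border has the form $\{x+iy:x=\rho(|y|)\}$ with $\rho$ convex on $\mathbb R^+$. It is called a logarithmic half-plane (or logarithmic neighborhood of $-\infty$) if there are $c\in\mathbb R$, $k>0$ with $\rho(y)=c-k\log(y)$ for $y$ big enough. $-1+H$ is the translate of $H$ by $-1$. $E_0(H)$ is the space of bounded holomorphic functions on $H$ extending continuously to the border, with the supremum norm. Laplace transform. For $g\in E_0(H)$ and $w_0\in H$, $\mathcal L_{w_0}g\in\mathcal O(\mathbb C\setminus\mathbb R^+)$ is defined by $\mathcal L_{w_0}g(p)=\int_{w_0}^{w_1}g(w)e^{-pw}dw+\int_{R(w_1,v)}g(w)e^{-pw}dw$ for any ray $R(w_1,v)\subset\overline H$ with $\mathrm{Re}(v)<0$, $\mathrm{Re}(pv)>0$ (independent of $w_1,v$). Changing $w_0$ adds an entire function with exponential growth, and the hyperfunction $\mathcal Lg$ is the class of $\mathcal L_{w_0}g$ modulo such entire functions. The support of $\mathcal Lg$ is the set of $\beta\in\mathbb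 R^+$ such that $\mathcal L_{w_0}g$ does not extend holomorphically to a neighborhood of $\beta$ (independent of $w_0$). Partial sums. If $\beta_1<\beta_2$ are real numbers not in the support of $\mathcal Lg$, then $S_{[\beta_1,\beta_2]}g(w)=\frac{1}{2i\pi}\int_\gamma\mathcal Lg(p)e^{pw}dp$, where $\gamma$ is a simple loop circling once around $[\beta_1,\beta_2]$ in the counterclockwise sense, meeting $\mathbb R$ exactly at $\beta_1$ and $\beta_2$ (points near which $\mathcal Lg$ extends holomorphically).
   Formalization: It is additionally assumed that β_k→+∞ (R has no finite accumulation point), without which the claim is false; finite enumerations are padded by +∞, so surplus points of R_n must tend to +∞ when R is finite; increasing means strictly increasing. *)

(* Defs.v *)
From Stdlib Require Import Reals.
From Coquelicot Require Export Coquelicot.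

Open Scope R_scope.

(** * Complex preliminaries *)

Definition Cexp (z : C) : C := (exp (Re z) * cos (Im z), exp (Re z) * sin (Im z)).

(* Principal argument, in ]-PI, PI]; only meaningful for z <> 0. *)
Definition Arg (z : C) : R :=
  if Rle_dec 0 (Im z) then acos (Re z / Cmod z) else - acos (Re z / Cmod z).

Definition on_Rplus (p : C) : Prop := Im p = 0 /\ 0 <= Re p.

Definition closure (H : C -> Prop) (w : C) : Prop :=
  forall eps : R, 0 < eps -> exists w' : C, H w' /\ Cmod (w' - w) < eps.

Definition border (H : C -> Prop) (w : C) : Prop :=
  closure H w /\ closure (fun u => ~ H u) w.

Definition holomorphic_at (f : C -> C) (p : C) : Prop :=
  @ex_derive C_AbsRing C_NormedModule f p.

Definition holomorphic_near (f : C -> C) (p : C) : Prop :=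
  exists r : R, 0 < r /\ forall q : C, Cmod (q - p) < r -> holomorphic_at f q.

Definition uniform_cv_on (D : C -> Prop) (fn : nat -> C -> C) (f : C -> C) : Prop :=
  forall eps : R, 0 < eps ->
  exists N : nat, forall n : nat, (N <= n)%nat ->
  forall w : C, D w -> Cmod (fn n w - f w) <= eps.

(** * Paths and path integrals (parameter interval [0,1]) *)

(* [d i] is the derivative of the i-th piece, continuous up to its ends. *)
Definition piecewise_C1 (gam : R -> C) : Prop :=
  @continuous_on R_UniformSpace C_UniformSpace (fun t => 0 <= t <= 1) gam /\
  exists (n : nat) (s : nat -> R) (d : nat -> R -> C),
    s 0%nat = 0 /\ s n = 1 /\
    forall i : nat, (i < n)%nat ->
      s i < s (S i) /\
      @continuous_on R_UniformSpace C_UniformSpace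
        (fun t => s i <= t <= s (S i)) (d i) /\
      forall t : R, s i < t < s (S i) ->
        @is_derive R_AbsRing C_R_NormedModule gam t (d i t).

(* Total; at the finitely many corners of a piecewise C^1 path its value is
   irrelevant to the integral below. *)
Definition path_derive (gam : R -> C) (t : R) : C :=
  (Derive (fun s => Re (gam s)) t, Derive (fun s => Im (gam s)) t).

Definition path_int (f : C -> C) (gam : R -> C) : C :=
  @RInt C_R_CompleteNormedModule
    (fun t => (f (gam t) * path_derive gam t)%C) 0 1.

(** * Logarithmic half-planes *)

(* C_-(w0, theta) *)
Definition cone_minus (w0 : C) (theta : R) (w : C) : Prop :=
  (w0 - w)%C <> RtoC 0 /\ Rabs (Arg (w0 - w)%C) < theta.

Definition cone_in (H : C -> Prop) (w0 : C) (theta : R) : Prop :=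
  forall w : C, cone_minus w0 theta w -> H w.

(* theta is the angle theta(w0). The cone with angle 0 is empty, so theta(w0)
   is always >= 0. *)
Definition is_biggest_angle (H : C -> Prop) (w0 : C) (theta : R) : Prop :=
  theta <= PI / 2 /\ cone_in H w0 theta /\
  forall theta' : R, theta' <= PI / 2 -> cone_in H w0 theta' -> theta' <= theta.

Definition neighborhood_minus_infty (H : C -> Prop) : Prop :=
  (forall theta : R, 0 <= theta < PI / 2 ->
     exists w0 : C, H w0 /\ cone_in H w0 theta) /\
  (forall w : C, H w <->
     exists x theta : R,
       H (RtoC x) /\ is_biggest_angle H (RtoC x) theta /\
       cone_minus (RtoC x) theta w).

Definition convex_on_Rplus (rho : R -> R) : Prop :=
  forall x y t : R, 0 <= x -> 0 <= y -> 0 <= t <= 1 ->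
  rho (t * x + (1 - t) * y) <= t * rho x + (1 - t) * rho y.

Definition log_half_plane (H : C -> Prop) : Prop :=
  neighborhood_minus_infty H /\
  exists rho : R -> R,
    convex_on_Rplus rho /\
    (forall w : C, border H w <-> Re w = rho (Rabs (Im w))) /\
    exists c k Y : R, 0 < k /\ forall y : R, Y <= y -> rho y = c - k * ln y.

(* -1 + H *)
Definition shift_m1 (H : C -> Prop) (w : C) : Prop := H (w + 1)%C.

(* An element of E_0(H) is represented together with its continuous extension
   to the border: only the values of g on the closure of H matter. *)
Definition E0 (H : C -> Prop) (g : C -> C) : Prop :=
  (forall w : C, H w -> holomorphic_at g w) /\
  (exists M : R, forall w : C, H w -> Cmod (g w) <= M) /\
  @continuous_on C_UniformSpace C_UniformSpace (closure H) g.

(** * Laplace transform *)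

(* z is the value at p computed with some path from w0 to w1 in the closure
   of H and some admissible ray R(w1, v). *)
Definition is_laplace (H : C -> Prop) (g : C -> C) (w0 p z : C) : Prop :=
  exists (w1 v : C) (gam : R -> C) (J : C),
    piecewise_C1 gam /\ gam 0 = w0 /\ gam 1 = w1 /\
    (forall t : R, 0 <= t <= 1 -> closure H (gam t)) /\
    (forall t : R, 0 <= t -> closure H (w1 + RtoC t * v)%C) /\
    Re v < 0 /\ 0 < Re (p * v)%C /\
    @is_RInt_gen C_R_NormedModule
      (fun t => let w := (w1 + RtoC t * v)%C in (g w * Cexp (- (p * w)) * v)%C)
      (at_point 0) (Rbar_locally p_infty) J /\
    z = (path_int (fun w => g w * Cexp (- (p * w)))%C gam + J)%C.

(* The common value of all these integrals. For p in R^+ there is no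
   admissible ray, and the value is meaningless. *)
Definition laplace (H : C -> Prop) (g : C -> C) (w0 p : C) : C :=
  @iota C_R_CompleteNormedModule (is_laplace H g w0 p).

Definition entire_exp_growth (E : C -> C) : Prop :=
  (forall p : C, holomorphic_at E p) /\
  exists A B : R, forall p : C, Cmod (E p) <= A * exp (B * Cmod p).

(* F represents the hyperfunction L g. The values of F on R^+ are not
   constrained, so that F may be a holomorphic extension across parts of R^+. *)
Definition represents_laplace (H : C -> Prop) (g F : C -> C) : Prop :=
  exists (w0 : C) (E : C -> C),
    H w0 /\ entire_exp_growth E /\
    forall p : C, ~ on_Rplus p -> F p = (laplace H g w0 p + E p)%C.

Definition extends_holomorphically_at (f : C -> C) (beta : R) : Prop :=
  exists F : C -> C,
    holomorphic_near F (RtoC beta) /\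
    exists r : R, 0 < r /\
      forall p : C, Cmod (p - RtoC beta) < r -> ~ on_Rplus p -> F p = f p.

(* Support of the hyperfunction L g. *)
Definition laplace_support (H : C -> Prop) (g : C -> C) (beta : R) : Prop :=
  0 <= beta /\
  forall w0 : C, H w0 -> ~ extends_holomorphically_at (laplace H g w0) beta.

(** * Partial sums *)

(* "Circling once counterclockwise around [b1, b2]" is winding number 1 around
   the points of ]b1, b2[; the points b1 and b2 lie on the loop itself. *)
Definition simple_loop_around (b1 b2 : R) (gam : R -> C) : Prop :=
  piecewise_C1 gam /\ gam 0 = gam 1 /\
  (forall s t : R, 0 <= s < 1 -> 0 <= t < 1 -> gam s = gam t -> s = t) /\
  (forall x : R, (exists t : R, 0 <= t <= 1 /\ gam t = RtoC x) <->
     (x = b1 \/ x = b2)) /\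
  (forall x : R, b1 < x < b2 ->
     path_int (fun p => / (p - RtoC x))%C gam = (2 * Ci * RtoC PI)%C).

Definition is_partial_sum (H : C -> Prop) (g : C -> C) (b1 b2 : R) (w z : C) : Prop :=
  exists F gam,
    represents_laplace H g F /\
    holomorphic_near F (RtoC b1) /\ holomorphic_near F (RtoC b2) /\
    simple_loop_around b1 b2 gam /\
    z = (/ (2 * Ci * RtoC PI) * path_int (fun p => F p * Cexp (p * w)) gam)%C.

(* S_{[b1, b2]} g (w) *)
Definition partial_sum (H : C -> Prop) (g : C -> C) (b1 b2 : R) (w : C) : C :=
  @iota C_R_CompleteNormedModule (is_partial_sum H g b1 b2 w).

Definition partial_sum_well_defined (H : C -> Prop) (g : C -> C) (b1 b2 : R) : Prop :=
  b1 < b2 /\ ~ laplace_support H g b1 /\ ~ laplace_support H g b2 /\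
  forall w : C, exists! z : C, is_partial_sum H g b1 b2 w z.

(** * Enumerated subsets of R^+ *)

(* Finite enumerations are padded with +oo. *)
Definition enumerates (b : nat -> Rbar) (A : R -> Prop) : Prop :=
  (forall k : nat, Rbar_le 0 (b k)) /\
  (forall k : nat, Rbar_lt (b k) (b (S k)) \/ (b k = p_infty /\ b (S k) = p_infty)) /\
  (forall x : R, A x <-> exists k : nat, b k = Finite x).

(* Convergence for the order topology of [-oo, +oo]. *)
Definition Rbar_cv (u : nat -> Rbar) (l : Rbar) : Prop :=
  (forall a : R, Rbar_lt a l -> eventually (fun n => Rbar_lt a (u n))) /\
  (forall a : R, Rbar_lt l a -> eventually (fun n => Rbar_lt (u n) a)).

(* Main.v *)
Require Import Defs.
From Stdlib Require Import Reals Psatz Classical ClassicalEpsilon FunctionalExtensionality.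
From Coquelicot Require Import Coquelicot.

Open Scope R_scope.

(* For p = x + i y close to the positive axis, the ray tangent to the border of
   H with slope of order |y| is admissible and starts at a point of order ln |y|,
   because the border is logarithmic. Hence |L g(p)| <= K |y|^(-N) sup |g|, where
   K and N depend only on H and on a bound for |p|. If moreover L g extends
   holomorphically to a disc centred on the axis, Cauchy's estimate for L g
   multiplied by ((p - x1) (p - x2))^N, on circles that meet the axis at x1 and
   x2, bounds L g on a smaller disc by a multiple of sup |g|. Applied to the
   differences g_n - g_m, this shows that the extensions of L g_n converge
   uniformly near every point outside R0, so that L g extends there.

   The exponential e^(p w) is not bounded for w in -1 + H. But convexity of the
   border gives H + tau <= H for tau = w + 1 - rho(0), and translating [g] by
   tau multiplies L g by e^(p tau): so S g (w) is also the value at the fixed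
   point rho(0) - 1 of the partial sum of a function bounded by sup |g|.

   That partial sums do not depend on the loop follows from primitives in the
   two half-planes enlarged by discs around b1 and b2, the winding number
   determining the orientation of the two arcs of the loop. *)

(** All large n share a disc around a point b outside R0: since [beta] tends to +oo and each
    enumeration increases, only finitely many indices k can bring a term of [betan n] near b, so one
    interval around b avoids every [Rn n] with n large. The exponent N comes from the logarithm: the
    admissible ray starts about k ln (1 / |y|) further left, where e^(-p w) has size at most a
    constant times |y|^(-k P) when |p| <= P. A bound for |p| thus turns the loss into a fixed power
    of |y|, uniform in g. That bound degenerates on the axis, where the extension is only known to
    be holomorphic; a factor vanishing where the circle crosses the axis restores a finite majorant.
    Two obstacles shape the development. Elements of E_0(H) are merely continuous on the border, so
    path independence cannot rest on a primitive of the integrand near the path. And [laplace] is a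
    total function with meaningless values on R^+, so a value must be chosen at each regular point
    of the axis ([hol_ext]) before a loop may cross it. *)

Definition cderiv (f : C -> C) (p l : C) : Prop :=
  forall eps : R, 0 < eps -> exists d : R, 0 < d /\
  forall q : C, Cmod (q - p) < d ->
  Cmod (f q - f p - l * (q - p)) <= eps * Cmod (q - p).

Definition differentiable (f : C -> C) (p : C) : Prop := exists l : C, cderiv f p l.

Definition seg (a b t : R) : Prop := Rmin a b <= t <= Rmax a b.

(** Continuity relative to [D], hence one-sided at the ends of an interval. [ccont] is the analogue
    on subsets of C, used on closures, outside of which the values of a function carry no
    information. *)
Definition rcont (D : R -> Prop) (f : R -> C) : Prop :=
  forall t, D t -> forall eps : R, 0 < eps -> exists d : R, 0 < d /\
  forall t', D t' -> Rabs (t' - t) < d -> Cmod (f t' - f t) < eps.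

Definition ccont (D : C -> Prop) (f : C -> C) : Prop :=
  forall p, D p -> forall eps : R, 0 < eps -> exists d : R, 0 < d /\
  forall q, D q -> Cmod (q - p) < d -> Cmod (f q - f p) < eps.

Definition cint (f : R -> C) (a b : R) : C := RInt (V := C_R_CompleteNormedModule) f a b.

Lemma Cmod_dist_tri (x y z : C) : Cmod (x - z) <= Cmod (x - y) + Cmod (y - z).
Proof.
replace (x - z)%C with ((x - y) + (y - z))%C by ring.
apply Cmod_triangle.
Qed.

Lemma Cmod_diag (x : C) : Cmod (x - x) = 0.
Proof. replace (x - x)%C with (RtoC 0) by ring. apply Cmod_0. Qed.

Lemma lt_Rmin_l {x a b : R} : x < Rmin a b -> x < a.
Proof. intros h. eapply Rlt_le_trans; [exact h|apply Rmin_l]. Qed.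

Lemma lt_Rmin_r {x a b : R} : x < Rmin a b -> x < b.
Proof. intros h. eapply Rlt_le_trans; [exact h|apply Rmin_r]. Qed.

Lemma Cmod_minus_sym (x y : C) : Cmod (x - y) = Cmod (y - x).
Proof. rewrite <- Cmod_opp. f_equal; ring. Qed.

Lemma Cmod_minus_le (x y : C) : Cmod (x - y) <= Cmod x + Cmod y.
Proof. rewrite <- (Cmod_opp y). apply Cmod_triangle. Qed.

Lemma Cmod_rev_tri (x y : C) : Cmod x - Cmod y <= Cmod (x - y).
Proof.
assert (h := Cmod_triangle (x - y) y).
replace (x - y + y)%C with x in h by ring. lra.
Qed.

Lemma im_le_Cmod (c : C) : Rabs (Im c) <= Cmod c.
Proof. eapply Rle_trans; [apply Rmax_r | apply (Rmax_Cmod c)]. Qed.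

Lemma Cmod_le_abs (x y : R) : Cmod (x, y) <= Rabs x + Rabs y.
Proof.
replace (x, y) with (RtoC x + Ci * RtoC y)%C.
- eapply Rle_trans; [apply Cmod_triangle|].
  rewrite Cmod_mult, Cmod_Ci, !Cmod_R; lra.
- unfold Ci, RtoC, Cmult, Cplus; simpl; f_equal; ring.
Qed.

Lemma C_eq_parts (z w : C) : Re z = Re w -> Im z = Im w -> z = w.
Proof. destruct z, w; simpl; intros; subst; reflexivity. Qed.

Lemma Cmod_le_eps_eq (x y : C) : (forall eps, 0 < eps -> Cmod (x - y) <= eps) -> x = y.
Proof.
intros h.
destruct (Req_dec (Cmod (x - y)) 0) as [e|e].
- apply Cmod_eq_0 in e.
  replace x with ((x - y) + y)%C by ring. rewrite e; ring.
- assert (h1 := Cmod_ge_0 (x - y)).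
  specialize (h (Cmod (x - y) / 2)). lra.
Qed.

(** In the absolute ring C both the balls and the norm are given by [Cmod], so unfolding the filters
    yields the epsilon form up to the order of a product. *)
Lemma is_derive_C_cderiv (f : C -> C) (p l : C) :
  @is_derive C_AbsRing C_NormedModule f p l <-> cderiv f p l.
Proof.
split.
- intros [_ h] eps he.
  assert (hp : is_filter_lim (locally (T := AbsRing_UniformSpace C_AbsRing) p) p).
  { intros P hP. exact hP. }
  specialize (h p hp (mkposreal eps he)).
  destruct h as [d hd].
  exists d; split; [apply cond_pos|].
  intros q hq.
  specialize (hd q hq).
  rewrite (Cmult_comm l). exact hd.
- intros h; split.
  + apply is_linear_scal_l.
  + intros x hx eps.
    assert (ex : x = p).
    { symmetry. apply (is_filter_lim_locally_unique
        (K := C_AbsRing) (V := AbsRing_NormedModule C_AbsRing) p x hx). }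
    subst x.
    destruct (h eps (cond_pos eps)) as [d [hd1 hd2]].
    exists (mkposreal d hd1).
    intros q hq. specialize (hd2 q hq).
    rewrite (Cmult_comm l) in hd2. exact hd2.
Qed.

Lemma holomorphic_at_iff (f : C -> C) (p : C) : holomorphic_at f p <-> differentiable f p.
Proof.
split; intros [l h]; exists l; apply is_derive_C_cderiv; exact h.
Qed.

Lemma cderiv_cont (f : C -> C) (p l : C) : cderiv f p l ->
  forall eps, 0 < eps -> exists d, 0 < d /\ forall q, Cmod (q - p) < d -> Cmod (f q - f p) < eps.
Proof.
intros h eps he.
destruct (h 1 Rlt_0_1) as [d [hd h1]].
assert (hl := Cmod_ge_0 l).
exists (Rmin d (eps / (Cmod l + 1) / 2)); split.
- apply Rmin_pos; [lra|]. apply Rdiv_lt_0_compat; [|lra]. apply Rdiv_lt_0_compat; lra.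
- intros q hq.
  specialize (h1 q (lt_Rmin_l hq)).
  assert (h2 := lt_Rmin_r hq).
  replace (f q - f p)%C with ((f q - f p - l * (q - p)) + l * (q - p))%C by ring.
  eapply Rle_lt_trans; [apply Cmod_triangle|].
  rewrite Cmod_mult.
  assert (h3 : Cmod (q - p) * (Cmod l + 1) < eps).
  { apply Rlt_le_trans with (eps / (Cmod l + 1) / 2 * (Cmod l + 1)).
    - apply Rmult_lt_compat_r; lra.
    - replace (eps / (Cmod l + 1) / 2 * (Cmod l + 1)) with (eps / 2) by (field; lra). lra. }
  lra.
Qed.

Lemma cderiv_ext_loc (f g : C -> C) (p l : C) (r : R) : 0 < r ->
  (forall q, Cmod (q - p) < r -> f q = g q) -> cderiv f p l -> cderiv g p l.
Proof.
intros hr he h eps heps.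
destruct (h eps heps) as [d [hd h1]].
exists (Rmin d r); split; [apply Rmin_pos; lra|].
intros q hq.
rewrite <- (he q), <- (he p).
- apply h1. exact (lt_Rmin_l hq).
- rewrite Cmod_diag; lra.
- exact (lt_Rmin_r hq).
Qed.

Lemma cderiv_eq (f : C -> C) (p l m : C) : cderiv f p l -> l = m -> cderiv f p m.
Proof. intros h <-; exact h. Qed.

Lemma cderiv_const (c p : C) : cderiv (fun _ => c) p 0.
Proof.
intros eps he; exists 1; split; [lra|]; intros q _.
replace (c - c - 0 * (q - p))%C with (RtoC 0) by ring. rewrite Cmod_0.
apply Rmult_le_pos; [lra|apply Cmod_ge_0].
Qed.

Lemma cderiv_id (p : C) : cderiv (fun z => z) p 1.
Proof.
intros eps he; exists 1; split; [lra|]; intros q _.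
replace (q - p - 1 * (q - p))%C with (RtoC 0) by ring. rewrite Cmod_0.
apply Rmult_le_pos; [lra|apply Cmod_ge_0].
Qed.

Lemma cderiv_plus (f g : C -> C) (p l m : C) : cderiv f p l -> cderiv g p m ->
  cderiv (fun z => f z + g z)%C p (l + m).
Proof.
intros hf hg eps he.
destruct (hf (eps / 2)) as [d1 [hd1 h1]]; [lra|].
destruct (hg (eps / 2)) as [d2 [hd2 h2]]; [lra|].
exists (Rmin d1 d2); split; [apply Rmin_pos; lra|].
intros q hq.
specialize (h1 q (lt_Rmin_l hq)).
specialize (h2 q (lt_Rmin_r hq)).
replace (f q + g q - (f p + g p) - (l + m) * (q - p))%C with
  ((f q - f p - l * (q - p)) + (g q - g p - m * (q - p)))%C by ring.
eapply Rle_trans; [apply Cmod_triangle|]. lra.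
Qed.

Lemma cderiv_comp (f g : C -> C) (p l m : C) : cderiv f p l -> cderiv g (f p) m ->
  cderiv (fun z => g (f z)) p (m * l).
Proof.
intros hf hg eps he.
assert (hl := Cmod_ge_0 l). assert (hm := Cmod_ge_0 m).
set (e1 := eps / 2 / (Cmod m + 1)).
assert (he1 : 0 < e1) by (unfold e1; apply Rdiv_lt_0_compat; lra).
set (e2 := eps / 2 / (Cmod l + e1 + 1)).
assert (he2 : 0 < e2) by (unfold e2; apply Rdiv_lt_0_compat; lra).
destruct (hf e1 he1) as [d1 [hd1 h1]].
destruct (hg e2 he2) as [d2 [hd2 h2]].
destruct (cderiv_cont f p l hf d2 hd2) as [d3 [hd3 h3]].
exists (Rmin d1 d3); split; [apply Rmin_pos; lra|].
intros q hq.
specialize (h1 q (lt_Rmin_l hq)).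
specialize (h3 q (lt_Rmin_r hq)).
specialize (h2 (f q) h3).
assert (hq0 := Cmod_ge_0 (q - p)).
assert (h4 : Cmod (f q - f p) <= (Cmod l + e1 + 1) * Cmod (q - p)).
{ replace (f q - f p)%C with ((f q - f p - l * (q - p)) + l * (q - p))%C by ring.
  eapply Rle_trans; [apply Cmod_triangle|]. rewrite Cmod_mult. lra. }
replace (g (f q) - g (f p) - m * l * (q - p))%C with
  ((g (f q) - g (f p) - m * (f q - f p)) + m * (f q - f p - l * (q - p)))%C by ring.
eapply Rle_trans; [apply Cmod_triangle|]. rewrite Cmod_mult.
assert (h5 : e2 * Cmod (f q - f p) <= eps / 2 * Cmod (q - p)).
{ apply Rle_trans with (e2 * ((Cmod l + e1 + 1) * Cmod (q - p))).
  - apply Rmult_le_compat_l; lra.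
  - right. unfold e2. field. lra. }
assert (h6 : Cmod m * Cmod (f q - f p - l * (q - p)) <= eps / 2 * Cmod (q - p)).
{ apply Rle_trans with ((Cmod m + 1) * (e1 * Cmod (q - p))).
  - apply Rmult_le_compat; try lra. apply Cmod_ge_0.
  - right. unfold e1. field. lra. }
lra.
Qed.

Lemma cderiv_mult (f g : C -> C) (p l m : C) : cderiv f p l -> cderiv g p m ->
  cderiv (fun z => f z * g z)%C p (l * g p + f p * m).
Proof.
intros hf hg eps he.
assert (h0 := Cmod_ge_0 (g p)). assert (hl := Cmod_ge_0 l). assert (hm := Cmod_ge_0 (f p)).
set (e1 := eps / 3 / (Cmod (g p) + 1)).
assert (he1 : 0 < e1) by (unfold e1; apply Rdiv_lt_0_compat; lra).
set (e2 := eps / 3 / (Cmod (f p) + 1)).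
assert (he2 : 0 < e2) by (unfold e2; apply Rdiv_lt_0_compat; lra).
set (e3 := eps / 3 / (Cmod l + e1 + 1)).
assert (he3 : 0 < e3) by (unfold e3; apply Rdiv_lt_0_compat; lra).
destruct (hf e1 he1) as [d1 [hd1 h1]].
destruct (hg e2 he2) as [d2 [hd2 h2]].
destruct (cderiv_cont g p m hg e3 he3) as [d3 [hd3 h3]].
exists (Rmin d1 (Rmin d2 d3)); split; [repeat apply Rmin_pos; lra|].
intros q hq.
specialize (h1 q (lt_Rmin_l hq)).
assert (hq' := lt_Rmin_r hq).
specialize (h2 q (Rlt_le_trans _ _ _ hq' (Rmin_l _ _))).
specialize (h3 q (Rlt_le_trans _ _ _ hq' (Rmin_r _ _))).
assert (hq0 := Cmod_ge_0 (q - p)).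
assert (h4 : Cmod (f q - f p) <= (Cmod l + e1 + 1) * Cmod (q - p)).
{ replace (f q - f p)%C with ((f q - f p - l * (q - p)) + l * (q - p))%C by ring.
  eapply Rle_trans; [apply Cmod_triangle|]. rewrite Cmod_mult. lra. }
replace (f q * g q - f p * g p - (l * g p + f p * m) * (q - p))%C with
  ((f q - f p - l * (q - p)) * g p + f p * (g q - g p - m * (q - p))
   + (f q - f p) * (g q - g p))%C by ring.
eapply Rle_trans; [apply Cmod_triangle|].
eapply Rle_trans; [apply Rplus_le_compat_r; apply Cmod_triangle|].
rewrite !Cmod_mult.
assert (h5 : Cmod (f q - f p - l * (q - p)) * Cmod (g p) <= eps / 3 * Cmod (q - p)).
{ apply Rle_trans with ((e1 * Cmod (q - p)) * (Cmod (g p) + 1)).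
  - apply Rmult_le_compat; try lra. apply Cmod_ge_0.
  - right. unfold e1. field. lra. }
assert (h6 : Cmod (f p) * Cmod (g q - g p - m * (q - p)) <= eps / 3 * Cmod (q - p)).
{ apply Rle_trans with ((Cmod (f p) + 1) * (e2 * Cmod (q - p))).
  - apply Rmult_le_compat; try lra. apply Cmod_ge_0.
  - right. unfold e2. field. lra. }
assert (h7 : Cmod (f q - f p) * Cmod (g q - g p) <= eps / 3 * Cmod (q - p)).
{ apply Rle_trans with (((Cmod l + e1 + 1) * Cmod (q - p)) * e3).
  - apply Rmult_le_compat; try lra; apply Cmod_ge_0.
  - right. unfold e3. field. lra. }
lra.
Qed.

Lemma cderiv_scal (f : C -> C) (c p l : C) : cderiv f p l ->
  cderiv (fun z => c * f z)%C p (c * l).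
Proof.
intros h. replace (c * l)%C with (0 * f p + c * l)%C by ring.
apply (cderiv_mult (fun _ => c) f); [apply cderiv_const|exact h].
Qed.

Lemma cderiv_minus (f g : C -> C) (p l m : C) : cderiv f p l -> cderiv g p m ->
  cderiv (fun z => f z - g z)%C p (l - m).
Proof.
intros hf hg.
replace (l - m)%C with (l + (-1) * m)%C by ring.
apply (cderiv_ext_loc (fun z => f z + (-1) * g z)%C _ _ _ 1 Rlt_0_1).
- intros; ring.
- apply cderiv_plus; [exact hf|apply cderiv_scal; exact hg].
Qed.

Lemma cderiv_inv (p : C) : p <> 0 -> cderiv (fun z => / z)%C p (- / (p * p)).
Proof.
intros hp eps he.
assert (h0 : 0 < Cmod p) by (apply Cmod_gt_0; exact hp).
set (P := Cmod p) in *.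
assert (hP3 : 0 < eps * (P * P * P) / 2).
{ assert (0 < P * P * P) by (repeat apply Rmult_lt_0_compat; lra).
  apply Rdiv_lt_0_compat; [apply Rmult_lt_0_compat|]; lra. }
(* The remainder is exactly (q - p)^2 / (q p^2), and |q| >= P / 2 on this disc; the second radius
   makes its quotient by |q - p| at most eps. *)
exists (Rmin (P / 2) (eps * (P * P * P) / 2)); split.
- apply Rmin_pos; lra.
- intros q hq.
  assert (h1 := lt_Rmin_l hq).
  assert (h2 := lt_Rmin_r hq).
  assert (h3 : P / 2 <= Cmod q).
  { assert (h := Cmod_rev_tri p q). rewrite Cmod_minus_sym in h. fold P in h. lra. }
  assert (hq0 : q <> 0).
  { apply Cmod_gt_0. lra. }
  replace (/ q - / p - - / (p * p) * (q - p))%C with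
    ((q - p) * ((q - p) * / (q * (p * p))))%C by (field; auto).
  rewrite Rmult_comm, Cmod_mult.
  apply Rmult_le_compat_l; [apply Cmod_ge_0|].
  assert (hqpp : (q * (p * p))%C <> 0).
  { repeat apply Cmult_neq_0; auto. }
  rewrite Cmod_mult, Cmod_inv, !Cmod_mult by exact hqpp.
  fold P.
  apply Rle_trans with (eps * (P * P * P) / 2 * / (P / 2 * (P * P))).
  + apply Rmult_le_compat; try lra.
    * apply Cmod_ge_0.
    * left; apply Rinv_0_lt_compat. assert (0 < P * P) by (apply Rmult_lt_0_compat; lra).
      apply Rmult_lt_0_compat; lra.
    * apply Rinv_le_contravar; [repeat apply Rmult_lt_0_compat; lra|].
      apply Rmult_le_compat_r; [|lra].
      apply Rmult_le_pos; lra.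
  + right. field. lra.
Qed.

(** * The complex exponential *)

Lemma Cexp_plus (z w : C) : Cexp (z + w) = (Cexp z * Cexp w)%C.
Proof.
destruct z as [x y], w as [x' y']. unfold Cexp; simpl.
rewrite exp_plus, cos_plus, sin_plus.
apply C_eq_parts; simpl; ring.
Qed.

Lemma Cexp_0 : Cexp 0 = 1.
Proof.
unfold Cexp; simpl. rewrite exp_0, cos_0, sin_0.
apply C_eq_parts; simpl; ring.
Qed.

Lemma Cmod_Cexp (z : C) : Cmod (Cexp z) = exp (Re z).
Proof.
unfold Cexp, Cmod; simpl.
replace (exp (Re z) * cos (Im z) * (exp (Re z) * cos (Im z) * 1) +
  exp (Re z) * sin (Im z) * (exp (Re z) * sin (Im z) * 1))
  with (exp (Re z) * exp (Re z) * (Rsqr (sin (Im z)) + Rsqr (cos (Im z)))) by (unfold Rsqr; ring).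
rewrite sin2_cos2, Rmult_1_r. apply sqrt_square. left; apply exp_pos.
Qed.

(** * Derivatives and integrals of complex functions of a real variable *)

Definition is_cint (f : R -> C) (a b : R) (l : C) : Prop :=
  is_RInt (V := C_R_NormedModule) f a b l.

Definition rderiv (f : R -> C) (t : R) (l : C) : Prop :=
  @is_derive R_AbsRing C_R_NormedModule f t l.

Lemma norm_C_R (x : C) : @norm R_AbsRing C_R_NormedModule x = Cmod x.
Proof. symmetry; apply Cmod_norm. Qed.

Lemma rderiv_iff (f : R -> C) (t : R) (l : C) :
  rderiv f t l <->
  forall eps : R, 0 < eps -> exists d : R, 0 < d /\
  forall t' : R, Rabs (t' - t) < d ->
  Cmod (f t' - f t - RtoC (t' - t) * l) <= eps * Rabs (t' - t).
Proof.
assert (key : forall t', norm (minus (minus (f t') (f t)) (scal (minus t' t) l) : C_R_NormedModule)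
  = Cmod (f t' - f t - RtoC (t' - t) * l)).
{ intros t'. rewrite norm_C_R. f_equal. apply C_eq_parts;
  unfold minus, plus, opp, scal; simpl;
  unfold scal, mult; simpl; unfold mult; simpl; ring. }
split.
- intros [_ h] eps he.
  assert (hp : is_filter_lim (locally (T := R_UniformSpace) t) t) by (intros P hP; exact hP).
  destruct (h t hp (mkposreal eps he)) as [d hd].
  exists d; split; [apply cond_pos|].
  intros t' ht. rewrite <- key. exact (hd t' ht).
- intros h; split.
  + apply is_linear_scal_l.
  + intros x hx eps.
    assert (ex : x = t).
    { symmetry. apply (is_filter_lim_locally_unique
        (K := R_AbsRing) (V := R_NormedModule) t x hx). }
    subst x.
    destruct (h eps (cond_pos eps)) as [d [hd1 hd2]].
    exists (mkposreal d hd1).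
    intros t' ht. change (norm (minus (minus (f t') (f t)) (scal (minus t' t) l) : C_R_NormedModule)
      <= eps * Rabs (t' - t)). rewrite key. exact (hd2 t' ht).
Qed.

Lemma rderiv_parts (f : R -> C) (t : R) (l : C) : rderiv f t l ->
  is_derive (fun s : R => Re (f s)) t (Re l) /\ is_derive (fun s : R => Im (f s)) t (Im l).
Proof.
intros h. rewrite rderiv_iff in h.
split; apply is_derive_Reals; intros eps he;
destruct (h (eps / 2)) as [d [hd h1]]; try lra;
exists (mkposreal d hd); intros k hk hkd; simpl in hkd;
specialize (h1 (t + k)); replace (t + k - t) with k in h1 by ring;
specialize (h1 hkd).
- assert (e : (Re (f (t + k)%R) - Re (f t)) / k - Re l
    = Re (f (t + k)%R - f t - RtoC k * l)%C / k).
  { destruct (f (t + k)%R), (f t), l; simpl; field; auto. }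
  rewrite e. unfold Rdiv; rewrite Rabs_mult, Rabs_inv.
  assert (hk' : 0 < Rabs k) by (apply Rabs_pos_lt; auto).
  apply Rle_lt_trans with (eps / 2 * Rabs k * / Rabs k).
  + apply Rmult_le_compat_r; [left; apply Rinv_0_lt_compat; auto|].
    eapply Rle_trans; [apply re_le_Cmod|exact h1].
  + rewrite Rmult_assoc, Rinv_r; lra.
- assert (e : (Im (f (t + k)%R) - Im (f t)) / k - Im l
    = Im (f (t + k)%R - f t - RtoC k * l)%C / k).
  { destruct (f (t + k)%R), (f t), l; simpl; field; auto. }
  rewrite e. unfold Rdiv; rewrite Rabs_mult, Rabs_inv.
  assert (hk' : 0 < Rabs k) by (apply Rabs_pos_lt; auto).
  apply Rle_lt_trans with (eps / 2 * Rabs k * / Rabs k).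
  + apply Rmult_le_compat_r; [left; apply Rinv_0_lt_compat; auto|].
    eapply Rle_trans; [apply im_le_Cmod|exact h1].
  + rewrite Rmult_assoc, Rinv_r; lra.
Qed.

Lemma rderiv_pair (u v : R -> R) (t du dv : R) : is_derive u t du -> is_derive v t dv ->
  rderiv (fun s => (u s, v s)) t (du, dv).
Proof.
intros hu hv. apply rderiv_iff. intros eps he.
destruct hu as [_ hu]. destruct hv as [_ hv].
assert (hp : is_filter_lim (locally (T := R_UniformSpace) t) t) by (intros P hP; exact hP).
assert (he2 : 0 < eps / 2) by lra.
destruct (hu t hp (mkposreal _ he2)) as [d1 h1].
destruct (hv t hp (mkposreal _ he2)) as [d2 h2].
exists (Rmin d1 d2); split; [apply Rmin_pos; apply cond_pos|].
intros t' ht.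
specialize (h1 t' (lt_Rmin_l ht)).
specialize (h2 t' (lt_Rmin_r ht)).
change (Rabs ((u t' + - u t) + - ((t' + - t) * du)) <= eps / 2 * Rabs (t' + - t)) in h1.
change (Rabs ((v t' + - v t) + - ((t' + - t) * dv)) <= eps / 2 * Rabs (t' + - t)) in h2.
replace ((u t', v t') - (u t, v t) - RtoC (t' - t) * (du, dv))%C with
  ((u t' + - u t) + - ((t' + - t) * du), (v t' + - v t) + - ((t' + - t) * dv)).
- eapply Rle_trans; [apply Cmod_le_abs|]. unfold Rminus. lra.
- apply C_eq_parts; simpl; ring.
Qed.

Lemma rderiv_comp (G : C -> C) (gam : R -> C) (t : R) (l m : C) :
  rderiv gam t l -> cderiv G (gam t) m -> rderiv (fun s => G (gam s)) t (m * l)%C.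
Proof.
rewrite !rderiv_iff. intros hf hg eps he.
assert (hl := Cmod_ge_0 l). assert (hm := Cmod_ge_0 m).
set (e1 := eps / 2 / (Cmod m + 1)).
assert (he1 : 0 < e1) by (unfold e1; apply Rdiv_lt_0_compat; lra).
set (e2 := eps / 2 / (Cmod l + e1 + 1)).
assert (he2 : 0 < e2) by (unfold e2; apply Rdiv_lt_0_compat; lra).
destruct (hf e1 he1) as [d1 [hd1 h1]].
destruct (hg e2 he2) as [d2 [hd2 h2]].
exists (Rmin d1 (d2 / (Cmod l + e1 + 1))); split.
{ apply Rmin_pos; [lra|]. apply Rdiv_lt_0_compat; lra. }
intros q hq.
specialize (h1 q (lt_Rmin_l hq)).
assert (h3 := lt_Rmin_r hq).
assert (hq0 := Rabs_pos (q - t)).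
assert (h4 : Cmod (gam q - gam t) <= (Cmod l + e1 + 1) * Rabs (q - t)).
{ replace (gam q - gam t)%C with ((gam q - gam t - RtoC (q - t) * l) + RtoC (q - t) * l)%C by ring.
  eapply Rle_trans; [apply Cmod_triangle|]. rewrite Cmod_mult, Cmod_R. lra. }
assert (h4' : Cmod (gam q - gam t) < d2).
{ eapply Rle_lt_trans; [exact h4|].
  apply Rlt_le_trans with ((Cmod l + e1 + 1) * (d2 / (Cmod l + e1 + 1))).
  - apply Rmult_lt_compat_l; lra.
  - right; field; lra. }
specialize (h2 (gam q) h4').
replace (G (gam q) - G (gam t) - RtoC (q - t) * (m * l))%C with
  ((G (gam q) - G (gam t) - m * (gam q - gam t)) + m * (gam q - gam t - RtoC (q - t) * l))%C by ring.
eapply Rle_trans; [apply Cmod_triangle|]. rewrite Cmod_mult.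
assert (h5 : e2 * Cmod (gam q - gam t) <= eps / 2 * Rabs (q - t)).
{ apply Rle_trans with (e2 * ((Cmod l + e1 + 1) * Rabs (q - t))).
  - apply Rmult_le_compat_l; lra.
  - right. unfold e2. field. lra. }
assert (h6 : Cmod m * Cmod (gam q - gam t - RtoC (q - t) * l) <= eps / 2 * Rabs (q - t)).
{ apply Rle_trans with ((Cmod m + 1) * (e1 * Rabs (q - t))).
  - apply Rmult_le_compat; try lra. apply Cmod_ge_0.
  - right. unfold e1. field. lra. }
lra.
Qed.

Lemma rderiv_eq (f : R -> C) (t : R) (l m : C) : rderiv f t l -> l = m -> rderiv f t m.
Proof. intros h <-; exact h. Qed.

Lemma rderiv_line (w v : C) (t : R) : rderiv (fun s => w + RtoC s * v)%C t v.
Proof.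
apply rderiv_iff. intros eps he. exists 1; split; [lra|]. intros t' _.
replace (w + RtoC t' * v - (w + RtoC t * v) - RtoC (t' - t) * v)%C with (RtoC 0).
- rewrite Cmod_0. apply Rmult_le_pos; [lra|apply Rabs_pos].
- rewrite RtoC_minus. ring.
Qed.

Lemma is_cint_ext (f g : R -> C) (a b : R) (l : C) :
  (forall t, Rmin a b < t < Rmax a b -> f t = g t) -> is_cint f a b l -> is_cint g a b l.
Proof. apply is_RInt_ext. Qed.

Lemma is_cint_minus (f g : R -> C) (a b : R) (l m : C) : is_cint f a b l -> is_cint g a b m ->
  is_cint (fun t => f t - g t)%C a b (l - m)%C.
Proof. apply (is_RInt_minus (V := C_R_NormedModule)). Qed.

Lemma is_cint_parts (f : R -> C) (a b : R) (l : C) :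
  is_cint f a b l <-> is_RInt (fun t => Re (f t)) a b (Re l) /\ is_RInt (fun t => Im (f t)) a b (Im l).
Proof.
split.
- intros h; split.
  + apply (is_RInt_fct_extend_fst (U := R_NormedModule) (V := R_NormedModule) f). exact h.
  + apply (is_RInt_fct_extend_snd (U := R_NormedModule) (V := R_NormedModule) f). exact h.
- intros [h1 h2]. destruct l as [l1 l2].
  apply (is_RInt_fct_extend_pair (U := R_NormedModule) (V := R_NormedModule) f); assumption.
Qed.

Lemma is_cint_scal (f : R -> C) (a b : R) (c l : C) : is_cint f a b l ->
  is_cint (fun t => c * f t)%C a b (c * l)%C.
Proof.
rewrite !is_cint_parts. intros [h1 h2].
destruct c as [c1 c2]; simpl.
split.
- apply (is_RInt_minus (V := R_NormedModule)); apply (is_RInt_scal (V := R_NormedModule)); assumption.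
- apply (is_RInt_plus (V := R_NormedModule)); apply (is_RInt_scal (V := R_NormedModule)); assumption.
Qed.

Lemma is_cint_chasles (f : R -> C) (a b c : R) (l m : C) :
  is_cint f a b l -> is_cint f b c m -> is_cint f a c (l + m)%C.
Proof. apply (is_RInt_Chasles (V := C_R_NormedModule)). Qed.

Lemma is_cint_swap (f : R -> C) (a b : R) (l : C) : is_cint f a b l -> is_cint f b a (- l)%C.
Proof. intros h. apply (is_RInt_swap (V := C_R_NormedModule)). exact h. Qed.

Lemma is_cint_point (f : R -> C) (a : R) : is_cint f a a 0.
Proof. apply (is_RInt_point (V := C_R_NormedModule)). Qed.

Lemma is_cint_const (c : C) (a b : R) : is_cint (fun _ => c) a b (RtoC (b - a) * c)%C.
Proof.
replace (RtoC (b - a) * c)%C with (scal (b - a) c : C_R_NormedModule).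
- apply (is_RInt_const (V := C_R_NormedModule)).
- apply C_eq_parts; unfold scal; simpl; unfold scal; simpl; unfold mult; simpl; ring.
Qed.

Lemma is_cint_cint (f : R -> C) (a b : R) (l : C) : is_cint f a b l -> cint f a b = l.
Proof. apply (is_RInt_unique (V := C_R_CompleteNormedModule)). Qed.

Lemma is_cint_unique (f : R -> C) (a b : R) (l m : C) : is_cint f a b l -> is_cint f a b m -> l = m.
Proof. intros h1 h2. apply is_cint_cint in h1. apply is_cint_cint in h2. congruence. Qed.

Lemma is_cint_bound (f : R -> C) (g : R -> R) (a b : R) (l : C) (m : R) : a <= b ->
  (forall t, a <= t <= b -> Cmod (f t) <= g t) -> is_cint f a b l -> is_RInt g a b m -> Cmod l <= m.
Proof.
intros hab hb h1 h2. rewrite <- norm_C_R.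
apply (norm_RInt_le (V := C_R_NormedModule) f g a b); auto.
intros t ht. rewrite norm_C_R. auto.
Qed.

Lemma is_cint_bound_const (f : R -> C) (a b : R) (l : C) (m : R) : 
  (forall t, seg a b t -> Cmod (f t) <= m) -> is_cint f a b l -> Cmod l <= Rabs (b - a) * m.
Proof.
intros hb h1.
destruct (Rle_dec a b) as [hab|hab].
- rewrite Rabs_pos_eq by lra. rewrite <- norm_C_R.
  apply (norm_RInt_le_const (V := C_R_NormedModule) f a b); auto.
  intros t ht. rewrite norm_C_R. apply hb. unfold seg. rewrite Rmin_left, Rmax_right; lra.
- rewrite Rabs_left by lra. rewrite <- Cmod_opp, <- norm_C_R.
  replace (- (b - a)) with (a - b) by ring.
  apply (norm_RInt_le_const (V := C_R_NormedModule) f b a); try lra.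
  + intros t ht. rewrite norm_C_R. apply hb. unfold seg. rewrite Rmin_right, Rmax_left; lra.
  + apply is_cint_swap; exact h1.
Qed.

(* Composition with [clamp a b] extends functions on [a, b] to continuous functions on R. *)
Definition clamp (a b t : R) : R := Rmax a (Rmin b t).

Lemma clamp_in (a b t : R) : a <= b -> a <= clamp a b t <= b.
Proof.
intros h; unfold clamp; split; [apply Rmax_l|].
apply Rmax_lub; [lra|apply Rmin_l].
Qed.

Lemma clamp_id (a b t : R) : a <= t <= b -> clamp a b t = t.
Proof. intros h; unfold clamp. rewrite Rmin_right, Rmax_right; lra. Qed.

Lemma clamp_lip (a b t t' : R) : Rabs (clamp a b t' - clamp a b t) <= Rabs (t' - t).
Proof.
unfold clamp, Rmax, Rmin.
repeat destruct Rle_dec; unfold Rabs; repeat destruct Rcase_abs; lra.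
Qed.

Lemma rcont_clamp (a b : R) (f : R -> C) (t : R) : a <= b -> rcont (seg a b) f ->
  continuous (T := R_UniformSpace) (U := C_UniformSpace) (fun s => f (clamp a b s)) t /\
  continuous (fun s => Re (f (clamp a b s))) t /\ continuous (fun s => Im (f (clamp a b s))) t.
Proof.
intros hab h.
assert (hs : forall s, seg a b (clamp a b s)).
{ intros s; unfold seg. rewrite Rmin_left, Rmax_right by lra. apply clamp_in; lra. }
assert (key : forall eps, 0 < eps -> exists d, 0 < d /\
  forall t', Rabs (t' - t) < d -> Cmod (f (clamp a b t') - f (clamp a b t)) < eps).
{ intros eps he. destruct (h (clamp a b t) (hs t) eps he) as [d [hd h1]].
  exists d; split; auto. intros t' ht'. apply h1; auto.
  eapply Rle_lt_trans; [apply clamp_lip|exact ht']. }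
split; [|split]; intros P [eps hP]; destruct (key eps (cond_pos eps)) as [d [hd h1]];
exists (mkposreal d hd); intros t' ht'; apply hP; specialize (h1 t' ht').
- split; (eapply Rle_lt_trans; [|exact h1]).
  + apply (re_le_Cmod (f (clamp a b t') - f (clamp a b t))%C).
  + apply (im_le_Cmod (f (clamp a b t') - f (clamp a b t))%C).
- eapply Rle_lt_trans; [|exact h1]. apply (re_le_Cmod (f (clamp a b t') - f (clamp a b t))%C).
- eapply Rle_lt_trans; [|exact h1]. apply (im_le_Cmod (f (clamp a b t') - f (clamp a b t))%C).
Qed.

Lemma rcont_sub (D D' : R -> Prop) (f : R -> C) : (forall t, D' t -> D t) -> rcont D f -> rcont D' f.
Proof.
intros hs h t ht eps he. destruct (h t (hs t ht) eps he) as [d [hd h1]].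
exists d; split; auto.
Qed.

Lemma seg_sym (a b t : R) : seg a b t -> seg b a t.
Proof. unfold seg. rewrite (Rmin_comm a), (Rmax_comm a). auto. Qed.

Lemma seg_le (a b t : R) : a <= b -> seg a b t <-> a <= t <= b.
Proof. intros h; unfold seg. rewrite Rmin_left, Rmax_right by lra. tauto. Qed.

Lemma seg_l (a b : R) : seg a b a.
Proof. unfold seg; split; [apply Rmin_l|apply Rmax_l]. Qed.

Lemma seg_r (a b : R) : seg a b b.
Proof. unfold seg; split; [apply Rmin_r|apply Rmax_r]. Qed.

Lemma rcont_ex_le (a b : R) (f : R -> C) : a <= b -> rcont (seg a b) f -> exists l, is_cint f a b l.
Proof.
intros hab h.
assert (h1 : ex_RInt (V := C_R_CompleteNormedModule) (fun s => f (clamp a b s)) a b).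
{ apply (ex_RInt_continuous (V := C_R_CompleteNormedModule)).
  intros z _. apply rcont_clamp; auto. }
destruct h1 as [l hl]. exists l.
apply is_cint_ext with (2 := hl).
rewrite Rmin_left, Rmax_right by lra. intros t ht. rewrite clamp_id; auto. lra.
Qed.

Lemma rcont_ex (a b : R) (f : R -> C) : rcont (seg a b) f -> is_cint f a b (cint f a b).
Proof.
intros h.
enough (hx : exists l, is_cint f a b l).
{ destruct hx as [l hl]. rewrite (is_cint_cint _ _ _ _ hl). exact hl. }
destruct (Rle_dec a b) as [hab|hab].
- apply rcont_ex_le; auto.
- destruct (rcont_ex_le b a f) as [l hl].
  + lra.
  + apply rcont_sub with (2 := h). intros t; apply seg_sym.
  + exists (- l)%C. apply is_cint_swap; exact hl.
Qed.

(** The derivative of F is unknown at the ends. The difference between the integral of f and F is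
    continuous on [a, b] with zero derivative inside, so the mean value theorem makes its increment
    vanish. *)
Lemma FTC_open (F f : R -> R) (a b : R) : a <= b ->
  (forall t, continuous F t) -> (forall t, continuous f t) ->
  (forall t, a < t < b -> is_derive F t (f t)) -> is_RInt f a b (F b - F a).
Proof.
intros hab hF hf hd.
assert (hex : forall t, is_RInt f a t (RInt f a t)).
{ intros t. apply (RInt_correct (V := R_CompleteNormedModule)).
  apply (ex_RInt_continuous (V := R_CompleteNormedModule)). auto. }
assert (hD : forall t, is_derive (RInt f a) t (f t)).
{ intros t. apply (is_derive_RInt (V := R_NormedModule) f (RInt f a) a t).
  - apply filter_forall. auto.
  - auto. }
destruct (MVT_gen (fun t => RInt f a t - F t) a b (fun _ => 0)) as [c [_ hc]].
- rewrite Rmin_left, Rmax_right by lra. intros t ht.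
  replace 0 with (f t - f t) by ring.
  apply (is_derive_minus (V := R_NormedModule)); auto.
- intros t _. apply continuity_pt_filterlim.
  apply (continuous_minus (V := R_NormedModule) (RInt f a) F t); [|apply hF].
  apply (ex_derive_continuous (V := R_NormedModule)). exists (f t); apply hD.
- assert (h0 := RInt_point (V := R_CompleteNormedModule) a f).
  change (RInt f a a = 0) in h0.
  assert (e : RInt f a b = F b - F a) by lra.
  rewrite <- e. auto.
Qed.

(* [F] is only required to be differentiable in the open interval, which
   allows curves that touch the border of the domain at their ends. *)
Lemma FTC_C (F f : R -> C) (a b : R) : a <= b ->
  rcont (seg a b) F -> rcont (seg a b) f ->
  (forall t, a < t < b -> rderiv F t (f t)) -> is_cint f a b (F b - F a)%C.
Proof.
intros hab hF hf hd.
assert (h : is_cint (fun t => f (clamp a b t)) a b (F b - F a)%C).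
(* Near a point of ]a, b[ clamping changes nothing, so derivatives pass to the clamped function. *)
{ assert (hl : forall (G H : R -> R) t, a < t < b -> (forall s, a < s < b -> G s = H s) ->
    forall l, is_derive G t l -> is_derive H t l).
  { intros G H t ht hGH l hG. apply (is_derive_ext_loc G); auto.
    assert (hp : 0 < Rmin (t - a) (b - t)) by (apply Rmin_pos; lra).
    exists (mkposreal _ hp). intros s hs. apply hGH.
    assert (h1 := lt_Rmin_l hs).
    assert (h2 := lt_Rmin_r hs).
    change (Rabs (s - t) < t - a) in h1. change (Rabs (s - t) < b - t) in h2.
    apply Rabs_def2 in h1. apply Rabs_def2 in h2. lra. }
  apply is_cint_parts. split.
  - replace (Re (F b - F a)%C) with (Re (F (clamp a b b)) - Re (F (clamp a b a)))
      by (rewrite !clamp_id by lra; reflexivity).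
    apply (FTC_open (fun t => Re (F (clamp a b t)))); auto.
    + intros t; apply (rcont_clamp a b F t); auto.
    + intros t; apply (rcont_clamp a b f t); auto.
    + intros t ht. apply (hl (fun s => Re (F s))); auto.
      * intros s hs; rewrite clamp_id; auto; lra.
      * rewrite clamp_id by lra. apply rderiv_parts; auto.
  - replace (Im (F b - F a)%C) with (Im (F (clamp a b b)) - Im (F (clamp a b a)))
      by (rewrite !clamp_id by lra; reflexivity).
    apply (FTC_open (fun t => Im (F (clamp a b t)))); auto.
    + intros t; apply (rcont_clamp a b F t); auto.
    + intros t; apply (rcont_clamp a b f t); auto.
    + intros t ht. apply (hl (fun s => Im (F s))); auto.
      * intros s hs; rewrite clamp_id; auto; lra.
      * rewrite clamp_id by lra. apply rderiv_parts; auto. }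
apply is_cint_ext with (2 := h).
rewrite Rmin_left, Rmax_right by lra. intros t ht. rewrite clamp_id; auto. lra.
Qed.

(** * Continuity relative to a set *)

Lemma rderiv_rcont (D : R -> Prop) (f : R -> C) : (forall t, D t -> exists l, rderiv f t l) -> rcont D f.
Proof.
intros h t ht eps he. destruct (h t ht) as [l hl]. rewrite rderiv_iff in hl.
destruct (hl 1 Rlt_0_1) as [d [hd h1]]. assert (h0 := Cmod_ge_0 l).
exists (Rmin d (eps / 2 / (Cmod l + 1))); split.
- apply Rmin_pos; [lra|]. repeat apply Rdiv_lt_0_compat; lra.
- intros t' _ ht'.
  specialize (h1 t' (Rlt_le_trans _ _ _ ht' (Rmin_l _ _))).
  assert (h2 := Rlt_le_trans _ _ _ ht' (Rmin_r _ _)).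
  replace (f t' - f t)%C with ((f t' - f t - RtoC (t' - t) * l) + RtoC (t' - t) * l)%C by ring.
  eapply Rle_lt_trans; [apply Cmod_triangle|]. rewrite Cmod_mult, Cmod_R.
  apply Rle_lt_trans with (Rabs (t' - t) * (Cmod l + 1)); [lra|].
  apply Rlt_trans with (eps / 2 / (Cmod l + 1) * (Cmod l + 1) + eps / 4).
  + assert (Rabs (t' - t) * (Cmod l + 1) < eps / 2 / (Cmod l + 1) * (Cmod l + 1))
      by (apply Rmult_lt_compat_r; lra). lra.
  + replace (eps / 2 / (Cmod l + 1) * (Cmod l + 1)) with (eps / 2) by (field; lra). lra.
Qed.

Lemma rcont_plus (D : R -> Prop) (f g : R -> C) : rcont D f -> rcont D g ->
  rcont D (fun t => f t + g t)%C.
Proof.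
intros hf hg t ht eps he.
destruct (hf t ht (eps / 2)) as [d1 [hd1 h1]]; [lra|].
destruct (hg t ht (eps / 2)) as [d2 [hd2 h2]]; [lra|].
exists (Rmin d1 d2); split; [apply Rmin_pos; lra|].
intros q hD hq.
specialize (h1 q hD (lt_Rmin_l hq)).
specialize (h2 q hD (lt_Rmin_r hq)).
replace (f q + g q - (f t + g t))%C with ((f q - f t) + (g q - g t))%C by ring.
eapply Rle_lt_trans; [apply Cmod_triangle|]. lra.
Qed.

(** Stated for an arbitrary [dist] so that one proof serves functions on R and on C. *)
Lemma cont_mult {T : Type} (dist : T -> T -> R) (D : T -> Prop) (f g : T -> C) :
  (forall t, D t -> forall eps, 0 < eps -> exists d, 0 < d /\ forall t', D t' -> dist t t' < d -> Cmod (f t' - f t) < eps) ->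
  (forall t, D t -> forall eps, 0 < eps -> exists d, 0 < d /\ forall t', D t' -> dist t t' < d -> Cmod (g t' - g t) < eps) ->
  forall t, D t -> forall eps, 0 < eps -> exists d, 0 < d /\ forall t', D t' -> dist t t' < d ->
  Cmod (f t' * g t' - f t * g t) < eps.
Proof.
intros hf hg t ht eps he.
assert (h0 := Cmod_ge_0 (f t)). assert (h0' := Cmod_ge_0 (g t)).
set (K := Cmod (f t) + Cmod (g t) + 1).
assert (hK : 0 < K) by (unfold K; lra).
set (e := Rmin 1 (eps / K)).
assert (he' : 0 < e) by (unfold e; apply Rmin_pos; [lra|apply Rdiv_lt_0_compat; lra]).
destruct (hf t ht e he') as [d1 [hd1 h1]].
destruct (hg t ht e he') as [d2 [hd2 h2]].
exists (Rmin d1 d2); split; [apply Rmin_pos; lra|].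
intros q hD hq.
specialize (h1 q hD (lt_Rmin_l hq)).
specialize (h2 q hD (lt_Rmin_r hq)).
replace (f q * g q - f t * g t)%C with
  ((f q - f t) * g t + f t * (g q - g t) + (f q - f t) * (g q - g t))%C by ring.
eapply Rle_lt_trans; [apply Cmod_triangle|].
eapply Rle_lt_trans; [apply Rplus_le_compat_r; apply Cmod_triangle|].
rewrite !Cmod_mult.
assert (e <= 1) by apply Rmin_l.
assert (heK : e * K <= eps).
{ apply Rle_trans with (eps / K * K); [|right; field; lra].
  apply Rmult_le_compat_r; [lra|apply Rmin_r]. }
assert (h3 := Cmod_ge_0 (f q - f t)). assert (h4 := Cmod_ge_0 (g q - g t)).
assert (h5 : Cmod (f q - f t) * Cmod (g t) <= e * Cmod (g t)) by (apply Rmult_le_compat_r; lra).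
assert (h6 : Cmod (f t) * Cmod (g q - g t) <= Cmod (f t) * e) by (apply Rmult_le_compat_l; lra).
assert (h7 : Cmod (f q - f t) * Cmod (g q - g t) <= 1 * Cmod (g q - g t)) by (apply Rmult_le_compat_r; lra).
unfold K in heK. lra.
Qed.

Lemma rcont_mult (D : R -> Prop) (f g : R -> C) : rcont D f -> rcont D g ->
  rcont D (fun t => f t * g t)%C.
Proof. exact (cont_mult (fun t t' => Rabs (t' - t)) D f g). Qed.

Lemma ccont_mult (D : C -> Prop) (f g : C -> C) : ccont D f -> ccont D g -> ccont D (fun z => f z * g z)%C.
Proof. exact (cont_mult (fun p q => Cmod (q - p)) D f g). Qed.

Lemma rcont_const (D : R -> Prop) (c : C) : rcont D (fun _ => c).
Proof.
intros t _ eps he. exists 1; split; [lra|]. intros t' _ _.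
rewrite Cmod_diag; lra.
Qed.

Lemma rcont_minus (D : R -> Prop) (f g : R -> C) : rcont D f -> rcont D g ->
  rcont D (fun t => f t - g t)%C.
Proof.
intros hf hg.
assert (h := rcont_plus D f (fun t => (-1) * g t)%C hf (rcont_mult D (fun _ => (-1)%C) g (rcont_const D _) hg)).
intros t ht eps he. destruct (h t ht eps he) as [d [hd h1]].
exists d; split; auto. intros t' hD ht'. specialize (h1 t' hD ht').
replace (f t' - g t' - (f t - g t))%C with (f t' + -1 * g t' - (f t + -1 * g t))%C by ring.
exact h1.
Qed.

Lemma rcont_comp (D : R -> Prop) (E : C -> Prop) (gam : R -> C) (f : C -> C) :
  rcont D gam -> ccont E f -> (forall t, D t -> E (gam t)) -> rcont D (fun t => f (gam t)).
Proof.
intros hg hf hD t ht eps he.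
destruct (hf (gam t) (hD t ht) eps he) as [d1 [hd1 h1]].
destruct (hg t ht d1 hd1) as [d [hd h2]].
exists d; split; auto.
Qed.

Lemma rcont_line (D : R -> Prop) (w v : C) : rcont D (fun s => w + RtoC s * v)%C.
Proof. apply rderiv_rcont. intros t _. exists v. apply rderiv_line. Qed.

Lemma differentiable_ccont (D : C -> Prop) (f : C -> C) : (forall p, D p -> differentiable f p) -> ccont D f.
Proof.
intros h p hp eps he. destruct (h p hp) as [l hl].
destruct (cderiv_cont f p l hl eps he) as [d [hd h1]].
exists d; split; auto.
Qed.

Lemma ccont_minus (D : C -> Prop) (f g : C -> C) : ccont D f -> ccont D g -> ccont D (fun z => f z - g z)%C.
Proof.
intros hf hg p hp eps he.
destruct (hf p hp (eps / 2)) as [d1 [hd1 k1]]; [lra|].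
destruct (hg p hp (eps / 2)) as [d2 [hd2 k2]]; [lra|].
exists (Rmin d1 d2); split; [apply Rmin_pos; lra|]. intros q hq hqp.
specialize (k1 q hq (lt_Rmin_l hqp)).
specialize (k2 q hq (lt_Rmin_r hqp)).
replace (f q - g q - (f p - g p))%C with ((f q - f p) - (g q - g p))%C by ring.
eapply Rle_lt_trans; [apply Cmod_minus_le|lra].
Qed.

Lemma rderiv_hor (y t : R) : rderiv (fun s => (s, y)) t 1.
Proof.
apply (rderiv_pair (fun s => s) (fun _ => y)); auto_derive; auto.
Qed.

Lemma rderiv_ver (x t : R) : rderiv (fun s => (x, s)) t Ci.
Proof.
apply (rderiv_pair (fun _ => x) (fun s => s)); auto_derive; auto.
Qed.

(** * Taylor estimates and derivative of the exponential *)

Lemma rderiv_Cexp_line (z : C) (t : R) :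
  rderiv (fun s => Cexp (RtoC s * z)%C) t (z * Cexp (RtoC t * z))%C.
Proof.
destruct z as [x y].
assert (e : (fun s => Cexp (RtoC s * (x, y))%C) =
  (fun s => (exp (s * x) * cos (s * y), exp (s * x) * sin (s * y)))).
{ apply functional_extensionality; intros s. unfold Cexp; simpl.
  replace (s * x - 0 * y) with (s * x) by ring. replace (s * y + 0 * x) with (s * y) by ring.
  reflexivity. }
rewrite e.
eapply rderiv_eq.
- apply rderiv_pair.
  + auto_derive; [auto|reflexivity].
  + auto_derive; [auto|reflexivity].
- unfold Cexp. apply C_eq_parts; simpl;
  replace (t * x - 0 * y) with (t * x) by ring; replace (t * y + 0 * x) with (t * y) by ring; ring.
Qed.

Lemma Re_scal_le (t : R) (z : C) : 0 <= t <= 1 -> Re (RtoC t * z)%C <= Cmod z.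
Proof.
intros ht. eapply Rle_trans; [apply Rle_abs|]. eapply Rle_trans; [apply re_le_Cmod|].
rewrite Cmod_mult, Cmod_R, Rabs_pos_eq by lra.
assert (h := Cmod_ge_0 z). nra.
Qed.

(** The difference is the integral over [0, 1] of z e^(t z), and Re (t z) <= |z| there. *)
Lemma Cexp_minus_1 (z : C) : Cmod (Cexp z - 1) <= Cmod z * exp (Cmod z).
Proof.
assert (h : is_cint (fun t => z * Cexp (RtoC t * z))%C 0 1 (Cexp (1 * z) - Cexp (0 * z))%C).
{ apply (FTC_C (fun t => Cexp (RtoC t * z)%C)); [lra| | |].
  - apply rderiv_rcont. intros t _. eexists; apply rderiv_Cexp_line.
  - apply rcont_mult; [apply rcont_const|].
    apply rderiv_rcont. intros t _. eexists; apply rderiv_Cexp_line.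
  - intros t _. apply rderiv_Cexp_line. }
rewrite Cmult_1_l, Cmult_0_l, Cexp_0 in h.
apply (is_cint_bound_const _ _ _ _ (Cmod z * exp (Cmod z))) in h.
- rewrite Rminus_0_r, Rabs_R1, Rmult_1_l in h. exact h.
- intros t ht. rewrite seg_le in ht by lra. rewrite Cmod_mult, Cmod_Cexp.
  apply Rmult_le_compat_l; [apply Cmod_ge_0|].
  destruct (Rle_lt_or_eq_dec _ _ (Re_scal_le t z ht)) as [h1|h1].
  + left; apply exp_increasing; exact h1.
  + right; f_equal; exact h1.
Qed.

Lemma exp_le (x y : R) : x <= y -> exp x <= exp y.
Proof. intros [h|h]; [left; apply exp_increasing; auto|right; f_equal; auto]. Qed.

(** One order further by the same device: the integrand is now z (e^(t z) - 1), bounded by the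
    first-order estimate. *)
Lemma Cexp_minus_1_lin (z : C) : Cmod (Cexp z - 1 - z) <= Cmod z * Cmod z * exp (Cmod z).
Proof.
assert (h : is_cint (fun t => z * (Cexp (RtoC t * z) - 1))%C 0 1
  ((Cexp (1 * z) - 1 * z) - (Cexp (0 * z) - 0 * z))%C).
{ apply (FTC_C (fun t => Cexp (RtoC t * z) - RtoC t * z)%C); [lra| | |].
  - apply rcont_minus.
    + apply rderiv_rcont. intros t _. eexists; apply rderiv_Cexp_line.
    + apply rcont_sub with (fun _ => True); [auto|].
      apply rderiv_rcont. intros t _. exists z.
      assert (e : (fun t => RtoC t * z)%C = (fun t => 0 + RtoC t * z)%C)
        by (apply functional_extensionality; intros; ring).
      rewrite e. apply rderiv_line.
  - apply rcont_mult; [apply rcont_const|]. apply rcont_minus; [|apply rcont_const].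
    apply rderiv_rcont. intros t _. eexists; apply rderiv_Cexp_line.
  - intros t _.
    assert (h1 := rderiv_Cexp_line z t).
    assert (h2 : rderiv (fun t => RtoC t * z)%C t z).
    { assert (e : (fun t => RtoC t * z)%C = (fun t => 0 + RtoC t * z)%C)
        by (apply functional_extensionality; intros; ring).
      rewrite e. apply rderiv_line. }
    apply rderiv_eq with (z * Cexp (RtoC t * z) - z)%C; [|ring].
    apply (is_derive_minus (V := C_R_NormedModule)); assumption. }
rewrite !Cmult_1_l, !Cmult_0_l, Cexp_0 in h.
apply (is_cint_bound_const _ _ _ _ (Cmod z * (Cmod z * exp (Cmod z)))) in h.
- rewrite Rminus_0_r, Rabs_R1, Rmult_1_l in h. rewrite Rmult_assoc.
  replace (Cexp z - 1 - z)%C with (Cexp z - z - (1 - 0))%C by ring. exact h.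
- intros t ht. rewrite seg_le in ht by lra. rewrite Cmod_mult.
  apply Rmult_le_compat_l; [apply Cmod_ge_0|].
  eapply Rle_trans; [apply Cexp_minus_1|].
  assert (h1 : Cmod (RtoC t * z) <= Cmod z).
  { rewrite Cmod_mult, Cmod_R, Rabs_pos_eq by lra. assert (h1 := Cmod_ge_0 z). nra. }
  apply Rmult_le_compat; try apply Cmod_ge_0; auto.
  + left; apply exp_pos.
  + apply exp_le; auto.
Qed.

(** The addition formula reduces the claim to the origin, where the second-order estimate applies;
    the radius is at most 1 so that e^|q - p| <= e. *)
Lemma cderiv_Cexp (p : C) : cderiv Cexp p (Cexp p).
Proof.
intros eps he.
assert (hE : 0 < exp (Re p) * exp 1) by (apply Rmult_lt_0_compat; apply exp_pos).
exists (Rmin 1 (eps / (exp (Re p) * exp 1))); split.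
{ apply Rmin_pos; [lra|]. apply Rdiv_lt_0_compat; lra. }
intros q hq.
assert (h1 := lt_Rmin_l hq).
assert (h2 := lt_Rmin_r hq).
assert (h0 := Cmod_ge_0 (q - p)).
assert (e : (Cexp q - Cexp p - Cexp p * (q - p))%C = (Cexp p * (Cexp (q - p) - 1 - (q - p)))%C).
{ replace q with (p + (q - p))%C at 1 by ring. rewrite Cexp_plus. ring. }
rewrite e, Cmod_mult, Cmod_Cexp.
apply Rle_trans with (exp (Re p) * (Cmod (q - p) * Cmod (q - p) * exp 1)).
- apply Rmult_le_compat_l; [left; apply exp_pos|].
  eapply Rle_trans; [apply Cexp_minus_1_lin|].
  apply Rmult_le_compat_l; [apply Rmult_le_pos; lra|]. apply exp_le; lra.
- replace (exp (Re p) * (Cmod (q - p) * Cmod (q - p) * exp 1))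
    with (Cmod (q - p) * (exp (Re p) * exp 1) * Cmod (q - p)) by ring.
  apply Rmult_le_compat_r; auto.
  apply Rle_trans with (eps / (exp (Re p) * exp 1) * (exp (Re p) * exp 1)).
  + apply Rmult_le_compat_r; lra.
  + right; field. split; apply Rgt_not_eq; apply exp_pos.
Qed.

(** * Cauchy's theorem for rectangles *)

Definition hor (f : C -> C) (x0 x1 y : R) : C := cint (fun x => f (x, y)) x0 x1.
Definition ver (f : C -> C) (y0 y1 x : R) : C := cint (fun y => f (x, y)) y0 y1.

(** The boundary integral, counterclockwise when the bounds are in increasing order. [Ci] comes from
    dz = i dy on the vertical sides, which [ver] leaves out. The bounds may come in any order. *)
Definition rint (f : C -> C) (x0 x1 y0 y1 : R) : C :=
  (hor f x0 x1 y0 + Ci * ver f y0 y1 x1 - hor f x0 x1 y1 - Ci * ver f y0 y1 x0)%C.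

Definition rect (x0 x1 y0 y1 : R) (z : C) : Prop := seg x0 x1 (Re z) /\ seg y0 y1 (Im z).

Lemma hor_rcont (f : C -> C) (D : C -> Prop) (x0 x1 y : R) : ccont D f ->
  (forall x, seg x0 x1 x -> D (x, y)) -> rcont (seg x0 x1) (fun x => f (x, y)).
Proof.
intros hf hD. apply rcont_comp with (E := D); auto.
apply rderiv_rcont. intros t _. eexists; apply rderiv_hor.
Qed.

Lemma ver_rcont (f : C -> C) (D : C -> Prop) (y0 y1 x : R) : ccont D f ->
  (forall y, seg y0 y1 y -> D (x, y)) -> rcont (seg y0 y1) (fun y => f (x, y)).
Proof.
intros hf hD. apply rcont_comp with (E := D); auto.
apply rderiv_rcont. intros t _. eexists; apply rderiv_ver.
Qed.

Lemma hor_primitive (F f : C -> C) (x0 x1 y : R) : x0 <= x1 -> rcont (seg x0 x1) (fun x => f (x, y)) ->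
  (forall x, seg x0 x1 x -> cderiv F (x, y) (f (x, y))) -> hor f x0 x1 y = (F (x1, y) - F (x0, y))%C.
Proof.
intros hx hf hF. apply is_cint_cint.
assert (hd : forall t, seg x0 x1 t -> rderiv (fun x => F (x, y)) t (f (t, y))).
{ intros t ht. apply rderiv_eq with (f (t, y) * 1)%C; [|ring].
  apply (rderiv_comp F (fun x => (x, y))); [apply rderiv_hor|auto]. }
apply (FTC_C (fun x => F (x, y))); auto.
- apply rderiv_rcont. intros t ht; eexists; apply hd; auto.
- intros t ht. apply hd. apply seg_le; lra.
Qed.

Lemma ver_primitive (F f : C -> C) (y0 y1 x : R) : y0 <= y1 -> rcont (seg y0 y1) (fun y => f (x, y)) ->
  (forall y, seg y0 y1 y -> cderiv F (x, y) (f (x, y))) -> (Ci * ver f y0 y1 x)%C = (F (x, y1) - F (x, y0))%C.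
Proof.
intros hx hf hF.
assert (hd : forall t, seg y0 y1 t -> rderiv (fun y => F (x, y)) t (Ci * f (x, t))%C).
{ intros t ht. apply rderiv_eq with (f (x, t) * Ci)%C; [|ring].
  apply (rderiv_comp F (fun y => (x, y))); [apply rderiv_ver|auto]. }
apply is_cint_unique with (f := fun y => (Ci * f (x, y))%C) (a := y0) (b := y1).
- apply is_cint_scal, rcont_ex; auto.
- apply (FTC_C (fun y => F (x, y))); auto.
  + apply rderiv_rcont. intros t ht; eexists; apply hd; auto.
  + apply rcont_mult; [apply rcont_const|auto].
  + intros t ht. apply hd. apply seg_le; lra.
Qed.

Lemma rint_primitive (F f : C -> C) (x0 x1 y0 y1 : R) : x0 <= x1 -> y0 <= y1 ->
  ccont (rect x0 x1 y0 y1) f -> (forall z, rect x0 x1 y0 y1 z -> cderiv F z (f z)) ->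
  rint f x0 x1 y0 y1 = 0.
Proof.
intros hx hy hf hF. unfold rint.
assert (r0 := seg_l x0 x1). assert (r1 := seg_r x0 x1).
assert (s0 := seg_l y0 y1). assert (s1 := seg_r y0 y1).
rewrite (hor_primitive F f x0 x1 y0), (hor_primitive F f x0 x1 y1),
  (ver_primitive F f y0 y1 x0), (ver_primitive F f y0 y1 x1); auto;
try (eapply hor_rcont; eauto; intros; split; auto);
try (eapply ver_rcont; eauto; intros; split; auto);
try (intros; apply hF; split; auto).
ring.
Qed.

Lemma cint_chasles (f : R -> C) (a b c : R) : rcont (seg a b) f -> rcont (seg b c) f ->
  (cint f a b + cint f b c)%C = cint f a c.
Proof.
intros h1 h2. symmetry. apply is_cint_cint. apply is_cint_chasles with b; apply rcont_ex; auto.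
Qed.

Lemma seg_sub (a b c d t : R) : seg a b c -> seg a b d -> seg c d t -> seg a b t.
Proof.
unfold seg. intros h1 h2 h3. split.
- apply Rle_trans with (Rmin c d); [apply Rmin_glb; lra|lra].
- apply Rle_trans with (Rmax c d); [lra|apply Rmax_lub; lra].
Qed.

Lemma rint_split_x (f : C -> C) (x0 x1 x2 y0 y1 : R) : seg x0 x2 x1 ->
  ccont (rect x0 x2 y0 y1) f ->
  rint f x0 x2 y0 y1 = (rint f x0 x1 y0 y1 + rint f x1 x2 y0 y1)%C.
Proof.
intros hx hf.
assert (h : forall y, seg y0 y1 y -> hor f x0 x2 y = (hor f x0 x1 y + hor f x1 x2 y)%C).
{ intros y hy. symmetry. apply cint_chasles; eapply hor_rcont; eauto; intros x hx'; split; auto;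
  apply seg_sub with (3 := hx'); auto using seg_l, seg_r. }
unfold rint. rewrite (h _ (seg_l _ _)), (h _ (seg_r _ _)). ring.
Qed.

Lemma rint_split_y (f : C -> C) (x0 x1 y0 y1 y2 : R) : seg y0 y2 y1 ->
  ccont (rect x0 x1 y0 y2) f ->
  rint f x0 x1 y0 y2 = (rint f x0 x1 y0 y1 + rint f x0 x1 y1 y2)%C.
Proof.
intros hy hf.
assert (h : forall x, seg x0 x1 x -> ver f y0 y2 x = (ver f y0 y1 x + ver f y1 y2 x)%C).
{ intros x hx. symmetry. apply cint_chasles; eapply ver_rcont; eauto; intros y hy'; split; auto;
  apply seg_sub with (3 := hy'); auto using seg_l, seg_r. }
unfold rint. rewrite (h _ (seg_l _ _)), (h _ (seg_r _ _)). ring.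
Qed.

Lemma ccont_sub (D D' : C -> Prop) (f : C -> C) : (forall t, D' t -> D t) -> ccont D f -> ccont D' f.
Proof.
intros hs h t ht eps he. destruct (h t (hs t ht) eps he) as [d [hd h1]].
exists d; split; auto.
Qed.

Lemma rint_bound (f : C -> C) (x0 x1 y0 y1 m : R) : ccont (rect x0 x1 y0 y1) f ->
  (forall z, rect x0 x1 y0 y1 z -> Cmod (f z) <= m) ->
  Cmod (rint f x0 x1 y0 y1) <= 2 * (Rabs (x1 - x0) + Rabs (y1 - y0)) * m.
Proof.
intros hf hm.
assert (hh : forall y, seg y0 y1 y -> Cmod (hor f x0 x1 y) <= Rabs (x1 - x0) * m).
{ intros y hy. apply is_cint_bound_const with (f := fun x => f (x, y)).
  - intros t ht; apply hm; split; auto.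
  - apply rcont_ex. eapply hor_rcont; eauto. intros; split; auto. }
assert (hv : forall x, seg x0 x1 x -> Cmod (Ci * ver f y0 y1 x) <= Rabs (y1 - y0) * m).
{ intros x hx. rewrite Cmod_mult, Cmod_Ci, Rmult_1_l. apply is_cint_bound_const with (f := fun y => f (x, y)).
  - intros t ht; apply hm; split; auto.
  - apply rcont_ex. eapply ver_rcont; eauto. intros; split; auto. }
assert (h1 := hh y0 (seg_l _ _)). assert (h2 := hh y1 (seg_r _ _)).
assert (h3 := hv x0 (seg_l _ _)). assert (h4 := hv x1 (seg_r _ _)).
unfold rint.
eapply Rle_trans; [apply Cmod_minus_le|].
eapply Rle_trans; [apply Rplus_le_compat_r; apply Cmod_minus_le|].
eapply Rle_trans; [apply Rplus_le_compat_r; apply Rplus_le_compat_r; apply Cmod_triangle|].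
lra.
Qed.

Lemma rint_minus (f g : C -> C) (x0 x1 y0 y1 : R) : ccont (rect x0 x1 y0 y1) f ->
  ccont (rect x0 x1 y0 y1) g ->
  rint (fun z => f z - g z)%C x0 x1 y0 y1 = (rint f x0 x1 y0 y1 - rint g x0 x1 y0 y1)%C.
Proof.
intros hf hg.
assert (hh : forall y, seg y0 y1 y -> hor (fun z => f z - g z)%C x0 x1 y = (hor f x0 x1 y - hor g x0 x1 y)%C).
{ intros y hy. apply is_cint_cint. apply is_cint_minus; apply rcont_ex;
  eapply hor_rcont; eauto; intros; split; auto. }
assert (hv : forall x, seg x0 x1 x -> ver (fun z => f z - g z)%C y0 y1 x = (ver f y0 y1 x - ver g y0 y1 x)%C).
{ intros y hy. apply is_cint_cint. apply is_cint_minus; apply rcont_ex;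
  eapply ver_rcont; eauto; intros; split; auto. }
unfold rint. rewrite (hh _ (seg_l _ _)), (hh _ (seg_r _ _)), (hv _ (seg_l _ _)), (hv _ (seg_r _ _)). ring.
Qed.

(** Nested intervals, to be applied to each coordinate of a nested sequence of rectangles. *)
Lemma nested_point (a w : nat -> R) : (forall n, 0 <= w n) -> (forall n, a n <= a (S n)) ->
  (forall n, a (S n) + w (S n) <= a n + w n) -> exists l, forall n, a n <= l <= a n + w n.
Proof.
intros hw ha hb.
assert (ha' : forall n m, (n <= m)%nat -> a n <= a m).
{ intros n m h; induction h; [lra|]. specialize (ha m). lra. }
assert (hb' : forall n m, (n <= m)%nat -> a m + w m <= a n + w n).
{ intros n m h; induction h; [lra|]. specialize (hb m). lra. }
assert (hab : forall n m, a m <= a n + w n).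
{ intros n m. destruct (Nat.le_ge_cases n m) as [h|h].
  - specialize (hb' n m h). specialize (hw m). lra.
  - specialize (ha' m n h). specialize (hw n). lra. }
destruct (completeness (fun x => exists n, x = a n)) as [l [hl1 hl2]].
- exists (a 0%nat + w 0%nat). intros x [n ->]. apply hab.
- exists (a 0%nat), 0%nat; reflexivity.
- exists l; intros n; split.
  + apply hl1. exists n; reflexivity.
  + apply hl2. intros x [m ->]. apply hab.
Qed.

(** The affine part of f at z0 has a polynomial primitive and integrates to 0. The rest is at most
    eps / 4 times the half-perimeter, on a boundary of twice that length, and (w + h)^2 <= 2 (w^2 +
    h^2). *)
Lemma rint_local (f : C -> C) (z0 l : C) (eps : R) : cderiv f z0 l -> 0 < eps ->
  exists d, 0 < d /\ forall x0 x1 y0 y1, x0 <= x1 -> y0 <= y1 -> rect x0 x1 y0 y1 z0 ->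
  x1 - x0 + (y1 - y0) < d -> ccont (rect x0 x1 y0 y1) f ->
  Cmod (rint f x0 x1 y0 y1) <= eps * ((x1 - x0) ^ 2 + (y1 - y0) ^ 2).
Proof.
intros hl he.
destruct (hl (eps / 4)) as [d [hd h1]]; [lra|].
exists d; split; auto. intros x0 x1 y0 y1 hx hy hz hw hf.
set (g := fun z => (f z0 + l * (z - z0))%C).
set (G := fun z => (f z0 * z + l * (/ 2 * (z * z) - z0 * z))%C).
assert (hG : forall z, cderiv G z (g z)).
{ intros z. unfold G, g. apply cderiv_eq with (f z0 * 1 + l * (/ 2 * (1 * z + z * 1) - z0 * 1))%C.
  - apply cderiv_plus; [apply cderiv_scal, cderiv_id|]. apply cderiv_scal.
    apply cderiv_minus; apply cderiv_scal; [|apply cderiv_id].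
    apply (cderiv_mult (fun z => z) (fun z => z)); apply cderiv_id.
  - field. }
assert (hg : forall z, differentiable g z).
{ intros z. exists (0 + l * (1 - 0))%C. unfold g.
  apply cderiv_plus; [apply cderiv_const|]. apply cderiv_scal.
  apply (cderiv_minus (fun z => z)); [apply cderiv_id|apply cderiv_const]. }
assert (hgc : ccont (rect x0 x1 y0 y1) g) by (apply differentiable_ccont; auto).
assert (e0 : rint g x0 x1 y0 y1 = 0) by (apply rint_primitive with G; auto).
assert (e1 := rint_minus f g x0 x1 y0 y1 hf hgc).
rewrite e0 in e1. replace (rint f x0 x1 y0 y1 - 0)%C with (rint f x0 x1 y0 y1) in e1 by ring.
rewrite <- e1.
assert (hfg := ccont_minus _ _ _ hf hgc).
eapply Rle_trans.
- apply rint_bound with (m := eps / 4 * (x1 - x0 + (y1 - y0))); [exact hfg|].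
  intros z [hzx hzy].
  assert (hz' : Cmod (z - z0) <= x1 - x0 + (y1 - y0)).
  { destruct hz as [hz1 hz2]. rewrite seg_le in hz1, hz2, hzx, hzy by lra. destruct z as [zx zy], z0 as [ux uy].
    simpl in *. eapply Rle_trans; [apply (Cmod_le_abs (zx - ux) (zy - uy))|].
    apply Rplus_le_compat; apply Rabs_le; split; lra. }
  assert (h2 : Cmod (z - z0) < d) by lra.
  specialize (h1 z h2). unfold g.
  replace (f z - (f z0 + l * (z - z0)))%C with (f z - f z0 - l * (z - z0))%C by ring.
  eapply Rle_trans; [exact h1|]. apply Rmult_le_compat_l; lra.
- rewrite !Rabs_pos_eq by lra.
  assert (h2 : 0 <= eps * ((x1 - x0) - (y1 - y0)) ^ 2).
  { apply Rmult_le_pos; [lra|]. apply pow2_ge_0. }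
  nra.
Qed.

Lemma pow2_archimed (w d : R) : 0 < d -> exists n, w / 2 ^ n < d.
Proof.
intros hd.
destruct (Pow_x_infinity 2) with (b := w / d + 1) as [N hN].
- rewrite Rabs_pos_eq; lra.
- exists N. specialize (hN N (le_n _)).
  assert (hp : 0 < 2 ^ N) by (apply pow_lt; lra).
  rewrite Rabs_pos_eq in hN by lra.
  apply Rmult_lt_reg_r with (2 ^ N); auto.
  replace (w / 2 ^ N * 2 ^ N) with w by (field; lra).
  apply Rlt_le_trans with (d * (w / d + 1)).
  + replace (d * (w / d + 1)) with (w + d) by (field; lra). lra.
  + apply Rmult_le_compat_l; lra.
Qed.

(** A selection that always succeeds and is a good one whenever there is one: the sequence of
    rectangles can thus be defined before any of them is known to be bad. *)
Lemma choose_of_four (P : R * R -> Prop) (a b c d : R * R) :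
  exists z, (z = a \/ z = b \/ z = c \/ z = d) /\ (P a \/ P b \/ P c \/ P d -> P z).
Proof.
destruct (classic (P a)); [exists a; tauto|].
destruct (classic (P b)); [exists b; tauto|].
destruct (classic (P c)); [exists c; tauto|].
exists d; tauto.
Qed.

(** Goursat's bisection. The threshold eps (w^2 + h^2) is divided by exactly 4 when both sides are
    halved, so a bad rectangle has a bad quarter; it is also comparable to the square of the
    perimeter, which contradicts [rint_local] at the limit point. *)
Lemma goursat_le (f : C -> C) (x0 x1 y0 y1 : R) : x0 <= x1 -> y0 <= y1 ->
  (forall z, rect x0 x1 y0 y1 z -> differentiable f z) -> rint f x0 x1 y0 y1 = 0.
Proof.
intros hx hy hf.
assert (hc : ccont (rect x0 x1 y0 y1) f) by (apply differentiable_ccont; auto).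
set (W := x1 - x0). set (H := y1 - y0).
apply Cmod_le_eps_eq. intros eps0 heps0.
replace (rint f x0 x1 y0 y1 - 0)%C with (rint f x0 x1 y0 y1) by ring.
apply NNPP; intros hno. apply Rnot_le_lt in hno.
assert (hWH : 0 < W ^ 2 + H ^ 2 + 1).
{ assert (h1 := pow2_ge_0 W). assert (h2 := pow2_ge_0 H). lra. }
(* The term 1 keeps the denominator positive for a degenerate rectangle; the initial rectangle is
   bad since eps (W^2 + H^2) <= [eps0]. *)
set (eps := eps0 / (W ^ 2 + H ^ 2 + 1)).
assert (heps : 0 < eps) by (apply Rdiv_lt_0_compat; lra).
set (bad := fun x y w h => eps * (w ^ 2 + h ^ 2) < Cmod (rint f x (x + w) y (y + h))).
set (corner := fix corner n := match n with
  | O => (x0, y0)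
  | S m => let x := fst (corner m) in let y := snd (corner m) in
    let w := W / 2 ^ n in let h := H / 2 ^ n in
    proj1_sig (constructive_indefinite_description _
      (choose_of_four (fun c => bad (fst c) (snd c) w h) (x, y) (x + w, y) (x, y + h) (x + w, y + h)))
  end).
assert (hW : forall n, 0 <= W / 2 ^ n).
{ intros n; apply Rdiv_le_0_compat; [unfold W; lra|apply pow_lt; lra]. }
assert (hH : forall n, 0 <= H / 2 ^ n).
{ intros n; apply Rdiv_le_0_compat; [unfold H; lra|apply pow_lt; lra]. }
assert (hW2 : forall n, W / 2 ^ n = 2 * (W / 2 ^ S n)).
{ intros n; simpl; field. apply pow_nonzero; lra. }
assert (hH2 : forall n, H / 2 ^ n = 2 * (H / 2 ^ S n)).
{ intros n; simpl; field. apply pow_nonzero; lra. }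
assert (hcor : forall n, (fst (corner (S n)) = fst (corner n) \/ fst (corner (S n)) = fst (corner n) + W / 2 ^ S n) /\
  (snd (corner (S n)) = snd (corner n) \/ snd (corner (S n)) = snd (corner n) + H / 2 ^ S n)).
{ intros n. cbn [corner]. destruct constructive_indefinite_description as [c [hc1 hc2]]; simpl proj1_sig.
  destruct hc1 as [e | [e | [e | e]]]; rewrite e; simpl fst; simpl snd; auto. }
assert (hmx : forall n, fst (corner n) <= fst (corner (S n)) /\
   fst (corner (S n)) + W / 2 ^ (S n) <= fst (corner n) + W / 2 ^ n).
{ intros n. destruct (hcor n) as [h1 _]. specialize (hW (S n)). rewrite (hW2 n). lra. }
assert (hmy : forall n, snd (corner n) <= snd (corner (S n)) /\
   snd (corner (S n)) + H / 2 ^ (S n) <= snd (corner n) + H / 2 ^ n).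
{ intros n. destruct (hcor n) as [_ h1]. specialize (hH (S n)). rewrite (hH2 n). lra. }
assert (hin : forall n, x0 <= fst (corner n) /\ fst (corner n) + W / 2 ^ n <= x1 /\
  y0 <= snd (corner n) /\ snd (corner n) + H / 2 ^ n <= y1).
{ induction n.
  - change (corner 0%nat) with (x0, y0). simpl fst; simpl snd. rewrite pow_O. unfold W, H. lra.
  - specialize (hmx n). specialize (hmy n). lra. }
assert (hsub : forall n z, rect (fst (corner n)) (fst (corner n) + W / 2 ^ n) (snd (corner n))
   (snd (corner n) + H / 2 ^ n) z -> rect x0 x1 y0 y1 z).
{ intros n z [h1 h2]. specialize (hin n). specialize (hW n). specialize (hH n).
  rewrite seg_le in h1, h2 by lra. split; apply seg_le; lra. }
(* If the selected quarter were not bad, none of the four would be, and their integrals would add up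
   to at most the threshold of the parent rectangle. *)
assert (hbad : forall n, bad (fst (corner n)) (snd (corner n)) (W / 2 ^ n) (H / 2 ^ n)).
{ induction n.
  - unfold bad. change (corner 0%nat) with (x0, y0). simpl fst; simpl snd. rewrite pow_O.
    replace (x0 + W / 1) with x1 by (unfold W; field).
    replace (y0 + H / 1) with y1 by (unfold H; field).
    apply Rle_lt_trans with (2 := hno). unfold eps.
    replace (W / 1) with W by field. replace (H / 1) with H by field.
    apply Rmult_le_reg_r with (W ^ 2 + H ^ 2 + 1); auto.
    replace (eps0 / (W ^ 2 + H ^ 2 + 1) * (W ^ 2 + H ^ 2) * (W ^ 2 + H ^ 2 + 1))
      with (eps0 * (W ^ 2 + H ^ 2)) by (field; lra). nra.
  - apply NNPP; intros hnb.
    assert (hs := hsub n). specialize (hW (S n)). specialize (hH (S n)).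
    revert IHn hs hnb. rewrite (hW2 n), (hH2 n). cbn [corner].
    set (x := fst (corner n)). set (y := snd (corner n)).
    set (w := W / 2 ^ S n) in *. set (h := H / 2 ^ S n) in *.
    intros hb hs hnb.
    assert (hnb' : ~ bad x y w h /\ ~ bad (x + w) y w h /\ ~ bad x (y + h) w h /\ ~ bad (x + w) (y + h) w h).
    { destruct constructive_indefinite_description as [c0 [hc1 hc2]]; simpl proj1_sig in hnb.
      split; [|split; [|split]]; intros hb'; apply hnb, hc2;
      [left | right; left | right; right; left | right; right; right]; exact hb'. }
    clear hnb. destruct hnb' as [b1 [b2 [b3 b4]]].
    unfold bad in *. apply Rnot_lt_le in b1. apply Rnot_lt_le in b2.
    apply Rnot_lt_le in b3. apply Rnot_lt_le in b4.
    assert (hcs : ccont (rect x (x + 2 * w) y (y + 2 * h)) f) by (apply ccont_sub with (2 := hc); auto).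
    assert (e : rint f x (x + 2 * w) y (y + 2 * h) =
      (rint f x (x + w) y (y + h) + rint f (x + w) (x + w + w) y (y + h)
      + (rint f x (x + w) (y + h) (y + h + h) + rint f (x + w) (x + w + w) (y + h) (y + h + h)))%C).
    { assert (s1 : seg x (x + 2 * w) (x + w)) by (apply seg_le; lra).
      assert (s2 : seg y (y + 2 * h) (y + h)) by (apply seg_le; lra).
      rewrite (rint_split_y f x (x + 2 * w) y (y + h)) by auto.
      replace (y + h + h) with (y + 2 * h) by ring. replace (x + w + w) with (x + 2 * w) by ring.
      rewrite (rint_split_x f x (x + w) (x + 2 * w) y (y + h)), 
        (rint_split_x f x (x + w) (x + 2 * w) (y + h) (y + 2 * h)); auto.
      - apply ccont_sub with (2 := hcs). intros z [h1 h2]; split; auto.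
        apply seg_sub with (3 := h2); auto using seg_l, seg_r.
      - apply ccont_sub with (2 := hcs). intros z [h1 h2]; split; auto.
        apply seg_sub with (3 := h2); auto using seg_l, seg_r. }
    rewrite e in hb. apply (Rlt_not_le _ _ hb).
    eapply Rle_trans; [apply Cmod_triangle|].
    eapply Rle_trans; [apply Rplus_le_compat; apply Cmod_triangle|]. nra. }
destruct (nested_point (fun n => fst (corner n)) (fun n => W / 2 ^ n)) as [lx hlx]; auto;
  try (intros n; apply hmx).
destruct (nested_point (fun n => snd (corner n)) (fun n => H / 2 ^ n)) as [ly hly]; auto;
  try (intros n; apply hmy).
assert (hz : forall n, rect (fst (corner n)) (fst (corner n) + W / 2 ^ n) (snd (corner n))
   (snd (corner n) + H / 2 ^ n) (lx, ly)).
{ intros n. specialize (hW n). specialize (hH n).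
  split; apply seg_le; try lra; [apply hlx|apply hly]. }
destruct (hf (lx, ly)) as [l hl].
{ apply (hsub 0%nat), hz. }
destruct (rint_local f (lx, ly) l eps hl heps) as [d [hd h1]].
destruct (pow2_archimed (W + H) d hd) as [n hn].
replace ((W + H) / 2 ^ n) with (W / 2 ^ n + H / 2 ^ n) in hn by (field; apply pow_nonzero; lra).
apply (Rlt_not_le _ _ (hbad n)).
specialize (hW n). specialize (hH n).
eapply Rle_trans; [apply h1; auto; try lra|].
- apply ccont_sub with (2 := hc). apply hsub.
- right. f_equal. f_equal; f_equal; ring.
Qed.

(** Exchanging two bounds only changes the sign of the boundary integral. Arbitrary order is
    required for primitives, whose increments go in any direction. *)
Theorem goursat (f : C -> C) (x0 x1 y0 y1 : R) :
  (forall z, rect x0 x1 y0 y1 z -> differentiable f z) -> rint f x0 x1 y0 y1 = 0.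
Proof.
intros hf.
assert (hc : ccont (rect x0 x1 y0 y1) f) by (apply differentiable_ccont; auto).
assert (hh : forall y, seg y0 y1 y -> hor f x1 x0 y = (- hor f x0 x1 y)%C).
{ intros y hy. apply is_cint_cint, is_cint_swap, rcont_ex. eapply hor_rcont; eauto. intros; split; auto. }
assert (hv : forall x, seg x0 x1 x -> ver f y1 y0 x = (- ver f y0 y1 x)%C).
{ intros y hy. apply is_cint_cint, is_cint_swap, rcont_ex. eapply ver_rcont; eauto. intros; split; auto. }
assert (hx : rint f x1 x0 y0 y1 = (- rint f x0 x1 y0 y1)%C).
{ unfold rint. rewrite (hh _ (seg_l _ _)), (hh _ (seg_r _ _)). ring. }
assert (hy : rint f x0 x1 y1 y0 = (- rint f x0 x1 y0 y1)%C).
{ unfold rint. rewrite (hv _ (seg_l _ _)), (hv _ (seg_r _ _)). ring. }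
assert (hxy : rint f x1 x0 y1 y0 = rint f x0 x1 y0 y1).
{ unfold rint. rewrite (hv _ (seg_l _ _)), (hv _ (seg_r _ _)), (hh _ (seg_l _ _)), (hh _ (seg_r _ _)). ring. }
assert (opp0 : forall z : C, (- z)%C = 0 -> z = 0).
{ intros z hz. replace z with (- - z)%C by ring. rewrite hz; ring. }
destruct (Rle_dec x0 x1) as [h1|h1]; destruct (Rle_dec y0 y1) as [h2|h2].
- apply goursat_le; auto.
- apply opp0. rewrite <- hy. apply goursat_le; try lra.
  intros z [a b]; apply hf; split; auto using seg_sym.
- apply opp0. rewrite <- hx. apply goursat_le; try lra.
  intros z [a b]; apply hf; split; auto using seg_sym.
- rewrite <- hxy. apply goursat_le; try lra.
  intros z [a b]; apply hf; split; auto using seg_sym.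
Qed.

(** * Primitives *)

Definition open_set (D : C -> Prop) : Prop :=
  forall w, D w -> exists r, 0 < r /\ forall z, Cmod (z - w) < r -> D z.

(* A spine on the horizontal line Im = b through (a, b), with vertical teeth. *)
Definition comb (a b : R) (D : C -> Prop) : Prop :=
  open_set D /\ forall x y, D (x, y) ->
  (forall t, seg b y t -> D (x, t)) /\ (forall s, seg a x s -> D (s, b)).

Lemma hor_local_bound (f : C -> C) (w : C) (x0 x1 y d eps : R) :
  (forall x, seg x0 x1 x -> Cmod ((x, y) - w) < d) ->
  (forall z, Cmod (z - w) < d -> Cmod (f z - f w) <= eps) ->
  rcont (seg x0 x1) (fun x => f (x, y)) ->
  Cmod (hor f x0 x1 y - RtoC (x1 - x0) * f w) <= Rabs (x1 - x0) * eps.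
Proof.
intros hd he hf.
apply is_cint_bound_const with (f := fun x => (f (x, y) - f w)%C).
- intros t ht. apply he, hd, ht.
- apply is_cint_minus; [apply rcont_ex, hf|apply is_cint_const].
Qed.

Lemma ver_local_bound (f : C -> C) (w : C) (y0 y1 x d eps : R) :
  (forall y, seg y0 y1 y -> Cmod ((x, y) - w) < d) ->
  (forall z, Cmod (z - w) < d -> Cmod (f z - f w) <= eps) ->
  rcont (seg y0 y1) (fun y => f (x, y)) ->
  Cmod (ver f y0 y1 x - RtoC (y1 - y0) * f w) <= Rabs (y1 - y0) * eps.
Proof.
intros hd he hf.
apply is_cint_bound_const with (f := fun y => (f (x, y) - f w)%C).
- intros t ht. apply he, hd, ht.
- apply is_cint_minus; [apply rcont_ex, hf|apply is_cint_const].
Qed.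

Lemma seg_dist (a b t : R) : seg a b t -> Rabs (t - a) <= Rabs (b - a).
Proof.
unfold seg, Rmin, Rmax. destruct (Rle_dec a b); intros h; unfold Rabs; repeat destruct Rcase_abs; lra.
Qed.

(** The primitive integrates along the spine, then along a tooth. For a nearby point, Goursat on the
    rectangle between the spine and the height y turns its increment into an integral over a short
    horizontal and a short vertical segment. That rectangle lies in D because it is filled by the
    teeth ending on the short horizontal segment. *)
Theorem comb_primitive (a b : R) (D : C -> Prop) (f : C -> C) : comb a b D ->
  (forall z, D z -> differentiable f z) -> exists G, forall z, D z -> cderiv G z (f z).
Proof.
intros [ho hcomb] hf.
exists (fun z => (hor f a (Re z) b + Ci * ver f b (Im z) (Re z))%C).
assert (hfc : ccont D f) by (apply differentiable_ccont; auto).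
intros [x y] hw eps he.
destruct (ho _ hw) as [r [hr hball]].
destruct (hf _ hw) as [l hl].
destruct (cderiv_cont f _ l hl (eps / 2)) as [d [hd hdl]]; [lra|].
set (e := Rmin r d).
assert (he' : 0 < e) by (apply Rmin_pos; lra).
exists (e / 2); split; [lra|].
intros [x' y'] hq. simpl.
assert (hx : Rabs (x' - x) <= Cmod ((x', y') - (x, y))) by apply (re_le_Cmod ((x', y') - (x, y))%C).
assert (hy : Rabs (y' - y) <= Cmod ((x', y') - (x, y))) by apply (im_le_Cmod ((x', y') - (x, y))%C).
assert (hb : forall s t, seg x x' s -> seg y y' t -> Cmod ((s, t) - (x, y)) < e).
{ intros s t hs ht. apply seg_dist in hs. apply seg_dist in ht.
  eapply Rle_lt_trans; [apply (Cmod_le_abs (s - x) (t - y))|]. lra. }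
assert (hD : forall s t, seg x x' s -> seg y y' t -> D (s, t)).
{ intros s t hs ht. apply hball. eapply Rlt_le_trans; [apply hb; auto|apply Rmin_l]. }
assert (hfe : forall z, Cmod (z - (x, y)) < e -> Cmod (f z - f (x, y)) <= eps / 2).
{ intros z hz. left. apply hdl. exact (lt_Rmin_r hz). }
assert (hw' : D (x', y)) by (apply hD; [apply seg_r|apply seg_l]).
assert (hw'' : D (x', y')) by (apply hD; apply seg_r).
assert (hcx : rcont (seg x x') (fun s => f (s, y))).
{ apply hor_rcont with D; auto. intros s hs. apply hD; auto using seg_l. }
assert (hcy : rcont (seg y y') (fun t => f (x', t))).
{ apply ver_rcont with D; auto. intros s hs. apply hD; auto using seg_r. }
assert (key : (hor f a x' b + Ci * ver f b y' x' - (hor f a x b + Ci * ver f b y x))%C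
  = (hor f x x' y + Ci * ver f y y' x')%C).
{ assert (e1 : hor f a x' b = (hor f a x b + hor f x x' b)%C).
  { symmetry. apply cint_chasles.
    - apply hor_rcont with D; auto. intros s hs. apply (hcomb x y hw); auto.
    - apply hor_rcont with D; auto. intros s hs.
      apply (hcomb s y); auto using seg_l, seg_r. }
  assert (e2 : ver f b y' x' = (ver f b y x' + ver f y y' x')%C).
  { symmetry. apply cint_chasles; auto.
    apply ver_rcont with D; auto. intros s hs. apply (hcomb x' y); auto. }
  assert (e3 : rint f x x' b y = 0).
  { apply goursat. intros [s t] [hs ht]. apply hf. apply (hcomb s y); auto using seg_l. }
  unfold rint in e3. rewrite e1, e2.
  replace (hor f x x' b) with (hor f x x' b + Ci * ver f b y x' - hor f x x' y - Ci * ver f b y x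
    - Ci * ver f b y x' + hor f x x' y + Ci * ver f b y x)%C by ring.
  rewrite e3. ring. }
rewrite key.
replace (hor f x x' y + Ci * ver f y y' x' - f (x, y) * ((x', y') - (x, y)))%C with
  ((hor f x x' y - RtoC (x' - x) * f (x, y)) + Ci * (ver f y y' x' - RtoC (y' - y) * f (x, y)))%C.
2: { replace ((x', y') - (x, y))%C with (RtoC (x' - x) + Ci * RtoC (y' - y))%C.
     - ring.
     - apply C_eq_parts; simpl; ring. }
eapply Rle_trans; [apply Cmod_triangle|]. rewrite Cmod_mult, Cmod_Ci, Rmult_1_l.
assert (h1 : Cmod (hor f x x' y - RtoC (x' - x) * f (x, y)) <= Rabs (x' - x) * (eps / 2)).
{ apply hor_local_bound with e; auto. intros s hs; apply hb; auto using seg_l. }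
assert (h2 : Cmod (ver f y y' x' - RtoC (y' - y) * f (x, y)) <= Rabs (y' - y) * (eps / 2)).
{ apply ver_local_bound with e; auto. intros s hs; apply hb; auto using seg_r. }
nra.
Qed.

(** * Consequences of Cauchy's theorem on discs *)

(* [k] is pulled back by the exponential to the strip Re z < ln r, where
   Cauchy's theorem on rectangles of height 2 pi shows that the mean of [k]
   over circles centred at [q] does not depend on the radius. *)
Lemma punctured_disc_bound (k : C -> C) (q L : C) (r s M : R) : 0 < s < r ->
  (forall p, 0 < Cmod (p - q) < r -> differentiable k p) ->
  (forall eps, 0 < eps -> exists d, 0 < d /\ forall p, 0 < Cmod (p - q) < d -> Cmod (k p - L) <= eps) ->
  (forall p, Cmod (p - q) = s -> Cmod (k p) <= M) -> Cmod L <= M.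
Proof.
intros hs hk hL hM.
set (phi := fun z => k (q + Cexp z)%C).
assert (hmod : forall z, Cmod (q + Cexp z - q) = exp (Re z)).
{ intros z. replace (q + Cexp z - q)%C with (Cexp z) by ring. apply Cmod_Cexp. }
assert (hphi : forall z, Re z <= ln s -> differentiable phi z).
{ intros z hz.
  assert (hz' : exp (Re z) <= s) by (rewrite <- (exp_ln s) by lra; apply exp_le; auto).
  destruct (hk (q + Cexp z)%C) as [l hl].
  - rewrite hmod. split; [apply exp_pos|lra].
  - exists (l * (0 + Cexp z))%C. apply (cderiv_comp (fun z => q + Cexp z)%C k); auto.
    apply cderiv_plus; [apply cderiv_const|apply cderiv_Cexp]. }
assert (hpi := PI_RGT_0).
assert (hper : forall x, phi (x, 2 * PI) = phi (x, 0)).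
{ intros x. unfold phi, Cexp; simpl. rewrite cos_2PI, sin_2PI, cos_0, sin_0. reflexivity. }
(* By periodicity the two horizontal sides cancel, which leaves the equality of the vertical
   ones. *)
assert (heq : forall A, A <= ln s -> ver phi 0 (2 * PI) A = ver phi 0 (2 * PI) (ln s)).
{ intros A hA.
  assert (h := goursat phi A (ln s) 0 (2 * PI)).
  unfold rint in h.
  replace (hor phi A (ln s) (2 * PI)) with (hor phi A (ln s) 0) in h.
  - assert (e : (Ci * (ver phi 0 (2 * PI) (ln s) - ver phi 0 (2 * PI) A))%C = 0).
    { rewrite <- h.
      - ring.
      - intros z [hz _]. apply hphi. rewrite seg_le in hz by lra. lra. }
    replace (ver phi 0 (2 * PI) (ln s)) with (ver phi 0 (2 * PI) A +
      - Ci * (Ci * (ver phi 0 (2 * PI) (ln s) - ver phi 0 (2 * PI) A)))%C.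
    + rewrite e; ring.
    + replace (- Ci * (Ci * (ver phi 0 (2 * PI) (ln s) - ver phi 0 (2 * PI) A)))%C
       with (- (Ci * Ci) * (ver phi 0 (2 * PI) (ln s) - ver phi 0 (2 * PI) A))%C by ring.
      replace (Ci * Ci)%C with (- (1))%C by (apply C_eq_parts; simpl; ring). ring.
  - unfold hor. f_equal. apply functional_extensionality. intros x. symmetry; apply hper. }
assert (hrc : forall A, A <= ln s -> rcont (seg 0 (2 * PI)) (fun y => phi (A, y))).
{ intros A hA. apply ver_rcont with (fun z => Re z <= ln s); auto.
  apply differentiable_ccont; auto. }
assert (h1 : Cmod (ver phi 0 (2 * PI) (ln s)) <= 2 * PI * M).
{ rewrite <- (Rabs_pos_eq (2 * PI)) at 2 by lra.
  replace (Rabs (2 * PI)) with (Rabs (2 * PI - 0)) by (f_equal; ring).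
  apply is_cint_bound_const with (fun y => phi (ln s, y)).
  - intros t _. apply hM. rewrite hmod. simpl. apply exp_ln; lra.
  - apply rcont_ex, hrc; lra. }
apply Rnot_lt_le. intros hlt.
destruct (hL ((Cmod L - M) / 2)) as [d [hd h2]]; [lra|].
(* A circle of radius e^A smaller than both s and d: the mean there is the one on the circle of
   radius s, and k is close to L there. *)
set (A := Rmin (ln s) (ln (d / 2))).
assert (hA : A <= ln s) by apply Rmin_l.
assert (hA2 : exp A < d).
{ apply Rle_lt_trans with (exp (ln (d / 2))); [apply exp_le, Rmin_r|]. rewrite exp_ln; lra. }
assert (h3 : Cmod (ver phi 0 (2 * PI) A - RtoC (2 * PI - 0) * L) <= Rabs (2 * PI - 0) * ((Cmod L - M) / 2)).
{ apply is_cint_bound_const with (fun y => phi (A, y) - L)%C.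
  - intros t _. apply h2. rewrite hmod. simpl. split; [apply exp_pos|auto].
  - apply is_cint_minus; [apply rcont_ex; auto|apply is_cint_const]. }
rewrite Rminus_0_r in h3. rewrite (Rabs_pos_eq (2 * PI)) in h3 by lra.
rewrite (heq A hA) in h3.
assert (h4 : Cmod (RtoC (2 * PI) * L) <= 2 * PI * M + 2 * PI * ((Cmod L - M) / 2)).
{ replace (RtoC (2 * PI) * L)%C with
   (ver phi 0 (2 * PI) (ln s) - (ver phi 0 (2 * PI) (ln s) - RtoC (2 * PI) * L))%C by ring.
  eapply Rle_trans; [apply Cmod_minus_le|]. lra. }
rewrite Cmod_mult, Cmod_R, Rabs_pos_eq in h4 by lra.
assert (h5 : 2 * PI * (Cmod L - (M + (Cmod L - M) / 2)) <= 0) by lra.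
assert (0 < 2 * PI * (Cmod L - (M + (Cmod L - M) / 2))) by (apply Rmult_lt_0_compat; lra).
lra.
Qed.

Lemma max_circle_bound (f : C -> C) (q : C) (r s M : R) : 0 < s < r ->
  (forall p, Cmod (p - q) < r -> differentiable f p) ->
  (forall p, Cmod (p - q) = s -> Cmod (f p) <= M) -> Cmod (f q) <= M.
Proof.
intros hs hf hM. apply punctured_disc_bound with f q r s; auto.
- intros p hp; apply hf; lra.
- intros eps he. destruct (hf q) as [l hl].
  { rewrite Cmod_diag; lra. }
  destruct (cderiv_cont f q l hl eps he) as [d [hd h1]].
  exists d; split; auto. intros p hp. left; apply h1; lra.
Qed.

(** The difference quotient is holomorphic on the punctured disc, tends to l at q and is at most 2 M
    / s on the circle; the factor 2 is due to the term f q. *)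
Lemma cauchy_derivative_bound (f : C -> C) (q l : C) (r s M : R) : 0 < s < r ->
  (forall p, Cmod (p - q) < r -> differentiable f p) -> cderiv f q l ->
  (forall p, Cmod (p - q) <= s -> Cmod (f p) <= M) -> Cmod l <= 2 * M / s.
Proof.
intros hs hf hl hM.
assert (hqq : Cmod (q - q) = 0) by (replace (q - q)%C with (RtoC 0) by ring; apply Cmod_0).
apply punctured_disc_bound with (fun p => (f p - f q) * / (p - q))%C q r s; auto.
- intros p hp. destruct (hf p) as [m hm]; [lra|].
  assert (hpq : (p - q)%C <> 0) by (apply Cmod_gt_0; lra).
  eexists. apply (cderiv_mult (fun p => f p - f q)%C (fun p => / (p - q))%C).
  + apply cderiv_minus; [exact hm|apply cderiv_const].
  + apply (cderiv_comp (fun p => p - q)%C (fun z => / z)%C).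
    * apply (cderiv_minus (fun z => z)); [apply cderiv_id|apply cderiv_const].
    * apply cderiv_inv; auto.
- intros eps he. destruct (hl eps he) as [d [hd h1]].
  exists d; split; auto. intros p hp.
  assert (hpq : (p - q)%C <> 0) by (apply Cmod_gt_0; lra).
  replace ((f p - f q) * / (p - q) - l)%C with ((f p - f q - l * (p - q)) * / (p - q))%C
    by (field; auto).
  rewrite Cmod_mult, Cmod_inv by auto.
  apply Rle_trans with (eps * Cmod (p - q) * / Cmod (p - q)).
  + apply Rmult_le_compat_r; [left; apply Rinv_0_lt_compat; lra|]. apply h1; lra.
  + right; field. lra.
- intros p hp. assert (hpq : (p - q)%C <> 0) by (apply Cmod_gt_0; lra).
  rewrite Cmod_mult, Cmod_inv, hp by auto.
  apply Rmult_le_compat_r; [left; apply Rinv_0_lt_compat; lra|].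
  eapply Rle_trans; [apply Cmod_minus_le|].
  assert (h1 := hM p). assert (h2 := hM q). lra.
Qed.

(** * Mean value inequality, completeness and uniform limits *)

Lemma is_derive_scal_real (f : R -> R) (t l : R) : is_derive f t l -> forall c, is_derive (fun s => c * f s) t (c * l).
Proof. intros h c. apply (is_derive_scal f t c l h). Qed.

(** The real mean value theorem is applied to the projection of f on the direction d = f b - f a,
    whose increment along the segment is |d|^2. *)
Lemma mean_value_C (f : C -> C) (a b : C) (M : R) :
  (forall t, 0 <= t <= 1 -> exists l, cderiv f (a + RtoC t * (b - a))%C l /\ Cmod l <= M) ->
  Cmod (f b - f a) <= M * Cmod (b - a).
Proof.
intros h.
set (d := (f b - f a)%C).
destruct (Req_dec (Cmod d) 0) as [e|e].
{ rewrite e. destruct (h 0) as [l [_ hl]]; [lra|].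
  apply Rmult_le_pos; [|apply Cmod_ge_0]. eapply Rle_trans; [apply Cmod_ge_0|exact hl]. }
assert (hd : 0 < Cmod d) by (assert (h0 := Cmod_ge_0 d); lra).
set (path := fun t => (a + RtoC t * (b - a))%C).
set (phi := fun t => Re d * Re (f (path t)) + Im d * Im (f (path t))).
destruct (MVT_gen phi 0 1 (fun t => Re d * Derive (fun s => Re (f (path s))) t
   + Im d * Derive (fun s => Im (f (path s))) t)) as [c [hc e1]].
- intros t ht. rewrite Rmin_left, Rmax_right in ht by lra.
  destruct (h t) as [l [hl _]]; [lra|].
  assert (hr := rderiv_comp f path t (b - a)%C l (rderiv_line a (b - a)%C t) hl).
  apply rderiv_parts in hr. destruct hr as [hr1 hr2].
  cbv beta. rewrite (is_derive_unique _ _ _ hr1), (is_derive_unique _ _ _ hr2).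
  apply (is_derive_plus (V := R_NormedModule)); apply is_derive_scal_real; assumption.
- intros t ht. rewrite Rmin_left, Rmax_right in ht by lra.
  destruct (h t) as [l [hl _]]; [lra|].
  assert (hr := rderiv_comp f path t (b - a)%C l (rderiv_line a (b - a)%C t) hl).
  apply rderiv_parts in hr. destruct hr as [hr1 hr2].
  apply continuity_pt_filterlim.
  apply (ex_derive_continuous (V := R_NormedModule)). eexists.
  apply (is_derive_plus (V := R_NormedModule)); apply is_derive_scal_real; eassumption.
- rewrite Rmin_left, Rmax_right in hc by lra.
  destruct (h c hc) as [l [hl hlM]].
  assert (hr := rderiv_comp f path c (b - a)%C l (rderiv_line a (b - a)%C c) hl).
  apply rderiv_parts in hr. destruct hr as [hr1 hr2].
  cbv beta in e1. rewrite (is_derive_unique _ _ _ hr1), (is_derive_unique _ _ _ hr2) in e1.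
  assert (e2 : phi 1 - phi 0 = Cmod d ^ 2).
  { unfold phi, path. replace (a + 1 * (b - a))%C with b by ring.
    replace (a + 0 * (b - a))%C with a by ring. rewrite Cmod2_alt. unfold d.
    destruct (f b), (f a); simpl; ring. }
  rewrite e2 in e1.
  assert (e3 : Re d * Re (l * (b - a))%C + Im d * Im (l * (b - a))%C = Re (Cconj d * (l * (b - a)))%C).
  { destruct d as [d1 d2], (l * (b - a))%C; simpl; ring. }
  rewrite e3 in e1.
  assert (h1 : Re (Cconj d * (l * (b - a)))%C <= Cmod d * (M * Cmod (b - a))).
  { eapply Rle_trans; [apply Rle_abs|]. eapply Rle_trans; [apply re_le_Cmod|].
    rewrite !Cmod_mult, Cmod_conj. apply Rmult_le_compat_l; [lra|].
    apply Rmult_le_compat_r; [apply Cmod_ge_0|auto]. }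
  apply Rmult_le_reg_l with (Cmod d); auto.
  replace (Cmod d * Cmod d) with (Cmod d ^ 2) by ring. lra.
Qed.

Lemma C_complete (u : nat -> C) :
  (forall eps, 0 < eps -> exists N, forall n m, (N <= n)%nat -> (N <= m)%nat -> Cmod (u n - u m) <= eps) ->
  exists l, forall eps, 0 < eps -> exists N, forall n, (N <= n)%nat -> Cmod (u n - l) <= eps.
Proof.
intros h.
destruct (Rcomplete.R_complete (fun n => Re (u n))) as [l1 h1].
{ intros eps he. destruct (h (eps / 2)) as [N hN]; [lra|]. exists N. intros n m hn hm.
  unfold Rdist. specialize (hN n m hn hm).
  eapply Rle_lt_trans; [apply (re_le_Cmod (u n - u m)%C)|]. lra. }
destruct (Rcomplete.R_complete (fun n => Im (u n))) as [l2 h2].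
{ intros eps he. destruct (h (eps / 2)) as [N hN]; [lra|]. exists N. intros n m hn hm.
  unfold Rdist. specialize (hN n m hn hm).
  eapply Rle_lt_trans; [apply (im_le_Cmod (u n - u m)%C)|]. lra. }
exists (l1, l2). intros eps he.
destruct (h1 (eps / 2)) as [N1 hN1]; [lra|].
destruct (h2 (eps / 2)) as [N2 hN2]; [lra|].
exists (max N1 N2). intros n hn.
specialize (hN1 n ltac:(lia)). specialize (hN2 n ltac:(lia)). unfold Rdist in *.
eapply Rle_trans; [apply (Cmod_le_abs (Re (u n) - l1) (Im (u n) - l2))|]. lra.
Qed.

(** Cauchy's estimate makes the derivatives at q a Cauchy sequence, and it makes fn m - fn n
    Lipschitz near q with a small constant, by the mean value inequality. Letting m tend to
    infinity, f - fn n has the same small Lipschitz bound from q, so the differentiability of one fn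
    n is enough. *)
Lemma uniform_limit_differentiable (fn : nat -> C -> C) (f : C -> C) (q : C) (r : R) : 0 < r ->
  (forall n p, Cmod (p - q) < r -> differentiable (fn n) p) ->
  uniform_cv_on (fun p => Cmod (p - q) < r) fn f -> differentiable f q.
Proof.
intros hr hfn hcv.
assert (hder : forall n m eps, (forall p, Cmod (p - q) < r -> Cmod (fn n p - fn m p) <= eps) ->
  forall p l, Cmod (p - q) < r / 2 -> cderiv (fun z => fn n z - fn m z)%C p l -> Cmod l <= 8 * eps / r).
{ intros n m eps hnm p l hp hl.
  (* The disc of radius r / 2 about p stays in the given disc; the estimate is taken on its circle
     of radius r / 4. *)
  replace (8 * eps / r) with (2 * eps / (r / 4)) by (field; lra).
  assert (hpz : forall z, Cmod (z - p) < r / 2 -> Cmod (z - q) < r).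
  { intros z hz. eapply Rle_lt_trans; [apply (Cmod_dist_tri z p q)|]. lra. }
  apply cauchy_derivative_bound with (fun z => fn n z - fn m z)%C p (r / 2); auto.
  - lra.
  - intros z hz. destruct (hfn n z (hpz z hz)) as [l1 hl1]. destruct (hfn m z (hpz z hz)) as [l2 hl2].
    eexists; apply cderiv_minus; eassumption.
  - intros z hz. apply hnm, hpz. lra. }
assert (hcau : forall eps, 0 < eps -> exists N, forall n m, (N <= n)%nat -> (N <= m)%nat ->
  forall p, Cmod (p - q) < r -> Cmod (fn n p - fn m p) <= eps).
{ intros eps he. destruct (hcv (eps / 2)) as [N hN]; [lra|]. exists N. intros n m hn hm p hp.
  assert (h1 := hN n hn p hp). assert (h2 := hN m hm p hp).
  eapply Rle_trans; [apply (Cmod_dist_tri _ (f p))|]. rewrite (Cmod_minus_sym (f p)). lra. }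
assert (hqq : Cmod (q - q) < r / 2) by (rewrite Cmod_diag; lra).
assert (hqq' : Cmod (q - q) < r) by lra.
assert (hl : exists l : nat -> C, forall n, cderiv (fn n) q (l n)).
{ apply (choice (fun n l => cderiv (fn n) q l)). intros n. apply (hfn n q hqq'). }
destruct hl as [l hl].
destruct (C_complete l) as [lim hlim].
{ intros eps he. destruct (hcau (eps * r / 8)) as [N hN].
  - assert (0 < eps * r) by (apply Rmult_lt_0_compat; lra). lra.
  - exists N. intros n m hn hm.
    assert (h1 := hder n m _ (hN n m hn hm) q (l n - l m)%C hqq (cderiv_minus _ _ _ _ _ (hl n) (hl m))).
    replace (8 * (eps * r / 8) / r) with eps in h1 by (field; lra). exact h1. }
exists lim. intros eps he.
destruct (hcau (eps / 3 * r / 8)) as [N1 hN1].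
{ assert (0 < eps * r) by (apply Rmult_lt_0_compat; lra). lra. }
destruct (hlim (eps / 3)) as [N2 hN2]; [lra|].
set (n := max N1 N2).
destruct (hl n (eps / 3)) as [d [hd h1]]; [lra|].
exists (Rmin d (r / 2)); split; [apply Rmin_pos; lra|].
intros z hz.
specialize (h1 z (lt_Rmin_l hz)).
assert (hz2 := lt_Rmin_r hz).
assert (h2 : Cmod (f z - fn n z - (f q - fn n q)) <= eps / 3 * Cmod (z - q)).
(* If the inequality failed by [g], an m with fn m within g / 3 of f at both z and q would
   contradict the Lipschitz bound for fn m - fn n. *)
{ apply Rnot_lt_le. intros hlt.
  set (g := Cmod (f z - fn n z - (f q - fn n q)) - eps / 3 * Cmod (z - q)).
  destruct (hcv (g / 3)) as [N3 hN3]; [unfold g; lra|].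
  set (m := max n N3).
  assert (h3 : Cmod ((fn m z - fn n z) - (fn m q - fn n q)) <= eps / 3 * Cmod (z - q)).
  { apply (mean_value_C (fun z => fn m z - fn n z)%C). intros t ht.
    assert (ht' : Cmod (q + RtoC t * (z - q) - q) < r / 2).
    { replace (q + RtoC t * (z - q) - q)%C with (RtoC t * (z - q))%C by ring.
      rewrite Cmod_mult, Cmod_R, Rabs_pos_eq by lra. assert (h0 := Cmod_ge_0 (z - q)). nra. }
    destruct (hfn m (q + RtoC t * (z - q))%C) as [l1 hl1]; [lra|].
    destruct (hfn n (q + RtoC t * (z - q))%C) as [l2 hl2]; [lra|].
    assert (hmn := cderiv_minus _ _ _ _ _ hl1 hl2).
    exists (l1 - l2)%C. split; [exact hmn|].
    replace (eps / 3) with (8 * (eps / 3 * r / 8) / r) by (field; lra).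
    apply (hder m n (eps / 3 * r / 8)) with (2 := ht'); [|exact hmn].
    apply hN1; lia. }
  assert (h4 := hN3 m ltac:(lia) z ltac:(lra)). assert (h5 := hN3 m ltac:(lia) q hqq').
  assert (h6 : Cmod (f z - fn n z - (f q - fn n q)) <= 2 * (g / 3) + eps / 3 * Cmod (z - q)).
  { replace (f z - fn n z - (f q - fn n q))%C with
      ((fn m q - f q) - (fn m z - f z) + ((fn m z - fn n z) - (fn m q - fn n q)))%C by ring.
    eapply Rle_trans; [apply Cmod_triangle|].
    eapply Rle_trans; [apply Rplus_le_compat_r; apply Cmod_minus_le|]. lra. }
  unfold g in h6. lra. }
assert (h3 := hN2 n ltac:(lia)).
replace (f z - f q - lim * (z - q))%C with
 ((f z - fn n z - (f q - fn n q)) + (fn n z - fn n q - l n * (z - q)) + (l n - lim) * (z - q))%C by ring.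
eapply Rle_trans; [apply Cmod_triangle|].
eapply Rle_trans; [apply Rplus_le_compat_r; apply Cmod_triangle|].
rewrite Cmod_mult.
assert (h4 : Cmod (l n - lim) * Cmod (z - q) <= eps / 3 * Cmod (z - q)).
{ apply Rmult_le_compat_r; [apply Cmod_ge_0|auto]. }
lra.
Qed.

(** * Removing polynomial growth near the real axis *)

Lemma differentiable_pow (f : C -> C) (p : C) (n : nat) : differentiable f p ->
  differentiable (fun z => f z ^ n)%C p.
Proof.
intros [l hl]. induction n as [|n [m hm]].
- exists 0. apply (cderiv_const 1).
- eexists. apply (cderiv_mult f (fun z => f z ^ n)%C); eassumption.
Qed.

(* Power of a point: if the circle meets the real axis at x1 and x2, the left-hand
   side is |p - x1| |p - x2|. *)
Lemma circle_chords (u e s : R) (p : C) : 0 <= s -> Cmod (p - (u, e)) = s ->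
  Cmod ((p - RtoC u) * (p - RtoC u) - RtoC (s * s - e * e)) = 2 * s * Rabs (Im p).
Proof.
intros hs hp. destruct p as [x y]. simpl Im.
assert (h1 : (x - u) ^ 2 + (y - e) ^ 2 = s ^ 2).
{ rewrite <- hp, Cmod2_alt. simpl. ring. }
set (g := (((x, y) - RtoC u) * ((x, y) - RtoC u) - RtoC (s * s - e * e))%C).
rewrite <- (Rabs_pos_eq (Cmod g)) by apply Cmod_ge_0.
rewrite <- (Rabs_pos_eq (2 * s)) by lra. rewrite <- Rabs_mult.
apply Rsqr_eq_abs_0. unfold Rsqr.
replace (Cmod g * Cmod g) with (Cmod g ^ 2) by ring.
rewrite Cmod2_alt.
set (X := (x - u) ^ 2) in h1.
replace (Re g ^ 2 + Im g ^ 2) with ((X - y ^ 2 - (s * s - e * e)) ^ 2 + 4 * X * y ^ 2)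
  by (unfold g, X; simpl; ring).
assert (hX : X = s ^ 2 - (y - e) ^ 2) by lra. rewrite hX. ring.
Qed.

(* On a circle meeting the real axis at x1 and x2, the factor ((p - x1) (p - x2))^N
   compensates for the growth of [f] near the axis. *)
Lemma real_axis_bound (f : C -> C) (b r A : R) (N : nat) : 0 < r ->
  (forall p, Cmod (p - RtoC b) < r -> differentiable f p) ->
  (forall p, Cmod (p - RtoC b) < r -> Cmod (f p) * Rabs (Im p) ^ N <= A) ->
  forall q, Cmod (q - RtoC b) < r / 2 -> Cmod (f q) <= A * (8 / r) ^ N.
Proof.
intros hr hf hA q hq.
(* Chosen so that the disc of radius 2 s about any q of the half disc stays in the disc of radius
   r. *)
set (s := r / 4).
assert (hs : 0 < s) by (unfold s; lra).
replace (8 / r) with (2 / s) by (unfold s; field; lra).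
assert (hball : forall p, Cmod (p - q) < 2 * s -> Cmod (p - RtoC b) < r).
{ intros p hp. eapply Rle_lt_trans; [apply (Cmod_dist_tri p q)|]. unfold s in hp; lra. }
assert (hpow : 0 < (2 / s) ^ N) by (apply pow_lt, Rdiv_lt_0_compat; lra).
(* Away from the axis the hypothesis already bounds f q; otherwise the circle of radius s about q
   meets the axis at two points. *)
destruct (Rle_lt_dec (s / 2) (Rabs (Im q))) as [h|h].
- assert (h1 := hA q ltac:(lra)).
  assert (h2 : (s / 2) ^ N <= Rabs (Im q) ^ N) by (apply pow_incr; lra).
  apply Rle_trans with (Cmod (f q) * (s / 2) ^ N * (2 / s) ^ N).
  + rewrite Rmult_assoc, <- Rpow_mult_distr.
    replace (s / 2 * (2 / s)) with 1 by (field; lra). rewrite pow1. lra.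
  + apply Rmult_le_compat_r; [lra|]. eapply Rle_trans; [|exact h1].
    apply Rmult_le_compat_l; [apply Cmod_ge_0|auto].
- destruct q as [u e]. simpl in h.
  set (dd := s * s - e * e).
  assert (hdd : 0 < dd).
  { unfold dd. assert (h1 : Rabs e * Rabs e = e * e) by (rewrite <- Rabs_mult; apply Rabs_pos_eq; nra).
    assert (h0 := Rabs_pos e). nra. }
  set (g := fun p : C => ((p - RtoC u) * (p - RtoC u) - RtoC dd)%C).
  assert (hg : forall p, differentiable g p).
  { intros p. eexists. apply cderiv_minus; [|apply cderiv_const].
    apply cderiv_mult; apply (cderiv_minus (fun z => z)); try apply cderiv_id; apply cderiv_const. }
  (* At the centre the weight equals - s^2 whatever the height e, so dividing by it costs a
     constant: (2 s)^N / s^(2 N) = (2 / s)^N. *)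
  assert (hgq : Cmod (g (u, e)) = s * s).
  { replace (g (u, e)) with (RtoC (- (s * s))).
    - rewrite Cmod_R, Rabs_left; nra.
    - unfold g, dd. apply C_eq_parts; simpl; ring. }
  assert (hgc : forall p, Cmod (p - (u, e)) = s -> Cmod (g p) = 2 * s * Rabs (Im p)).
  { intros p hp. apply circle_chords; auto; lra. }
  assert (hfin : Cmod (f (u, e) * g (u, e) ^ N)%C <= A * (2 * s) ^ N).
  { apply (max_circle_bound (fun p => f p * g p ^ N)%C (u, e) (2 * s) s); [lra| |].
    - intros p hp. destruct (hf p (hball p hp)) as [l1 hl1].
      destruct (differentiable_pow g p N (hg p)) as [l2 hl2].
      eexists; apply cderiv_mult; eassumption.
    - intros p hp. rewrite Cmod_mult, Cmod_pow, (hgc p hp), Rpow_mult_distr.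
      replace (Cmod (f p) * ((2 * s) ^ N * Rabs (Im p) ^ N)) with
        (Cmod (f p) * Rabs (Im p) ^ N * (2 * s) ^ N) by ring.
      apply Rmult_le_compat_r; [apply pow_le; lra|]. apply hA, hball. lra. }
  rewrite Cmod_mult, Cmod_pow, hgq in hfin.
  apply Rmult_le_reg_r with ((s * s) ^ N); [apply pow_lt; nra|].
  eapply Rle_trans; [exact hfin|]. right.
  rewrite Rmult_assoc, <- Rpow_mult_distr. do 2 f_equal. field. lra.
Qed.

(** * The shape of logarithmic half-planes *)

Lemma Cmod_ge_re (z : C) : Re z <= Cmod z.
Proof. eapply Rle_trans; [apply Rle_abs|apply re_le_Cmod]. Qed.

(** The cosine decreases on [0, pi], which replaces the argument by an inequality between real part
    and modulus. Being strict, it also excludes the apex, where both sides vanish. *)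
Lemma cone_minus_iff (w0 w : C) (theta : R) : 0 <= theta <= PI / 2 ->
  cone_minus w0 theta w <-> Cmod (w0 - w) * cos theta < Re (w0 - w).
Proof.
intros hth. unfold cone_minus. set (z := (w0 - w)%C).
assert (hpi := PI_RGT_0).
assert (hc : 0 <= cos theta) by (apply cos_ge_0; lra).
assert (hm := Cmod_ge_0 z).
destruct (Req_dec (Cmod z) 0) as [e|e].
{ assert (hz : z = 0) by (apply Cmod_eq_0; auto). rewrite hz, Cmod_0. simpl. split; [tauto|lra]. }
assert (hz : z <> 0) by (apply Cmod_gt_0; lra).
assert (hq : -1 <= Re z / Cmod z <= 1).
{ assert (h := re_le_Cmod z). apply Rabs_le_between in h.
  split; apply Rmult_le_reg_r with (Cmod z); try lra;
  unfold Rdiv; rewrite Rmult_assoc, Rinv_l; lra. }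
assert (harg : Rabs (Arg z) = acos (Re z / Cmod z)).
{ assert (h := acos_bound (Re z / Cmod z)).
  unfold Arg; destruct Rle_dec; [|rewrite Rabs_Ropp]; apply Rabs_pos_eq; lra. }
rewrite harg.
assert (hab := acos_bound (Re z / Cmod z)).
assert (hcos := cos_acos _ hq).
split.
- intros [_ h].
  assert (h1 : cos theta < Re z / Cmod z).
  { rewrite <- hcos. apply cos_decreasing_1; lra. }
  apply Rmult_lt_reg_r with (/ Cmod z); [apply Rinv_0_lt_compat; lra|].
  replace (Cmod z * cos theta * / Cmod z) with (cos theta) by (field; lra). exact h1.
- intros h. split; auto.
  apply cos_decreasing_0; try lra. rewrite hcos.
  apply Rmult_lt_reg_r with (Cmod z); [lra|].
  replace (Re z / Cmod z * Cmod z) with (Re z) by (field; lra). lra.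
Qed.

Lemma cone_minus_open (w0 w : C) (theta : R) : 0 <= theta <= PI / 2 -> cone_minus w0 theta w ->
  exists r, 0 < r /\ forall z, Cmod (z - w) < r -> cone_minus w0 theta z.
Proof.
intros hth h. rewrite cone_minus_iff in h by auto.
assert (hc := COS_bound theta).
assert (hc0 : 0 <= cos theta) by (apply cos_ge_0; lra).
set (g := Re (w0 - w)%C - Cmod (w0 - w) * cos theta).
exists (g / 2); split; [unfold g; lra|]. intros z hz.
apply cone_minus_iff; auto.
assert (h1 : Re (w0 - z)%C = Re (w0 - w)%C - Re (z - w)%C) by (destruct w0, w, z; simpl; ring).
assert (h2 := Cmod_ge_re (z - w)%C).
assert (h3 : Cmod (w0 - z) <= Cmod (w0 - w) + Cmod (z - w)).
{ rewrite (Cmod_minus_sym z w). apply Cmod_dist_tri. }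
assert (h4 := Cmod_ge_0 (z - w)).
rewrite h1.
apply Rle_lt_trans with ((Cmod (w0 - w) + Cmod (z - w)) * cos theta).
- apply Rmult_le_compat_r; auto.
- unfold g in hz. nra.
Qed.

Lemma cone_minus_left (w0 w : C) (theta s : R) : 0 <= theta <= PI / 2 -> 0 <= s ->
  cone_minus w0 theta w -> cone_minus w0 theta (w - RtoC s).
Proof.
intros hth hs h. rewrite cone_minus_iff in * by auto.
assert (hc := COS_bound theta).
assert (hc0 : 0 <= cos theta) by (apply cos_ge_0; lra).
replace (w0 - (w - RtoC s))%C with ((w0 - w) + RtoC s)%C by ring.
assert (h1 := Cmod_triangle (w0 - w) (RtoC s)). rewrite Cmod_R, Rabs_pos_eq in h1 by auto.
assert (h2 : Re (w0 - w + RtoC s)%C = Re (w0 - w)%C + s) by (destruct w0, w; simpl; ring).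
rewrite h2.
apply Rle_lt_trans with ((Cmod (w0 - w) + s) * cos theta).
- apply Rmult_le_compat_r; auto.
- nra.
Qed.

Lemma biggest_angle_range (H : C -> Prop) (w0 : C) (theta : R) :
  is_biggest_angle H w0 theta -> 0 <= theta <= PI / 2.
Proof.
intros [h1 [_ h3]]. split; auto. assert (hpi := PI_RGT_0).
apply h3; [lra|]. intros w [_ hw]. assert (h := Rabs_pos (Arg (w0 - w))). lra.
Qed.

Lemma nbhd_open (H : C -> Prop) : neighborhood_minus_infty H -> open_set H.
Proof.
intros [_ hH] w hw. apply hH in hw. destruct hw as [x [th [hx [hb hc]]]].
assert (hr := biggest_angle_range _ _ _ hb).
destruct (cone_minus_open _ _ _ hr hc) as [r [hr0 h]].
exists r; split; auto. intros z hz. apply hH. exists x, th. auto.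
Qed.

Lemma nbhd_left (H : C -> Prop) (w : C) (s : R) : neighborhood_minus_infty H -> 0 <= s ->
  H w -> H (w - RtoC s)%C.
Proof.
intros [_ hH] hs hw. apply hH in hw. destruct hw as [x [th [hx [hb hc]]]].
assert (hr := biggest_angle_range _ _ _ hb).
apply hH. exists x, th. split; [|split]; auto. apply cone_minus_left; auto.
Qed.

(** A cone of angle pi / 3 reaches every height; as cos (pi / 3) = 1 / 2, membership becomes a
    linear inequality. *)
Lemma nbhd_row (H : C -> Prop) (y : R) : neighborhood_minus_infty H -> exists x, H (x, y).
Proof.
intros [hH _]. assert (hpi := PI_RGT_0).
destruct (hH (PI / 3)) as [w0 [_ hc]]; [lra|].
set (d := Im w0 - y).
exists (Re w0 - (Rabs d + 1)). apply hc. apply cone_minus_iff; [lra|].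
replace (w0 - ((Re w0 - (Rabs d + 1))%R, y))%C with ((Rabs d + 1, d) : C)
  by (destruct w0; apply C_eq_parts; unfold d; simpl; ring).
rewrite cos_PI3. assert (h := Cmod_le_abs (Rabs d + 1) d). simpl.
assert (h0 := Rabs_pos d). rewrite (Rabs_pos_eq (Rabs d + 1)) in h by lra. lra.
Qed.

Lemma border_iff (H : C -> Prop) (x y : R) : neighborhood_minus_infty H ->
  (forall s, s < x -> H (s, y)) -> ~ H (x, y) -> border H (x, y).
Proof.
intros hn hl hx. split; intros eps he.
- exists (x - eps / 2, y). split; [apply hl; lra|].
  replace (((x - eps / 2)%R, y) - (x, y))%C with (RtoC (- (eps / 2))) by (apply C_eq_parts; simpl; ring).
  rewrite Cmod_R, Rabs_left; lra.
- exists (x, y). split; auto. rewrite Cmod_diag; lra.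
Qed.

(** Each row of H is a nonempty open left half-line. If it ended before rho, or were the whole row,
    its end would be a border point with the wrong abscissa in the first case, and the border point
    at rho would lie in the open set H in the second. *)
Lemma nbhd_profile (H : C -> Prop) (rho : R -> R) : neighborhood_minus_infty H ->
  (forall w, border H w <-> Re w = rho (Rabs (Im w))) ->
  (forall w, H w <-> Re w < rho (Rabs (Im w))) /\ (forall w, closure H w <-> Re w <= rho (Rabs (Im w))).
Proof.
intros hn hb.
assert (hleft : forall x y x', H (x, y) -> x' <= x -> H (x', y)).
{ intros x y x' h hx. replace ((x', y) : C) with ((x, y) - RtoC (x - x'))%C.
  - apply nbhd_left; auto. lra.
  - apply C_eq_parts; simpl; ring. }
assert (h1 : forall w, H w <-> Re w < rho (Rabs (Im w))).
{ intros [x y]; simpl. split.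
  - intros h. apply Rnot_le_lt. intros hle.
    assert (hH : H (rho (Rabs y), y)) by (apply hleft with x; auto).
    assert (hbd : border H (rho (Rabs y), y)) by (apply hb; reflexivity).
    destruct (nbhd_open H hn _ hH) as [r [hr hball]].
    destruct hbd as [_ hcl]. destruct (hcl r hr) as [w' [hw' hd]]. apply hw', hball, hd.
  - intros hlt. apply NNPP. intros hno.
    destruct (nbhd_row H y hn) as [x0 hx0].
    destruct (completeness (fun s => H (s, y))) as [l [hl1 hl2]].
    + exists x. intros s hs. apply Rnot_lt_le. intros hsx. apply hno. apply hleft with s; auto. lra.
    + exists x0; auto.
    + assert (hlx : l <= x).
      { apply hl2. intros s hs. apply Rnot_lt_le. intros hsx. apply hno. apply hleft with s; auto. lra. }
      assert (hbd : border H (l, y)).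
      { apply border_iff; auto.
        - intros s hs. apply NNPP. intros hns.
          apply (Rlt_not_le _ _ hs). apply hl2. intros t ht.
          apply Rnot_lt_le. intros hst. apply hns, hleft with t; auto. lra.
        - intros hl. destruct (nbhd_open H hn _ hl) as [r [hr hball]].
          assert (h : H (l + r / 2, y)).
          { apply hball. replace (((l + r / 2)%R, y) - (l, y))%C with (RtoC (r / 2)) by (apply C_eq_parts; simpl; ring).
            rewrite Cmod_R, Rabs_pos_eq; lra. }
          specialize (hl1 _ h). lra. }
      apply hb in hbd. simpl in hbd. lra. }
split; auto.
intros w. split.
- intros hcl. destruct (classic (H w)) as [hw|hw].
  + apply h1 in hw. lra.
  + right. apply hb. split; auto. intros eps he. exists w. split; auto.
    rewrite Cmod_diag; lra.
- intros [h|h].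
  + intros eps he. exists w. split; [apply h1; auto|].
    rewrite Cmod_diag; lra.
  + apply hb in h. apply h.
Qed.

(* [ld_log]: for every slope d, H contains a sector with apex of order k ln d. *)
Record log_domain (H : C -> Prop) (rho : R -> R) (X k : R) : Prop := {
  ld_open : open_set H;
  ld_in : forall w, H w <-> Re w < rho (Rabs (Im w));
  ld_cl : forall w, closure H w <-> Re w <= rho (Rabs (Im w));
  ld_decr : forall x y, 0 <= x <= y -> rho y <= rho x;
  ld_shift : forall y y0, 0 <= y -> 0 <= y0 -> rho y - rho 0 <= rho (y + y0) - rho y0;
  ld_k : 0 < k;
  ld_log : forall d y, 0 < d <= 1 -> 0 <= y -> X + k * ln d - d * y <= rho y }.

Lemma ln_le_minus_1 (x : R) : 0 < x -> ln x <= x - 1.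
Proof.
intros hx. assert (h := exp_ineq1_le (ln x)). rewrite exp_ln in h by auto. lra.
Qed.

(** A convex function that takes arbitrarily small values at large heights is decreasing. Convexity
    also makes increments over a fixed length grow, which is [ld_shift]; the logarithm enters
    [ld_log] through an explicit minimum. *)
Lemma log_half_plane_domain (H : C -> Prop) : log_half_plane H ->
  exists rho X k, log_domain H rho X k.
Proof.
intros [hn [rho [hconv [hb [c [k [Y0 [hk hY0]]]]]]]].
destruct (nbhd_profile H rho hn hb) as [h1 h2].
set (Y := Rmax Y0 1).
assert (hY1 : 1 <= Y) by apply Rmax_r.
assert (hY : forall y, Y <= y -> rho y = c - k * ln y).
{ intros y hy. apply hY0. assert (h := Rmax_l Y0 1). fold Y in h. lra. }
assert (hdec : forall x y, 0 <= x <= y -> rho y <= rho x).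
{ intros x y hxy.
  destruct (Req_dec x y) as [e|e]; [rewrite e; lra|].
  (* A height beyond y, in the logarithmic range, where rho z <= rho x: y is then a convex
     combination of x and z. *)
  set (z := Rmax (Rmax Y (y + 1)) (exp ((c - rho x) / k))).
  assert (hz1 : Y <= z) by (eapply Rle_trans; [|apply Rmax_l]; apply Rmax_l).
  assert (hz2 : y + 1 <= z) by (eapply Rle_trans; [|apply Rmax_l]; apply Rmax_r).
  assert (hz3 : exp ((c - rho x) / k) <= z) by apply Rmax_r.
  assert (hz : rho z <= rho x).
  { rewrite hY by auto.
    assert (h : (c - rho x) / k <= ln z).
    { rewrite <- (ln_exp ((c - rho x) / k)). apply ln_le; auto. apply exp_pos. }
    apply Rmult_le_compat_l with (r := k) in h; [|lra].
    replace (k * ((c - rho x) / k)) with (c - rho x) in h by (field; lra). lra. }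
  assert (h := hconv x z ((z - y) / (z - x))).
  assert (ht : 0 <= (z - y) / (z - x) <= 1).
  { split; [apply Rdiv_le_0_compat; lra|]. apply Rmult_le_reg_r with (z - x); [lra|].
    unfold Rdiv; rewrite Rmult_assoc, Rinv_l; lra. }
  replace ((z - y) / (z - x) * x + (1 - (z - y) / (z - x)) * z) with y in h by (field; lra).
  specialize (h ltac:(lra) ltac:(lra) ht). nra. }
(* The function c - k ln y + d y is minimal at y = k / d, with value c - k ln k + k + k ln d. The
   term [rho Y] serves the heights below Y. *)
set (X := Rmin (c - k * ln k + k) (rho Y)).
exists rho, X, k. constructor; auto.
- apply nbhd_open; auto.
- intros y y0 hy hy0.
  destruct (Req_dec (y + y0) 0) as [e|e].
  { replace y with 0 by lra. replace y0 with 0 by lra. rewrite Rplus_0_r. lra. }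
  set (z := y + y0).
  assert (ht : 0 <= y / z <= 1).
  { unfold z; split; [apply Rdiv_le_0_compat; lra|]. apply Rmult_le_reg_r with (y + y0); [lra|].
    unfold Rdiv; rewrite Rmult_assoc, Rinv_l; lra. }
  (* Both y and y0 lie between 0 and z = y + y0 with complementary weights; the two convexity
     inequalities are added. *)
  assert (a1 := hconv z 0 (y / z) ltac:(unfold z; lra) ltac:(lra) ht).
  assert (a2 := hconv 0 z (y / z) ltac:(lra) ltac:(unfold z; lra) ht).
  replace (y / z * z + (1 - y / z) * 0) with y in a1 by (unfold z; field; lra).
  replace (y / z * 0 + (1 - y / z) * z) with y0 in a2 by (unfold z; field; lra).
  lra.
- intros d y hd hy.
  assert (hld : ln d <= 0) by (rewrite <- ln_1; apply ln_le; lra).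
  assert (hx1 : X <= c - k * ln k + k) by apply Rmin_l.
  assert (hx2 : X <= rho Y) by apply Rmin_r.
  destruct (Rle_lt_dec Y y) as [h|h].
  + rewrite hY by auto.
    assert (hp : 0 < y * d / k).
    { apply Rdiv_lt_0_compat; auto. apply Rmult_lt_0_compat; lra. }
    assert (hl := ln_le_minus_1 _ hp).
    unfold Rdiv in hl. rewrite ln_mult, ln_mult, ln_Rinv in hl; try lra.
    2: apply Rmult_lt_0_compat; lra.
    2: apply Rinv_0_lt_compat; lra.
    apply Rmult_le_compat_l with (r := k) in hl; [|lra].
    replace (k * (y * d * / k - 1)) with (y * d - k) in hl by (field; lra). lra.
  + assert (hr : rho Y <= rho y) by (apply hdec; lra).
    assert (0 <= d * y) by (apply Rmult_le_pos; lra).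
    assert (k * ln d <= 0) by nra. lra.
Qed.

(** * Integrals along curves *)

(** The balls of the uniform structure of C are squares, hence the factor 2 in this direction. *)
Lemma ball_C_Cmod (x y : C) (e : R) : 0 < e -> @ball C_UniformSpace x (e / 2) y -> Cmod (y - x) < e.
Proof.
intros he [h1 h2]. destruct x as [x1 x2], y as [y1 y2].
change (Rabs (y1 - x1) < e / 2) in h1. change (Rabs (y2 - x2) < e / 2) in h2.
eapply Rle_lt_trans; [apply (Cmod_le_abs (y1 - x1) (y2 - x2))|lra].
Qed.

Lemma Cmod_ball_C (x y : C) (e : R) : Cmod (y - x) < e -> @ball C_UniformSpace x e y.
Proof.
intros h. split; (eapply Rle_lt_trans; [|exact h]).
- apply (re_le_Cmod (y - x)%C).
- apply (im_le_Cmod (y - x)%C).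
Qed.

Lemma continuous_on_rcont (D : R -> Prop) (f : R -> C) :
  @continuous_on R_UniformSpace C_UniformSpace D f <-> rcont D f.
Proof.
split.
- intros h t ht eps he.
  assert (he2 : 0 < eps / 2) by lra.
  assert (hl : locally (T := R_UniformSpace) t (fun y => D y -> @ball C_UniformSpace (f t) (eps / 2) (f y))).
  { apply (h t ht (@ball C_UniformSpace (f t) (eps / 2))). exists (mkposreal _ he2). auto. }
  destruct hl as [d hd]. exists d; split; [apply cond_pos|]. intros t' hD ht'.
  apply ball_C_Cmod; [exact he|]. apply hd; auto.
- intros h t ht P [eps hP].
  destruct (h t ht eps (cond_pos eps)) as [d [hd h1]].
  exists (mkposreal d hd). intros t' ht' hD. apply hP, Cmod_ball_C, h1; auto.
Qed.

Lemma continuous_on_ccont (D : C -> Prop) (f : C -> C) :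
  @continuous_on C_UniformSpace C_UniformSpace D f <-> ccont D f.
Proof.
split.
- intros h t ht eps he.
  assert (he2 : 0 < eps / 2) by lra.
  assert (hl : locally (T := C_UniformSpace) t (fun y => D y -> @ball C_UniformSpace (f t) (eps / 2) (f y))).
  { apply (h t ht (@ball C_UniformSpace (f t) (eps / 2))). exists (mkposreal _ he2). auto. }
  destruct hl as [d hd]. exists d; split; [apply cond_pos|]. intros t' hD ht'.
  apply ball_C_Cmod; [exact he|]. apply hd; auto. apply Cmod_ball_C; auto.
- intros h t ht P [eps hP].
  destruct (h t ht eps (cond_pos eps)) as [d [hd h1]].
  assert (hd2 : 0 < d / 2) by lra.
  exists (mkposreal _ hd2). intros t' ht' hD. apply hP, Cmod_ball_C, h1; auto.
  apply ball_C_Cmod; auto.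
Qed.

Lemma path_derive_eq (gam : R -> C) (t : R) (l : C) : rderiv gam t l -> path_derive gam t = l.
Proof.
intros h. apply rderiv_parts in h. destruct h as [h1 h2].
unfold path_derive. rewrite (is_derive_unique _ _ _ h1), (is_derive_unique _ _ _ h2).
destruct l; reflexivity.
Qed.

Lemma clamp_mono (a b s t : R) : s <= t -> clamp a b s <= clamp a b t.
Proof. intros h; unfold clamp. apply Rle_max_compat_l, Rle_min_compat_l; auto. Qed.

Lemma rcont_bounded (a b : R) (f : R -> C) : a <= b -> rcont (seg a b) f ->
  exists M, forall t, seg a b t -> Cmod (f t) <= M.
Proof.
intros hab hf.
destruct (continuity_ab_maj (fun t => Cmod (f (clamp a b t))) a b hab) as [m [hm _]].
- intros c _. apply continuity_pt_filterlim.
  intros P [eps hP].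
  assert (hs : forall s, seg a b (clamp a b s)) by (intros s; apply seg_le; auto; apply clamp_in; auto).
  destruct (hf (clamp a b c) (hs c) eps (cond_pos eps)) as [d [hd h1]].
  exists (mkposreal d hd). intros t ht. apply hP.
  change (Rabs (Cmod (f (clamp a b t)) - Cmod (f (clamp a b c))) < eps).
  apply Rle_lt_trans with (Cmod (f (clamp a b t) - f (clamp a b c))).
  + apply Rabs_le. assert (h2 := Cmod_rev_tri (f (clamp a b t)) (f (clamp a b c))).
    assert (h3 := Cmod_rev_tri (f (clamp a b c)) (f (clamp a b t))).
    rewrite Cmod_minus_sym in h3. lra.
  + apply h1; auto. eapply Rle_lt_trans; [apply clamp_lip|exact ht].
- eexists. intros t ht. rewrite seg_le in ht by auto.
  specialize (hm t ht). simpl in hm. rewrite clamp_id in hm by auto. exact hm.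
Qed.

(** Clamping the subdivision points to [a, b] restricts the pieces to that interval; pieces lying
    outside collapse to a point and contribute 0. *)
Lemma piecewise_FTC (gam F phi : R -> C) (a b : R) : piecewise_C1 gam -> 0 <= a <= b -> b <= 1 ->
  rcont (seg a b) phi -> rcont (seg a b) F ->
  (forall t l, a < t < b -> rderiv gam t l -> rderiv F t (phi t * l)%C) ->
  is_cint (fun t => phi t * path_derive gam t)%C a b (F b - F a)%C.
Proof.
intros [_ [n [s [d [hs0 [hsn hp]]]]]] hab hb1 hphi hF hder.
assert (key : forall i, (i <= n)%nat ->
  is_cint (fun t => phi t * path_derive gam t)%C a (clamp a b (s i)) (F (clamp a b (s i)) - F a)%C).
{ induction i as [|i IH]; intros hi.
  - rewrite hs0. replace (clamp a b 0) with a.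
    + replace (F a - F a)%C with (RtoC 0) by ring. apply is_cint_point.
    + unfold clamp. rewrite Rmin_right by lra. rewrite Rmax_left; lra.
  - destruct (hp i hi) as [hlt [hdc hd]].
    assert (huv := clamp_mono a b (s i) (s (S i)) (Rlt_le _ _ hlt)).
    assert (hu := clamp_in a b (s i) (proj2 hab)). assert (hv := clamp_in a b (s (S i)) (proj2 hab)).
    replace (F (clamp a b (s (S i))) - F a)%C with ((F (clamp a b (s i)) - F a) +
      (F (clamp a b (s (S i))) - F (clamp a b (s i))))%C by ring.
    apply is_cint_chasles with (clamp a b (s i)); [apply IH; lia|].
    destruct (Rle_lt_or_eq_dec _ _ huv) as [h|h].
    + assert (hsub : s i <= clamp a b (s i) /\ clamp a b (s (S i)) <= s (S i)).
      { revert h. unfold clamp, Rmax, Rmin. repeat destruct Rle_dec; lra. }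
      set (u := clamp a b (s i)) in *. set (v := clamp a b (s (S i))) in *.
      assert (hsg : forall t, seg u v t -> seg a b t /\ s i <= t <= s (S i)).
      { intros t ht. rewrite seg_le in * by lra. lra. }
      apply is_cint_ext with (f := fun t => (phi t * d i t)%C).
      * rewrite Rmin_left, Rmax_right by lra. intros t ht.
        rewrite (path_derive_eq gam t (d i t)); auto. apply hd; lra.
      * apply FTC_C; [lra| | |].
        -- apply rcont_sub with (2 := hF). apply hsg.
        -- apply rcont_mult.
           ++ apply rcont_sub with (2 := hphi). apply hsg.
           ++ apply continuous_on_rcont in hdc. apply rcont_sub with (2 := hdc). apply hsg.
        -- intros t ht. apply hder; [lra|]. apply hd; lra.
    + rewrite <- h. replace (F (clamp a b (s i)) - F (clamp a b (s i)))%C with (RtoC 0) by ring.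
      apply is_cint_point. }
specialize (key n (le_n _)). rewrite hsn in key.
replace (clamp a b 1) with b in key; auto.
unfold clamp. rewrite Rmin_left by lra. rewrite Rmax_right; lra.
Qed.

(** [B] majorizes the length of the curve: over each piece, the duration times a bound for the
    speed. It is independent of phi, so the integral depends continuously on phi for the uniform
    norm. *)
Lemma piecewise_weight (gam : R -> C) : piecewise_C1 gam -> exists B, 0 <= B /\
  forall phi eps, rcont (seg 0 1) phi -> (forall t, seg 0 1 t -> Cmod (phi t) <= eps) ->
  exists J, is_cint (fun t => phi t * path_derive gam t)%C 0 1 J /\ Cmod J <= B * eps.
Proof.
intros [_ [n [s [d [hs0 [hsn hp]]]]]].
assert (mono : forall j i, (i <= j)%nat -> (j <= n)%nat -> s i <= s j).
{ induction j as [|j IH]; intros i hij hj.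
  - replace i with 0%nat by lia. lra.
  - destruct (Nat.eq_dec i (S j)) as [e|e]; [rewrite e; lra|].
    assert (h := IH i ltac:(lia) ltac:(lia)). destruct (hp j hj) as [h1 _]. lra. }
assert (key : forall i, (i <= n)%nat -> exists B, 0 <= B /\
  forall phi eps, rcont (seg 0 1) phi -> (forall t, seg 0 1 t -> Cmod (phi t) <= eps) ->
  exists J, is_cint (fun t => phi t * path_derive gam t)%C 0 (s i) J /\ Cmod J <= B * eps).
{ induction i as [|i IH]; intros hi.
  - exists 0; split; [lra|]. intros phi eps _ _. exists 0. rewrite hs0, Cmod_0.
    split; [apply is_cint_point|lra].
  - destruct (IH ltac:(lia)) as [B [hB h]].
    destruct (hp i hi) as [hlt [hdc hd]].
    assert (hs1 := mono i 0%nat ltac:(lia) ltac:(lia)). assert (hs2 := mono n (S i) hi (le_n _)).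
    rewrite hs0 in hs1. rewrite hsn in hs2.
    assert (hdc' : rcont (seg (s i) (s (S i))) (d i)).
    { apply continuous_on_rcont in hdc. apply rcont_sub with (2 := hdc). intros t ht.
      rewrite seg_le in ht by lra. exact ht. }
    destruct (rcont_bounded (s i) (s (S i)) (d i) (Rlt_le _ _ hlt) hdc') as [M hM].
    assert (hM0 : 0 <= M) by (eapply Rle_trans; [apply Cmod_ge_0|apply (hM (s i)), seg_l]).
    exists (B + (s (S i) - s i) * M); split.
    { assert (0 <= (s (S i) - s i) * M) by (apply Rmult_le_pos; lra). lra. }
    intros phi eps hphi heps.
    destruct (h phi eps hphi heps) as [J [hJ1 hJ2]].
    assert (hsg : forall t, seg (s i) (s (S i)) t -> seg 0 1 t).
    { intros t ht. rewrite seg_le in * by lra. lra. }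
    assert (hI : is_cint (fun t => phi t * d i t)%C (s i) (s (S i)) (cint (fun t => phi t * d i t)%C (s i) (s (S i)))).
    { apply rcont_ex, rcont_mult; auto. apply rcont_sub with (2 := hphi); auto. }
    exists (J + cint (fun t => phi t * d i t)%C (s i) (s (S i)))%C. split.
    + apply is_cint_chasles with (s i); auto.
      apply is_cint_ext with (2 := hI). rewrite Rmin_left, Rmax_right by lra. intros t ht.
      rewrite (path_derive_eq gam t (d i t)); auto. apply hd; lra.
    + eapply Rle_trans; [apply Cmod_triangle|].
      apply is_cint_bound_const with (m := eps * M) in hI.
      * rewrite Rabs_pos_eq in hI by lra. lra.
      * intros t ht. rewrite Cmod_mult. apply Rmult_le_compat; auto using Cmod_ge_0. }
destruct (key n (le_n _)) as [B hB]. rewrite hsn in hB. exists B; auto.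
Qed.

Lemma path_int_primitive (gam : R -> C) (f G : C -> C) (a b : R) : piecewise_C1 gam -> 0 <= a <= b -> b <= 1 ->
  rcont (seg a b) (fun t => f (gam t)) -> (forall t, a <= t <= b -> cderiv G (gam t) (f (gam t))) ->
  is_cint (fun t => f (gam t) * path_derive gam t)%C a b (G (gam b) - G (gam a))%C.
Proof.
intros hg hab hb hf hG.
apply (piecewise_FTC gam (fun t => G (gam t)) (fun t => f (gam t))); auto.
- intros t ht eps he. rewrite seg_le in ht by lra.
  destruct (cderiv_cont G (gam t) _ (hG t ht) eps he) as [d [hd h1]].
  destruct hg as [hgc _]. apply continuous_on_rcont in hgc.
  destruct (hgc t ltac:(lra) d hd) as [d' [hd' h2]].
  exists d'; split; auto. intros t' ht'. rewrite seg_le in ht' by lra. intros hd''.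
  apply h1, h2; auto. lra.
- intros t l ht hl. apply rderiv_comp; auto. apply hG; lra.
Qed.

(** Uniform continuity of f along the curve for small shifts to the left: the radii given by
    continuity at each parameter have a common lower bound by compactness of [a, b]. *)
Lemma rcont_shift_uniform (D : C -> Prop) (f : C -> C) (gam : R -> C) (a b : R) : a <= b ->
  (forall w s, 0 <= s -> D w -> D (w - RtoC s)%C) -> ccont D f -> rcont (seg a b) gam ->
  (forall t, seg a b t -> D (gam t)) ->
  forall eps, 0 < eps -> exists s0, 0 < s0 /\ forall s t, 0 <= s < s0 -> seg a b t ->
  Cmod (f (gam t - RtoC s)%C - f (gam t)) <= eps.
Proof.
intros hab hD hf hg hin eps he.
assert (hloc : forall t, exists r : posreal, seg a b t -> forall t' s, seg a b t' -> Rabs (t' - t) < r -> 0 <= s < r ->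
  Cmod (f (gam t' - RtoC s)%C - f (gam t')) <= eps).
{ intros t. destruct (classic (seg a b t)) as [ht|ht].
  2: { exists (mkposreal 1 Rlt_0_1). tauto. }
  destruct (hf (gam t) (hin t ht) (eps / 2)) as [d [hd h1]]; [lra|].
  destruct (hg t ht (d / 2)) as [e [he' h2]]; [lra|].
  assert (hp : 0 < Rmin e (d / 2)) by (apply Rmin_pos; lra).
  exists (mkposreal _ hp). simpl. intros _ t' s ht' hr hs.
  specialize (h2 t' ht' (lt_Rmin_l hr)).
  assert (hs2 := lt_Rmin_r (proj2 hs)).
  assert (a1 := h1 (gam t') (hin t' ht') ltac:(lra)).
  assert (a2 : Cmod (f (gam t' - RtoC s)%C - f (gam t)) < eps / 2).
  { apply h1; [apply hD; auto; lra|].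
    replace (gam t' - RtoC s - gam t)%C with ((gam t' - gam t) - RtoC s)%C by ring.
    eapply Rle_lt_trans; [apply Cmod_minus_le|]. rewrite Cmod_R, Rabs_pos_eq by lra. lra. }
  eapply Rle_trans; [apply (Cmod_dist_tri _ (f (gam t)))|].
  rewrite (Cmod_minus_sym (f (gam t))). lra. }
apply choice in hloc. destruct hloc as [delta hdelta].
destruct (compactness_value_1d a b delta) as [d hd].
exists d; split; [apply cond_pos|]. intros s t hs ht.
apply NNPP. intros hno. rewrite seg_le in ht by auto.
apply (hd t ht). intros [u [hu [h1 h2]]]. apply hno.
apply (hdelta u); auto.
- apply seg_le; auto.
- apply seg_le; auto.
- lra.
Qed.

(* [inc H f w w' J]: J is the integral of [f] from w to w', where [f] is
   holomorphic on H and continuous on its closure. As [f] has no primitive on a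
   neighbourhood of the border, the integral is defined as a limit of those of
   the translates f (. - s), which are holomorphic on the closure of H. *)
Definition inc (H : C -> Prop) (f : C -> C) (w w' J : C) : Prop :=
  forall eps, 0 < eps -> exists s0, 0 < s0 /\ forall s G, 0 < s < s0 ->
  (forall z, closure H z -> cderiv G z (f (z - RtoC s)%C)) -> Cmod (G w' - G w - J) <= eps.

Lemma inc_trans (H : C -> Prop) (f : C -> C) (u v w J K : C) :
  inc H f u v J -> inc H f v w K -> inc H f u w (J + K).
Proof.
intros h1 h2 eps he.
destruct (h1 (eps / 2)) as [s1 [hs1 k1]]; [lra|].
destruct (h2 (eps / 2)) as [s2 [hs2 k2]]; [lra|].
exists (Rmin s1 s2); split; [apply Rmin_pos; lra|].
intros s G hs hG.
assert (a1 := lt_Rmin_l (proj2 hs)).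
assert (a2 := lt_Rmin_r (proj2 hs)).
specialize (k1 s G ltac:(lra) hG). specialize (k2 s G ltac:(lra) hG).
replace (G w - G u - (J + K))%C with ((G v - G u - J) + (G w - G v - K))%C by ring.
eapply Rle_trans; [apply Cmod_triangle|lra].
Qed.

Lemma closure_left (H : C -> Prop) (rho : R -> R) (X k : R) (w : C) (s : R) : log_domain H rho X k ->
  0 <= s -> closure H w -> closure H (w - RtoC s)%C.
Proof.
intros hH hs hw. apply (ld_cl _ _ _ _ hH). apply (ld_cl _ _ _ _ hH) in hw.
destruct w as [x y]. simpl in *. replace (y + - 0) with y by ring. lra.
Qed.

Lemma closure_shift_in (H : C -> Prop) (rho : R -> R) (X k : R) (w : C) (s : R) : log_domain H rho X k ->
  0 < s -> closure H w -> H (w - RtoC s)%C.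
Proof.
intros hH hs hw. apply (ld_in _ _ _ _ hH). apply (ld_cl _ _ _ _ hH) in hw.
destruct w as [x y]. simpl in *. replace (y + - 0) with y by ring. lra.
Qed.

(** H translated by s contains the closure of H, and is a comb with the real axis as spine: as rho
    decreases, a vertical segment going down to the axis stays inside, and the axis is met on a
    half-line containing rho 0. *)
Lemma shifted_comb (H : C -> Prop) (rho : R -> R) (X k s : R) : log_domain H rho X k -> 0 < s ->
  comb (rho 0) 0 (fun z => H (z - RtoC s)%C).
Proof.
intros hH hs. split.
- intros w hw. destruct (ld_open _ _ _ _ hH _ hw) as [r [hr h]]. exists r; split; auto.
  intros z hz. apply h. replace (z - RtoC s - (w - RtoC s))%C with (z - w)%C by ring. auto.
- intros x y h.
  assert (key : forall x' y', H ((x', y') - RtoC s)%C <-> x' - s < rho (Rabs y')).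
  { intros x' y'. rewrite (ld_in _ _ _ _ hH). simpl. replace (y' + - 0) with y' by ring. tauto. }
  apply key in h. split.
  + intros t ht. apply key. eapply Rlt_le_trans; [exact h|].
    apply (ld_decr _ _ _ _ hH). split; [apply Rabs_pos|].
    apply seg_dist in ht. rewrite !Rminus_0_r in ht. exact ht.
  + intros t ht. apply key. rewrite Rabs_R0.
    assert (hr : rho (Rabs y) <= rho 0).
    { apply (ld_decr _ _ _ _ hH). split; [lra|apply Rabs_pos]. }
    destruct ht as [_ ht]. eapply Rle_lt_trans; [apply Rplus_le_compat_r; exact ht|].
    unfold Rmax. destruct Rle_dec; lra.
Qed.

Lemma shifted_primitive (H : C -> Prop) (rho : R -> R) (X k s : R) (f : C -> C) :
  log_domain H rho X k -> 0 < s -> (forall z, H z -> differentiable f z) ->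
  exists G, forall z, closure H z -> cderiv G z (f (z - RtoC s)%C).
Proof.
intros hH hs hf.
destruct (comb_primitive (rho 0) 0 _ (fun z => f (z - RtoC s)%C) (shifted_comb H rho X k s hH hs)) as [G hG].
- intros z hz. destruct (hf _ hz) as [l hl]. exists (l * (1 - 0))%C.
  apply (cderiv_comp (fun z => z - RtoC s)%C f); auto.
  apply (cderiv_minus (fun z => z)); [apply cderiv_id|apply cderiv_const].
- exists G. intros z hz. apply hG. apply closure_shift_in with rho X k; auto.
Qed.

(** The condition in [inc] is not vacuous: a primitive G exists for every small s, and a single pair
    (s, G) compares both values. *)
Lemma inc_unique (H : C -> Prop) (rho : R -> R) (X k : R) (f : C -> C) (u v J K : C) :
  log_domain H rho X k -> (forall z, H z -> differentiable f z) ->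
  inc H f u v J -> inc H f u v K -> J = K.
Proof.
intros hH hf h1 h2. apply Cmod_le_eps_eq. intros eps he.
destruct (h1 (eps / 2)) as [s1 [hs1 k1]]; [lra|].
destruct (h2 (eps / 2)) as [s2 [hs2 k2]]; [lra|].
set (s := Rmin s1 s2 / 2).
assert (hs : 0 < s < Rmin s1 s2) by (assert (0 < Rmin s1 s2) by (apply Rmin_pos; lra); unfold s; lra).
assert (a1 := Rmin_l s1 s2). assert (a2 := Rmin_r s1 s2).
destruct (shifted_primitive H rho X k s f hH (proj1 hs) hf) as [G hG].
specialize (k1 s G ltac:(lra) hG). specialize (k2 s G ltac:(lra) hG).
replace (J - K)%C with ((G v - G u - K) - (G v - G u - J))%C by ring.
eapply Rle_trans; [apply Cmod_minus_le|lra].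
Qed.

(** Common to paths and segments: [om] stands for the derivative of the curve and [B] for its
    length. The integral of a translate of f is an increment of its primitive, and it tends to the
    integral of f by uniform continuity along the curve. *)
Lemma inc_curve (H : C -> Prop) (rho : R -> R) (X k : R) (f : C -> C) (gam om : R -> C) (a b B : R) (J : C) :
  log_domain H rho X k -> (forall z, H z -> differentiable f z) -> ccont (closure H) f -> a <= b -> 0 <= B ->
  rcont (seg a b) gam -> (forall t, seg a b t -> closure H (gam t)) ->
  (forall phi eps, rcont (seg a b) phi -> (forall t, seg a b t -> Cmod (phi t) <= eps) ->
    exists K, is_cint (fun t => phi t * om t)%C a b K /\ Cmod K <= B * eps) ->
  (forall h G, ccont (closure H) h -> (forall z, closure H z -> cderiv G z (h z)) ->
    is_cint (fun t => h (gam t) * om t)%C a b (G (gam b) - G (gam a))%C) ->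
  is_cint (fun t => f (gam t) * om t)%C a b J -> inc H f (gam a) (gam b) J.
Proof.
intros hH hf hfc hab hB hg hin hw hp hJ eps he.
destruct (rcont_shift_uniform (closure H) f gam a b hab) with (eps := eps / (B + 1)) as [s0 [hs0 h]]; auto.
{ intros w s hs hwcl. apply closure_left with rho X k; auto. }
{ apply Rdiv_lt_0_compat; lra. }
exists s0; split; auto. intros s G hs hG.
assert (hfs : ccont (closure H) (fun z => f (z - RtoC s)%C)).
{ apply differentiable_ccont. intros z hz.
  destruct (hf (z - RtoC s)%C) as [l hl].
  - apply closure_shift_in with rho X k; auto. lra.
  - exists (l * (1 - 0))%C. apply (cderiv_comp (fun z => z - RtoC s)%C f); auto.
    apply (cderiv_minus (fun z => z)); [apply cderiv_id|apply cderiv_const]. }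
assert (hI := hp (fun z => f (z - RtoC s)%C) G hfs hG).
destruct (hw (fun t => f (gam t - RtoC s) - f (gam t))%C (eps / (B + 1))) as [K [hK1 hK2]].
- apply rcont_minus; [apply (rcont_comp _ (closure H) gam (fun z => f (z - RtoC s)%C))
    | apply (rcont_comp _ (closure H) gam f)]; auto.
- intros t ht. exact (h s t ltac:(lra) ht).
- assert (e : (G (gam b) - G (gam a) - J)%C = K).
  { apply is_cint_unique with (2 := hK1).
    apply is_cint_ext with (2 := is_cint_minus _ _ _ _ _ _ hI hJ). intros t _. ring. }
  rewrite e. eapply Rle_trans; [exact hK2|].
  apply Rle_trans with ((B + 1) * (eps / (B + 1))); [|right; field; lra].
  apply Rmult_le_compat_r; [|lra]. left; apply Rdiv_lt_0_compat; lra.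
Qed.

Lemma inc_path (H : C -> Prop) (rho : R -> R) (X k : R) (f : C -> C) (gam : R -> C) :
  log_domain H rho X k -> (forall z, H z -> differentiable f z) -> ccont (closure H) f -> piecewise_C1 gam ->
  (forall t, 0 <= t <= 1 -> closure H (gam t)) -> inc H f (gam 0) (gam 1) (path_int f gam).
Proof.
intros hH hf hfc hg hin.
assert (hgc : rcont (seg 0 1) gam).
{ destruct hg as [hgc _]. apply continuous_on_rcont in hgc. apply rcont_sub with (2 := hgc).
  intros t ht. rewrite seg_le in ht by lra. auto. }
assert (hin' : forall t, seg 0 1 t -> closure H (gam t)).
{ intros t ht. rewrite seg_le in ht by lra. auto. }
assert (hfg : rcont (seg 0 1) (fun t => f (gam t))) by (apply rcont_comp with (E := closure H); auto).
destruct (piecewise_weight gam hg) as [B [hB hw]].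
apply inc_curve with rho X k (path_derive gam) B; auto; try lra.
- intros h G hh hG. apply path_int_primitive; auto; try lra.
  apply rcont_comp with (E := closure H); auto.
- destruct (rcont_bounded 0 1 _ ltac:(lra) hfg) as [M hM].
  destruct (hw _ M hfg hM) as [K [hK _]].
  replace (path_int f gam) with K; auto. symmetry. exact (is_cint_cint _ _ _ _ hK).
Qed.

Lemma inc_line (H : C -> Prop) (rho : R -> R) (X k : R) (f : C -> C) (w v J : C) (T : R) :
  log_domain H rho X k -> (forall z, H z -> differentiable f z) -> ccont (closure H) f -> 0 <= T ->
  (forall t, 0 <= t <= T -> closure H (w + RtoC t * v)%C) ->
  is_cint (fun t => f (w + RtoC t * v) * v)%C 0 T J -> inc H f w (w + RtoC T * v)%C J.
Proof.
intros hH hf hfc hT hin hJ.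
assert (hin' : forall t, seg 0 T t -> closure H (w + RtoC t * v)%C).
{ intros t ht. rewrite seg_le in ht by lra. auto. }
replace w with (w + RtoC 0 * v)%C at 1 by ring.
apply (inc_curve H rho X k f (fun t => w + RtoC t * v)%C (fun _ => v) 0 T (T * Cmod v)); auto.
- apply Rmult_le_pos; auto using Cmod_ge_0.
- apply rcont_line.
- intros phi eps hphi heps.
  assert (hI : is_cint (fun t => phi t * v)%C 0 T (cint (fun t => phi t * v)%C 0 T)).
  { apply rcont_ex, rcont_mult; auto using rcont_const. }
  eexists; split; [exact hI|].
  apply is_cint_bound_const with (m := eps * Cmod v) in hI.
  + rewrite Rminus_0_r, Rabs_pos_eq in hI by lra. lra.
  + intros t ht. rewrite Cmod_mult. apply Rmult_le_compat_r; auto using Cmod_ge_0.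
- intros h G hh hG.
  assert (hd : forall t, seg 0 T t -> rderiv (fun t => G (w + RtoC t * v)%C) t (h (w + RtoC t * v) * v)%C).
  { intros t ht. apply (rderiv_comp G (fun t => w + RtoC t * v)%C); auto. apply rderiv_line. }
  apply (FTC_C (fun t => G (w + RtoC t * v)%C)); auto.
  + apply rderiv_rcont. intros t ht. eexists; apply hd; auto.
  + apply rcont_mult; [|apply rcont_const]. apply rcont_comp with (E := closure H); auto. apply rcont_line.
  + intros t ht. apply hd, seg_le; lra.
Qed.

(** * The Laplace transform *)

(** E_0(H) with an explicit bound on the whole closure: the estimates for transforms and partial
    sums are linear in M, so that they can be applied to small differences. *)
Definition E0_bound (H : C -> Prop) (g : C -> C) (M : R) : Prop :=
  (forall z, H z -> differentiable g z) /\ ccont (closure H) g /\ forall w, closure H w -> Cmod (g w) <= M.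

Lemma log_domain_left (H : C -> Prop) (rho : R -> R) (X k : R) (w : C) : log_domain H rho X k ->
  H w -> closure H w.
Proof.
intros hH hw. apply (ld_cl _ _ _ _ hH). apply (ld_in _ _ _ _ hH) in hw. lra.
Qed.

Lemma closure_bound (H : C -> Prop) (rho : R -> R) (X k : R) (g : C -> C) (M : R) : log_domain H rho X k ->
  ccont (closure H) g -> (forall w, H w -> Cmod (g w) <= M) -> forall w, closure H w -> Cmod (g w) <= M.
Proof.
intros hH hg hM w hw. apply Rnot_lt_le. intros hlt.
destruct (hg w hw (Cmod (g w) - M)) as [d [hd h]]; [lra|].
assert (hin : H (w - RtoC (d / 2))%C) by (apply closure_shift_in with rho X k; auto; lra).
specialize (h (w - RtoC (d / 2))%C (log_domain_left _ _ _ _ _ hH hin)).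
replace (w - RtoC (d / 2) - w)%C with (- RtoC (d / 2))%C in h by ring.
rewrite Cmod_opp, Cmod_R, Rabs_pos_eq in h by lra. specialize (h ltac:(lra)).
specialize (hM _ hin).
assert (h4 := Cmod_rev_tri (g w) (g (w - RtoC (d / 2))%C)).
rewrite Cmod_minus_sym in h4. lra.
Qed.

Lemma E0_bound_ex (H : C -> Prop) (rho : R -> R) (X k : R) (g : C -> C) : log_domain H rho X k ->
  E0 H g -> exists M, E0_bound H g M.
Proof.
intros hH [h1 [[M hM] h3]]. apply continuous_on_ccont in h3. exists M.
split; [|split]; auto.
- intros z hz. apply holomorphic_at_iff; auto.
- apply closure_bound with rho X k; auto.
Qed.

Lemma E0_bound_pos (H : C -> Prop) (g : C -> C) (M : R) (w : C) : E0_bound H g M -> closure H w -> 0 <= M.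
Proof. intros [_ [_ h]] hw. eapply Rle_trans; [apply Cmod_ge_0|apply (h w hw)]. Qed.

Definition lap_fun (g : C -> C) (p w : C) : C := (g w * Cexp (- (p * w)))%C.

Lemma Cexp_lin_differentiable (p w : C) : differentiable (fun w => Cexp (- (p * w)))%C w.
Proof.
exists (Cexp (- (p * w)) * (- p * 1))%C.
apply (cderiv_ext_loc (fun w => Cexp (- p * w)%C) _ _ _ 1 Rlt_0_1).
- intros q _. f_equal; ring.
- apply cderiv_eq with (Cexp (- p * w) * (- p * 1))%C.
  + apply (cderiv_comp (fun w => - p * w)%C Cexp).
    * apply cderiv_scal, cderiv_id.
    * apply cderiv_Cexp.
  + replace (- (p * w))%C with (- p * w)%C by ring. reflexivity.
Qed.

Lemma differentiable_mult (f g : C -> C) (p : C) : differentiable f p -> differentiable g p ->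
  differentiable (fun z => f z * g z)%C p.
Proof. intros [l hl] [m hm]. eexists; apply cderiv_mult; eassumption. Qed.

Lemma differentiable_plus (f g : C -> C) (p : C) : differentiable f p -> differentiable g p ->
  differentiable (fun z => f z + g z)%C p.
Proof. intros [l hl] [m hm]. eexists; apply cderiv_plus; eassumption. Qed.

Lemma differentiable_minus (f g : C -> C) (p : C) : differentiable f p -> differentiable g p ->
  differentiable (fun z => f z - g z)%C p.
Proof. intros [l hl] [m hm]. eexists; apply cderiv_minus; eassumption. Qed.

Lemma lap_fun_differentiable (H : C -> Prop) (g : C -> C) (M : R) (p z : C) : E0_bound H g M -> H z ->
  differentiable (lap_fun g p) z.
Proof.
intros [h _] hz. apply (differentiable_mult g); [auto|apply Cexp_lin_differentiable].
Qed.

Lemma lap_fun_ccont (H : C -> Prop) (g : C -> C) (M : R) (p : C) : E0_bound H g M ->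
  ccont (closure H) (lap_fun g p).
Proof.
intros [_ [h _]]. apply ccont_mult; auto. apply differentiable_ccont.
intros; apply Cexp_lin_differentiable.
Qed.

Lemma lap_fun_bound (H : C -> Prop) (g : C -> C) (M : R) (p w : C) : E0_bound H g M -> closure H w ->
  Cmod (lap_fun g p w) <= M * exp (- Re (p * w)).
Proof.
intros [_ [_ h]] hw. unfold lap_fun. rewrite Cmod_mult, Cmod_Cexp.
replace (Re (- (p * w))%C) with (- Re (p * w)%C) by (destruct (p * w)%C; reflexivity).
apply Rmult_le_compat_r; auto. left; apply exp_pos.
Qed.

(** * Sectors contained in H, and exponential decay *)

Lemma sector (H : C -> Prop) (rho : R -> R) (X k d : R) (z : C) : log_domain H rho X k -> 0 < d <= 1 ->
  Re z <= X + k * ln d - d * Rabs (Im z) -> closure H z.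
Proof.
intros hH hd hz. apply (ld_cl _ _ _ _ hH). eapply Rle_trans; [exact hz|].
apply (ld_log _ _ _ _ hH); auto. apply Rabs_pos.
Qed.

(** Points moving left at speed [del] while their height grows at speed at most V end up in a sector
    of small enough slope, uniformly. *)
Lemma deep_sector (H : C -> Prop) (rho : R -> R) (X k W V del : R) : log_domain H rho X k -> 0 < del -> 0 <= V ->
  exists T0, forall T z, T0 <= T -> 0 <= T -> Re z <= W - T * del -> Rabs (Im z) <= W + T * V -> closure H z.
Proof.
intros hH hdel hV.
(* With d V <= del / 2, half of the leftward motion remains to absorb the constants. *)
set (d := Rmin 1 (del / (2 * (V + 1)))).
assert (hd : 0 < d <= 1).
{ split; [apply Rmin_pos; [lra|apply Rdiv_lt_0_compat; lra]|apply Rmin_l]. }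
assert (hdV : d * (V + 1) <= del / 2).
{ apply Rle_trans with (del / (2 * (V + 1)) * (V + 1)); [|right; field; lra].
  apply Rmult_le_compat_r; [lra|apply Rmin_r]. }
exists ((W + d * W - X - k * ln d) / (del / 2)). intros T z hT hT0 hz1 hz2.
apply sector with rho X k d; auto.
apply Rmult_le_compat_r with (r := del / 2) in hT; [|lra].
unfold Rdiv at 1 in hT. rewrite Rmult_assoc, Rinv_l, Rmult_1_r in hT by lra.
assert (h1 : d * Rabs (Im z) <= d * (W + T * V)) by (apply Rmult_le_compat_l; lra).
assert (h2 : T * (d * (V + 1)) <= T * (del / 2)) by (apply Rmult_le_compat_l; lra).
assert (0 <= T * d) by (apply Rmult_le_pos; lra).
nra.
Qed.

Lemma exp_opp_le_inv (x : R) : 0 < x -> exp (- x) <= / x.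
Proof.
intros hx. rewrite exp_Ropp. apply Rinv_le_contravar; auto.
assert (h := exp_ineq1_le x). lra.
Qed.

Lemma exp_decay (K s eps : R) : 0 < s -> 0 < eps -> exists T0, 0 < T0 /\ forall T, T0 <= T -> K * exp (- s * T) <= eps.
Proof.
intros hs he.
assert (hK := Rabs_pos K).
exists ((Rabs K + 1) / (s * eps)). split.
{ apply Rdiv_lt_0_compat; [lra|apply Rmult_lt_0_compat; lra]. }
intros T hT.
assert (hp : 0 < s * eps) by (apply Rmult_lt_0_compat; lra).
assert (hT1 : Rabs K + 1 <= T * (s * eps)).
{ apply Rmult_le_compat_r with (r := s * eps) in hT; [|lra].
  unfold Rdiv in hT. rewrite Rmult_assoc, Rinv_l in hT by lra. lra. }
assert (hTp : 0 < T).
{ apply Rmult_lt_reg_r with (s * eps); lra. }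
assert (hsT : 0 < s * T) by (apply Rmult_lt_0_compat; lra).
assert (h := exp_opp_le_inv (s * T) hsT). replace (- (s * T)) with (- s * T) in h by ring.
apply Rle_trans with (Rabs K * exp (- s * T)).
- apply Rmult_le_compat_r; [left; apply exp_pos|apply Rle_abs].
- apply Rle_trans with (Rabs K * / (s * T)); [apply Rmult_le_compat_l; auto|].
  apply Rmult_le_reg_r with (s * T); auto. rewrite Rmult_assoc, Rinv_l by lra. nra.
Qed.

Lemma exp_decay_lin (A B s eps : R) : 0 < s -> 0 < eps -> 0 <= A -> 0 <= B ->
  exists T0, 0 < T0 /\ forall T, T0 <= T -> (A + B * T) * exp (- s * T) <= eps.
Proof.
intros hs he hA hB.
destruct (exp_decay (A + B * (2 / s)) (s / 2) eps ltac:(lra) he) as [T0 [hT0 h]].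
exists T0; split; auto. intros T hT.
eapply Rle_trans; [|apply (h T hT)].
replace (- s * T) with (- (s / 2) * T + - (s / 2) * T) by field. rewrite exp_plus, <- Rmult_assoc.
apply Rmult_le_compat_r; [left; apply exp_pos|].
assert (h1 := exp_opp_le_inv (s / 2 * T) ltac:(apply Rmult_lt_0_compat; lra)).
assert (h2 : exp (- (s / 2) * T) <= 1) by (rewrite <- exp_0; apply exp_le; nra).
replace (- (s / 2 * T)) with (- (s / 2) * T) in h1 by ring.
assert (h3 : T * exp (- (s / 2) * T) <= 2 / s).
{ apply Rle_trans with (T * / (s / 2 * T)); [apply Rmult_le_compat_l; lra|right; field; lra]. }
nra.
Qed.

(** * Convergence of integrals along rays *)

Lemma exp_cint_bound (f : R -> C) (K s S T : R) : 0 < s -> 0 <= K -> 0 <= S <= T -> rcont (seg S T) f ->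
  (forall t, 0 <= t -> Cmod (f t) <= K * exp (- s * t)) -> Cmod (cint f S T) <= K / s * exp (- s * S).
Proof.
intros hs hK hST hf hb.
assert (hI : is_RInt (fun t => K * exp (- s * t)) S T (- (K / s * exp (- s * T)) - - (K / s * exp (- s * S)))).
{ apply (FTC_open (fun t => - (K / s * exp (- s * t)))); [lra| | |].
  - intros t. apply (ex_derive_continuous (V := R_NormedModule)). auto_derive. auto.
  - intros t. apply (ex_derive_continuous (V := R_NormedModule)). auto_derive. auto.
  - intros t _. auto_derive; [auto|]. field. lra. }
assert (h := is_cint_bound f _ S T _ _ (proj2 hST) (fun t ht => hb t ltac:(lra)) (rcont_ex _ _ _ hf) hI).
assert (0 <= K / s * exp (- s * T)).
{ apply Rmult_le_pos; [apply Rdiv_le_0_compat; auto|left; apply exp_pos]. }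
lra.
Qed.

Definition ray_limit (f : R -> C) (J : C) : Prop :=
  forall eps, 0 < eps -> exists T0, forall T, T0 <= T -> exists K, is_cint f 0 T K /\ Cmod (K - J) <= eps.

Lemma is_RInt_gen_ray_limit (f : R -> C) (J : C) :
  @is_RInt_gen C_R_NormedModule f (at_point 0) (Rbar_locally p_infty) J <-> ray_limit f J.
Proof.
split.
- intros h eps he.
  assert (he2 : 0 < eps / 2) by lra.
  assert (hb : locally (T := C_UniformSpace) J (fun y => Cmod (y - J) <= eps)).
  { exists (mkposreal _ he2). intros y hy. left. apply ball_C_Cmod; auto. }
  destruct (h _ hb) as [Q P hQ [T0 hP] hQP].
  exists (T0 + 1). intros T hT. apply (hQP 0 T); [apply hQ|apply hP; lra].
- intros h P [eps hP].
  destruct (h (eps / 2)) as [T0 hT0].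
  { assert (h1 := cond_pos eps). lra. }
  apply (Filter_prod _ _ _ (fun x => x = 0) (fun T => T0 < T)).
  + reflexivity.
  + exists T0. auto.
  + intros x T -> hT. destruct (hT0 T (Rlt_le _ _ hT)) as [K [hK1 hK2]].
    exists K. split; [exact hK1|]. apply hP, Cmod_ball_C.
    assert (h1 := cond_pos eps). eapply Rle_lt_trans; [exact hK2|]. lra.
Qed.

(** Integrals up to integers form a Cauchy sequence by exponential domination. The explicit tail
    bound is kept because truncations are compared quantitatively. *)
Lemma exp_ray_limit (f : R -> C) (K s : R) : 0 < s -> 0 <= K -> (forall T, 0 <= T -> rcont (seg 0 T) f) ->
  (forall t, 0 <= t -> Cmod (f t) <= K * exp (- s * t)) ->
  exists J, ray_limit f J /\ forall T, 0 <= T -> Cmod (J - cint f 0 T) <= K / s * exp (- s * T).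
Proof.
intros hs hK hf hb.
assert (hseg : forall S T, 0 <= S <= T -> rcont (seg S T) f).
{ intros S T h. apply rcont_sub with (2 := hf T ltac:(lra)). intros t ht.
  rewrite seg_le in ht |- * by lra. lra. }
assert (hdiff : forall S T, 0 <= S <= T -> Cmod (cint f 0 T - cint f 0 S) <= K / s * exp (- s * S)).
{ intros S T h. rewrite <- (cint_chasles f 0 S T) by (apply hseg; lra).
  replace (cint f 0 S + cint f S T - cint f 0 S)%C with (cint f S T) by ring.
  apply exp_cint_bound; auto. }
destruct (C_complete (fun n => cint f 0 (INR n))) as [J hJ].
{ intros eps he. destruct (exp_decay (K / s) s eps hs he) as [T0 [hT0 h]].
  destruct (INR_unbounded T0) as [N hN]. exists N.
  assert (key : forall n m, (N <= n <= m)%nat -> Cmod (cint f 0 (INR m) - cint f 0 (INR n)) <= eps).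
  { intros n m hnm. assert (h1 := le_INR N n ltac:(lia)). assert (h2 := le_INR n m ltac:(lia)).
    eapply Rle_trans; [apply hdiff; lra|]. apply h; lra. }
  intros n m hn hm. destruct (Nat.le_ge_cases n m) as [h1|h1].
  - rewrite Cmod_minus_sym. apply key; lia.
  - apply key; lia. }
assert (hfin : forall T, 0 <= T -> Cmod (J - cint f 0 T) <= K / s * exp (- s * T)).
{ intros T hT. apply Rnot_lt_le. intros hlt.
  destruct (hJ ((Cmod (J - cint f 0 T) - K / s * exp (- s * T)) / 2)) as [N hN]; [lra|].
  destruct (INR_unbounded T) as [N' hN'].
  specialize (hN (max N N') ltac:(lia)).
  assert (h1 := le_INR N' (max N N') ltac:(lia)).
  assert (h2 := hdiff T (INR (max N N')) ltac:(lra)).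
  assert (h3 := Cmod_dist_tri J (cint f 0 (INR (max N N'))) (cint f 0 T)).
  rewrite (Cmod_minus_sym J (cint f 0 (INR (max N N')))) in h3. lra. }
exists J; split; auto.
intros eps he. destruct (exp_decay (K / s) s eps hs he) as [T0 [hT0 h]].
exists T0. intros T hT. exists (cint f 0 T). split; [apply rcont_ex, hf; lra|].
rewrite Cmod_minus_sym. eapply Rle_trans; [apply hfin; lra|auto].
Qed.

(* [is_laplace] with the path from w0 to w1 replaced by the path-independent [inc]. *)
Definition lap_value (H : C -> Prop) (g : C -> C) (w0 p z : C) : Prop :=
  exists w1 v A J, inc H (lap_fun g p) w0 w1 A /\ (forall t, 0 <= t -> closure H (w1 + RtoC t * v)%C) /\
  Re v < 0 /\ 0 < Re (p * v)%C /\ ray_limit (fun t => lap_fun g p (w1 + RtoC t * v) * v)%C J /\ z = (A + J)%C.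

Lemma abs_Re_mult_le (p w : C) : Rabs (Re (p * w)%C) <= Cmod p * Cmod w.
Proof. rewrite <- Cmod_mult. apply re_le_Cmod. Qed.

(* The ends of the two truncated rays are joined by a segment, which lies in H
   and contributes a vanishing integral when the truncation tends to infinity. *)
Lemma lap_value_unique (H : C -> Prop) (rho : R -> R) (X k : R) (g : C -> C) (M : R) (w0 p z z' : C) :
  log_domain H rho X k -> E0_bound H g M -> lap_value H g w0 p z -> lap_value H g w0 p z' -> z = z'.
Proof.
intros hH hg [w1 [v [A [J [hA [hcl [hv [hpv [hJ ->]]]]]]]]].
intros [w1' [v' [A' [J' [hA' [hcl' [hv' [hpv' [hJ' ->]]]]]]]]].
set (f := lap_fun g p) in *.
assert (hf : forall z, H z -> differentiable f z) by (intros; eapply lap_fun_differentiable; eauto).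
assert (hfc : ccont (closure H) f) by (eapply lap_fun_ccont; eauto).
set (W := Cmod w1 + Cmod w1').
set (V := Cmod v + Cmod v').
set (del := Rmin (- Re v) (- Re v')).
assert (hdel : 0 < del) by (apply Rmin_pos; lra).
set (s := Rmin (Re (p * v)%C) (Re (p * v')%C)).
assert (hs : 0 < s) by (apply Rmin_pos; lra).
assert (hw1 := Cmod_ge_0 w1). assert (hw1' := Cmod_ge_0 w1').
assert (hv0 := Cmod_ge_0 v). assert (hv0' := Cmod_ge_0 v').
assert (hp0 := Cmod_ge_0 p).
destruct (deep_sector H rho X k W V del hH hdel ltac:(unfold V; lra)) as [T1 hT1].
apply Cmod_le_eps_eq. intros eps he.
destruct (hJ (eps / 3)) as [T2 hT2]; [lra|].
destruct (hJ' (eps / 3)) as [T3 hT3]; [lra|].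
assert (hM0 : 0 <= M).
{ exact (E0_bound_pos _ _ _ _ hg (hcl 0 ltac:(lra))). }
set (K := M * exp (Cmod p * W)).
assert (hK : 0 <= K) by (apply Rmult_le_pos; [auto|left; apply exp_pos]).
(* The closing segment has length at most W + T V, while the integrand on it is at most K e^(-s
   T). *)
destruct (exp_decay_lin (K * W) (K * V) s (eps / 3) hs ltac:(lra)) as [T4 [hT4 hT4']].
{ apply Rmult_le_pos; unfold W; lra. }
{ apply Rmult_le_pos; unfold V; lra. }
set (T := Rmax (Rmax T1 T2) (Rmax T3 T4)).
assert (a1 : T1 <= T) by (eapply Rle_trans; [|apply Rmax_l]; apply Rmax_l).
assert (a2 : T2 <= T) by (eapply Rle_trans; [|apply Rmax_l]; apply Rmax_r).
assert (a3 : T3 <= T) by (eapply Rle_trans; [|apply Rmax_r]; apply Rmax_l).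
assert (a4 : T4 <= T) by (eapply Rle_trans; [|apply Rmax_r]; apply Rmax_r).
assert (hT : 0 <= T) by lra.
destruct (hT2 T a2) as [I [hI1 hI2]]. destruct (hT3 T a3) as [I' [hI1' hI2']].
set (a := (w1 + RtoC T * v)%C). set (b := (w1' + RtoC T * v')%C).
(* Both rays are cut at the same T, so a point of the segment is c + T u with c and u convex
   combinations of the starts and of the directions: u still satisfies the bounds [del] and [s]. *)
assert (hseg : forall t, 0 <= t <= 1 -> closure H (a + RtoC t * (b - a))%C /\
  s * T - Cmod p * W <= Re (p * (a + RtoC t * (b - a)))%C).
{ intros t ht.
  assert (e : (a + RtoC t * (b - a))%C =
    (RtoC (1 - t) * w1 + RtoC t * w1' + RtoC T * (RtoC (1 - t) * v + RtoC t * v'))%C).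
  { unfold a, b. rewrite RtoC_minus. ring. }
  rewrite e.
  assert (hW : Cmod (RtoC (1 - t) * w1 + RtoC t * w1')%C <= W).
  { eapply Rle_trans; [apply Cmod_triangle|]. rewrite !Cmod_mult, !Cmod_R, !Rabs_pos_eq by lra.
    unfold W. nra. }
  assert (hV : Cmod (RtoC (1 - t) * v + RtoC t * v')%C <= V).
  { eapply Rle_trans; [apply Cmod_triangle|]. rewrite !Cmod_mult, !Cmod_R, !Rabs_pos_eq by lra.
    unfold V. nra. }
  assert (hRe : Re (RtoC (1 - t) * v + RtoC t * v')%C <= - del).
  { assert (r1 := Rmin_l (- Re v) (- Re v')). assert (r2 := Rmin_r (- Re v) (- Re v')). fold del in r1, r2.
    replace (Re (RtoC (1 - t) * v + RtoC t * v')%C) with ((1 - t) * Re v + t * Re v')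
      by (destruct v, v'; simpl; ring). nra. }
  assert (hRp : s <= Re (p * (RtoC (1 - t) * v + RtoC t * v'))%C).
  { assert (r1 := Rmin_l (Re (p * v)%C) (Re (p * v')%C)). assert (r2 := Rmin_r (Re (p * v)%C) (Re (p * v')%C)).
    fold s in r1, r2.
    replace (Re (p * (RtoC (1 - t) * v + RtoC t * v'))%C) with ((1 - t) * Re (p * v)%C + t * Re (p * v')%C)
      by (destruct v, v', p; simpl; ring). nra. }
  set (c := (RtoC (1 - t) * w1 + RtoC t * w1')%C) in *.
  set (u := (RtoC (1 - t) * v + RtoC t * v')%C) in *.
  split.
  - apply (hT1 T); auto.
    + replace (Re (c + RtoC T * u)%C) with (Re c + T * Re u) by (destruct c, u; simpl; ring).
      assert (h1 := Cmod_ge_re c). nra.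
    + replace (Im (c + RtoC T * u)%C) with (Im c + T * Im u) by (destruct c, u; simpl; ring).
      eapply Rle_trans; [apply Rabs_triang|]. rewrite Rabs_mult, (Rabs_pos_eq T) by auto.
      assert (h1 := im_le_Cmod c). assert (h2 := im_le_Cmod u). nra.
  - replace (Re (p * (c + RtoC T * u))%C) with (Re (p * c)%C + T * Re (p * u)%C)
      by (destruct c, u, p; simpl; ring).
    assert (h1 := abs_Re_mult_le p c). apply Rabs_le_between in h1.
    assert (Cmod p * Cmod c <= Cmod p * W) by (apply Rmult_le_compat_l; auto). nra. }
assert (hS : is_cint (fun t => f (a + RtoC t * (b - a)) * (b - a))%C 0 1
   (cint (fun t => f (a + RtoC t * (b - a)) * (b - a))%C 0 1)).
{ apply rcont_ex, rcont_mult; [|apply rcont_const]. apply rcont_comp with (E := closure H); auto.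
  - apply rcont_line.
  - intros t ht. rewrite seg_le in ht by lra. apply hseg; auto. }
set (S := cint (fun t => f (a + RtoC t * (b - a)) * (b - a))%C 0 1) in *.
assert (hSb : Cmod S <= eps / 3).
{ apply is_cint_bound_const with (m := M * exp (- (s * T - Cmod p * W)) * (W + T * V)) in hS.
  - rewrite Rminus_0_r, Rabs_R1, Rmult_1_l in hS. eapply Rle_trans; [exact hS|].
    eapply Rle_trans; [|apply (hT4' T a4)]. right. unfold K.
    replace (- (s * T - Cmod p * W)) with (Cmod p * W + - s * T) by ring. rewrite exp_plus. ring.
  - intros t ht. rewrite seg_le in ht by lra. destruct (hseg t ht) as [h1 h2].
    rewrite Cmod_mult. apply Rmult_le_compat; try apply Cmod_ge_0.
    + eapply Rle_trans; [apply (lap_fun_bound H g M p _ hg h1)|].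
      apply Rmult_le_compat_l; auto. apply exp_le. lra.
    + unfold a, b. replace (w1' + RtoC T * v' - (w1 + RtoC T * v))%C with
        ((w1' - w1) + RtoC T * (v' - v))%C by ring.
      eapply Rle_trans; [apply Cmod_triangle|]. rewrite Cmod_mult, Cmod_R, Rabs_pos_eq by auto.
      assert (h3 := Cmod_minus_le w1' w1). assert (h4 := Cmod_minus_le v' v).
      unfold W, V. nra. }
assert (i1 : inc H f w0 a (A + I)).
{ apply inc_trans with w1; auto. apply inc_line with rho X k; auto. intros t ht; apply hcl; lra. }
assert (i2 : inc H f w0 b (A' + I')).
{ apply inc_trans with w1'; auto. apply inc_line with rho X k; auto. intros t ht; apply hcl'; lra. }
assert (i3 : inc H f a b S).
{ replace b with (a + RtoC 1 * (b - a))%C at 1 by ring.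
  apply inc_line with rho X k; auto; [lra|]. intros t ht. apply hseg; auto. }
assert (e := inc_unique H rho X k f w0 b _ _ hH hf (inc_trans _ _ _ _ _ _ _ i1 i3) i2).
replace (A + J - (A' + J'))%C with ((I' - J') - (I - J) - S + (A + I + S - (A' + I')))%C by ring.
rewrite e. replace (A' + I' - (A' + I'))%C with (RtoC 0) by ring.
replace (I' - J' - (I - J) - S + 0)%C with (I' - J' - (I - J) - S)%C by ring.
eapply Rle_trans; [apply Cmod_minus_le|].
eapply Rle_trans; [apply Rplus_le_compat_r; apply Cmod_minus_le|]. lra.
Qed.

(** For p = x + i y with y <> 0 and v = - a - i y, Re (p v) = y^2 - a x, which is positive for a =
    y^2 / (|x| + 1). On the negative axis v = -1 suits. *)
Lemma admissible_direction (p : C) : ~ on_Rplus p -> exists v : C, Re v < 0 /\ 0 < Re (p * v)%C.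
Proof.
intros hp. destruct p as [x y].
destruct (Req_dec y 0) as [e|e].
- exists (-1, 0). simpl. split; [lra|].
  assert (~ 0 <= x) by (intros hx; apply hp; split; simpl; auto). lra.
- assert (hx := Rabs_pos x).
  assert (hy : 0 < y * y) by nra.
  exists (- (y * y / (Rabs x + 1)), - y). simpl.
  assert (ha : 0 < y * y / (Rabs x + 1)) by (apply Rdiv_lt_0_compat; lra).
  split; [lra|].
  assert (h : y * y / (Rabs x + 1) * (Rabs x + 1) = y * y) by (field; lra).
  assert (h2 := Rle_abs x). nra.
Qed.

(** For a slope d with d |v| <= - Re v, the ray stays in the sector of slope d as soon as it starts
    far enough to the left. *)
Lemma admissible_start (H : C -> Prop) (rho : R -> R) (X k : R) (w0 v : C) : log_domain H rho X k -> Re v < 0 ->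
  exists L, 0 <= L /\ forall t, 0 <= t -> closure H (w0 - RtoC L + RtoC t * v)%C.
Proof.
intros hH hv. assert (hv0 := Cmod_ge_0 v). assert (hw0 := Cmod_ge_0 w0).
set (d := Rmin 1 (- Re v / (Cmod v + 1))).
assert (hd : 0 < d <= 1).
{ split; [apply Rmin_pos; [lra|apply Rdiv_lt_0_compat; lra]|apply Rmin_l]. }
assert (hdv : d * Cmod v <= - Re v).
{ apply Rle_trans with (- Re v / (Cmod v + 1) * (Cmod v + 1)); [|right; field; lra].
  apply Rmult_le_compat; try lra. apply Rmin_r. }
exists (Rmax 0 (Cmod w0 + d * Cmod w0 - X - k * ln d)). split; [apply Rmax_l|].
intros t ht. set (L := Rmax 0 _).
assert (hL : Cmod w0 + d * Cmod w0 - X - k * ln d <= L) by apply Rmax_r.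
apply sector with rho X k d; auto.
replace (Re (w0 - RtoC L + RtoC t * v)%C) with (Re w0 - L + t * Re v) by (destruct w0, v; simpl; ring).
replace (Im (w0 - RtoC L + RtoC t * v)%C) with (Im w0 + t * Im v) by (destruct w0, v; simpl; ring).
assert (h1 := Cmod_ge_re w0).
assert (h2 : d * Rabs (Im w0 + t * Im v) <= d * (Cmod w0 + t * Cmod v)).
{ apply Rmult_le_compat_l; [lra|]. eapply Rle_trans; [apply Rabs_triang|].
  rewrite Rabs_mult, (Rabs_pos_eq t) by auto.
  assert (h3 := im_le_Cmod w0). assert (h4 := im_le_Cmod v). nra. }
nra.
Qed.

(** * Existence, uniqueness and holomorphy of the transform *)

Definition lap_ray (g : C -> C) (w1 v p : C) (T : R) : C := cint (fun t => lap_fun g p (w1 + RtoC t * v) * v)%C 0 T.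

Definition ray_in (H : C -> Prop) (w1 v : C) : Prop := forall t, 0 <= t -> closure H (w1 + RtoC t * v)%C.

Lemma lap_ray_limit (H : C -> Prop) (g : C -> C) (M : R) (w1 v p : C) : E0_bound H g M -> ray_in H w1 v ->
  0 < Re (p * v)%C ->
  exists J, ray_limit (fun t => lap_fun g p (w1 + RtoC t * v) * v)%C J /\ forall T, 0 <= T ->
  Cmod (J - lap_ray g w1 v p T) <= M * Cmod v * exp (- Re (p * w1)%C) / Re (p * v)%C * exp (- Re (p * v)%C * T).
Proof.
intros hg hr hpv.
assert (hM0 : 0 <= M).
{ exact (E0_bound_pos _ _ _ _ hg (hr 0 ltac:(lra))). }
apply exp_ray_limit; auto.
- apply Rmult_le_pos; [apply Rmult_le_pos; auto using Cmod_ge_0|left; apply exp_pos].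
- intros T hT. apply rcont_mult; [|apply rcont_const].
  apply rcont_comp with (E := closure H).
  + apply rcont_line.
  + eapply lap_fun_ccont; eauto.
  + intros t ht. rewrite seg_le in ht by auto. apply hr; lra.
- intros t ht. rewrite Cmod_mult.
  replace (M * Cmod v * exp (- Re (p * w1)%C) * exp (- Re (p * v)%C * t)) with
    (M * (exp (- Re (p * w1)%C) * exp (- Re (p * v)%C * t)) * Cmod v) by ring.
  apply Rmult_le_compat_r; [apply Cmod_ge_0|].
  rewrite <- exp_plus.
  replace (- Re (p * w1)%C + - Re (p * v)%C * t) with (- Re (p * (w1 + RtoC t * v))%C)
    by (destruct p, w1, v; simpl; ring).
  apply (lap_fun_bound H); auto.
Qed.

Lemma piecewise_C1_line (w v : C) : piecewise_C1 (fun t => w + RtoC t * v)%C.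
Proof.
split.
- apply continuous_on_rcont, rcont_line.
- exists 1%nat, INR, (fun _ _ => v). split; [reflexivity|]. split; [reflexivity|].
  intros i hi. replace i with 0%nat by lia. simpl. split; [lra|]. split.
  + apply continuous_on_rcont, rcont_const.
  + intros t _. apply rderiv_line.
Qed.

Lemma is_laplace_lap_value (H : C -> Prop) (rho : R -> R) (X k : R) (g : C -> C) (M : R) (w0 p z : C) :
  log_domain H rho X k -> E0_bound H g M -> is_laplace H g w0 p z -> lap_value H g w0 p z.
Proof.
intros hH hg [w1 [v [gam [J [h1 [h2 [h3 [h4 [h5 [h6 [h7 [h8 h9]]]]]]]]]]]].
exists w1, v, (path_int (lap_fun g p) gam), J.
split; [|split; [|split; [|split; [|split]]]]; auto.
- rewrite <- h2, <- h3. apply inc_path with rho X k; auto.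
  + intros; eapply lap_fun_differentiable; eauto.
  + eapply lap_fun_ccont; eauto.
- apply is_RInt_gen_ray_limit. exact h8.
Qed.

Lemma is_laplace_ex (H : C -> Prop) (rho : R -> R) (X k : R) (g : C -> C) (M : R) (w0 p : C) :
  log_domain H rho X k -> E0_bound H g M -> closure H w0 -> ~ on_Rplus p -> exists z, is_laplace H g w0 p z.
Proof.
intros hH hg hw0 hp.
destruct (admissible_direction p hp) as [v [hv hpv]].
destruct (admissible_start H rho X k w0 v hH hv) as [L [hL hr]].
destruct (lap_ray_limit H g M (w0 - RtoC L)%C v p hg hr hpv) as [J [hJ _]].
eexists. exists (w0 - RtoC L)%C, v, (fun t => w0 + RtoC t * (- RtoC L))%C, J.
split; [apply piecewise_C1_line|]. split; [ring|]. split; [ring|]. split.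
{ intros t ht. replace (w0 + RtoC t * - RtoC L)%C with (w0 - RtoC (t * L))%C by (rewrite RtoC_mult; ring).
  apply closure_left with rho X k; auto. apply Rmult_le_pos; lra. }
split; [exact hr|]. split; [exact hv|]. split; [exact hpv|]. split; [|reflexivity].
apply is_RInt_gen_ray_limit. exact hJ.
Qed.

(** This is what makes [iota] meaningful: off R^+ some path and ray exist, and all of them give one
    value. *)
Lemma laplace_value (H : C -> Prop) (rho : R -> R) (X k : R) (g : C -> C) (M : R) (w0 p z : C) :
  log_domain H rho X k -> E0_bound H g M -> closure H w0 -> ~ on_Rplus p ->
  lap_value H g w0 p z -> laplace H g w0 p = z.
Proof.
intros hH hg hw0 hp hz.
destruct (is_laplace_ex H rho X k g M w0 p hH hg hw0 hp) as [z' hz'].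
assert (e : z = z').
{ apply lap_value_unique with H rho X k g M w0 p; auto. apply is_laplace_lap_value with rho X k M; auto. }
subst z'. unfold laplace. apply (iota_unique (V := C_R_CompleteNormedModule)); auto.
intros y hy. apply lap_value_unique with H rho X k g M w0 p; auto. apply is_laplace_lap_value with rho X k M; auto.
Qed.

Lemma laplace_lap_value (H : C -> Prop) (rho : R -> R) (X k : R) (g : C -> C) (M : R) (w0 p : C) :
  log_domain H rho X k -> E0_bound H g M -> closure H w0 -> ~ on_Rplus p ->
  lap_value H g w0 p (laplace H g w0 p).
Proof.
intros hH hg hw0 hp.
destruct (is_laplace_ex H rho X k g M w0 p hH hg hw0 hp) as [z hz].
apply is_laplace_lap_value with (rho := rho) (X := X) (k := k) (M := M) in hz; auto.
rewrite (laplace_value H rho X k g M w0 p z); auto.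
Qed.

(** The concrete path used for computations: leftwards over a length L, then along v up to parameter
    T. *)
Definition lap_trunc (g : C -> C) (w0 : C) (L : R) (v p : C) (T : R) : C :=
  (lap_ray g w0 (- (1)) p L + lap_ray g (w0 - RtoC L) v p T)%C.

Lemma left_ray_in (H : C -> Prop) (rho : R -> R) (X k : R) (w0 : C) : log_domain H rho X k -> closure H w0 ->
  ray_in H w0 (- (1)).
Proof.
intros hH hw t ht. replace (w0 + RtoC t * - (1))%C with (w0 - RtoC t)%C by ring.
apply closure_left with rho X k; auto.
Qed.

Lemma lap_ray_is_cint (H : C -> Prop) (g : C -> C) (M : R) (w1 v p : C) (T : R) : E0_bound H g M -> ray_in H w1 v ->
  0 <= T -> is_cint (fun t => lap_fun g p (w1 + RtoC t * v) * v)%C 0 T (lap_ray g w1 v p T).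
Proof.
intros hg hr hT. apply rcont_ex, rcont_mult; [|apply rcont_const].
apply rcont_comp with (E := closure H).
- apply rcont_line.
- eapply lap_fun_ccont; eauto.
- intros t ht. rewrite seg_le in ht by auto. apply hr; lra.
Qed.

(** The rate is explicit in p and M. Large T gives identities and holomorphy; T = 0 gives the bound
    near the axis. *)
Lemma lap_trunc_cv (H : C -> Prop) (rho : R -> R) (X k : R) (g : C -> C) (M : R) (w0 p v : C) (L T : R) :
  log_domain H rho X k -> E0_bound H g M -> closure H w0 -> ~ on_Rplus p -> 0 <= L ->
  ray_in H (w0 - RtoC L) v -> Re v < 0 -> 0 < Re (p * v)%C -> 0 <= T ->
  Cmod (laplace H g w0 p - lap_trunc g w0 L v p T) <=
  M * Cmod v * exp (- Re (p * (w0 - RtoC L))%C) / Re (p * v)%C * exp (- Re (p * v)%C * T).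
Proof.
intros hH hg hw0 hp hL hr hv hpv hT.
destruct (lap_ray_limit H g M (w0 - RtoC L)%C v p hg hr hpv) as [J [hJ hJb]].
rewrite (laplace_value H rho X k g M w0 p (lap_ray g w0 (- (1)) p L + J)%C); auto.
- unfold lap_trunc.
  replace (lap_ray g w0 (- (1)) p L + J - (lap_ray g w0 (- (1)) p L + lap_ray g (w0 - RtoC L) v p T))%C
    with (J - lap_ray g (w0 - RtoC L) v p T)%C by ring.
  auto.
- exists (w0 - RtoC L)%C, v, (lap_ray g w0 (- (1)) p L), J.
  split; [|split; [|split; [|split; [|split]]]]; auto.
  replace (w0 - RtoC L)%C with (w0 + RtoC L * - (1))%C by ring.
  assert (hl := left_ray_in H rho X k w0 hH hw0).
  apply inc_line with rho X k; auto.
  + intros; eapply lap_fun_differentiable; eauto.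
  + eapply lap_fun_ccont; eauto.
  + intros t ht. apply hl; lra.
  + eapply lap_ray_is_cint; eauto.
Qed.

(** Differentiation under the integral sign, from the second-order estimate of the exponential: the
    remainder is at most K |q - p|^2, with K built from bounds of phi and w on [a, b]. *)
Lemma cint_param_derive (phi w : R -> C) (a b : R) (p : C) : rcont (seg a b) phi -> rcont (seg a b) w -> a <= b ->
  cderiv (fun q => cint (fun t => phi t * Cexp (- (q * w t)))%C a b) p
    (cint (fun t => phi t * (- w t * Cexp (- (p * w t))))%C a b).
Proof.
intros hphi hw hab.
destruct (rcont_bounded a b phi hab hphi) as [B hB]. destruct (rcont_bounded a b w hab hw) as [W hW].
assert (hB0 : 0 <= B) by (eapply Rle_trans; [apply Cmod_ge_0|apply (hB a), seg_l]).
assert (hW0 : 0 <= W) by (eapply Rle_trans; [apply Cmod_ge_0|apply (hW a), seg_l]).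
assert (hE : forall q, rcont (seg a b) (fun t => Cexp (- (q * w t))%C)).
{ intros q. apply (rcont_comp _ (fun _ => True) w (fun z => Cexp (- (q * z))%C)); auto.
  apply differentiable_ccont. intros; apply Cexp_lin_differentiable. }
assert (hI : forall q, is_cint (fun t => phi t * Cexp (- (q * w t)))%C a b
  (cint (fun t => phi t * Cexp (- (q * w t)))%C a b)).
{ intros q. apply rcont_ex, rcont_mult; auto. }
assert (hI1 : is_cint (fun t => phi t * (- w t * Cexp (- (p * w t))))%C a b
  (cint (fun t => phi t * (- w t * Cexp (- (p * w t))))%C a b)).
{ apply rcont_ex, rcont_mult; auto. apply rcont_mult; auto.
  apply (rcont_comp _ (fun _ => True) w (fun z => (- z)%C)); auto.
  apply differentiable_ccont. intros z _. exists (0 - 1)%C.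
  apply (cderiv_ext_loc (fun z => 0 - z)%C _ _ _ 1 Rlt_0_1); [intros; ring|].
  apply (cderiv_minus (fun _ => 0)); [apply cderiv_const|apply cderiv_id]. }
set (K := (b - a) * (B * (exp (Cmod p * W) * (W * W * exp W)))).
assert (hK : 0 <= K).
{ unfold K. repeat apply Rmult_le_pos; try lra; left; apply exp_pos. }
intros eps he.
exists (Rmin 1 (eps / (K + 1))). split; [apply Rmin_pos; [lra|apply Rdiv_lt_0_compat; lra]|].
intros q hq.
assert (hq1 := lt_Rmin_l hq). assert (hq2 := lt_Rmin_r hq).
assert (h0 := Cmod_ge_0 (q - p)).
assert (hd := is_cint_minus _ _ _ _ _ _ (is_cint_minus _ _ _ _ _ _ (hI q) (hI p)) (is_cint_scal _ _ _ (q - p)%C _ hI1)).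
replace (cint (fun t : R => (phi t * Cexp (- (q * w t)))%C) a b - cint (fun t : R => (phi t * Cexp (- (p * w t)))%C) a b -
   cint (fun t : R => (phi t * (- w t * Cexp (- (p * w t))))%C) a b * (q - p))%C with
  (cint (fun t : R => (phi t * Cexp (- (q * w t)))%C) a b - cint (fun t : R => (phi t * Cexp (- (p * w t)))%C) a b -
   (q - p) * cint (fun t : R => (phi t * (- w t * Cexp (- (p * w t))))%C) a b)%C by ring.
apply Rle_trans with (K * Cmod (q - p) * Cmod (q - p)).
- apply is_cint_bound_const with
    (m := B * (exp (Cmod p * W) * (W * W * exp W)) * Cmod (q - p) * Cmod (q - p)) in hd.
  + rewrite Rabs_pos_eq in hd by lra. eapply Rle_trans; [exact hd|]. right. unfold K; ring.
  + intros t ht. specialize (hB t ht). specialize (hW t ht).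
    replace (phi t * Cexp (- (q * w t)) - phi t * Cexp (- (p * w t)) -
      (q - p) * (phi t * (- w t * Cexp (- (p * w t)))))%C with
      (phi t * (Cexp (- (p * w t)) * (Cexp (- ((q - p) * w t)) - 1 - - ((q - p) * w t))))%C.
    2: { replace (- (q * w t))%C with (- (p * w t) + - ((q - p) * w t))%C by ring. rewrite Cexp_plus. ring. }
    rewrite !Cmod_mult, Cmod_Cexp.
    replace (B * (exp (Cmod p * W) * (W * W * exp W)) * Cmod (q - p) * Cmod (q - p)) with
      (B * (exp (Cmod p * W) * (Cmod (q - p) * W * (Cmod (q - p) * W) * exp W))) by ring.
    apply Rmult_le_compat; auto using Cmod_ge_0.
    { apply Rmult_le_pos; [left; apply exp_pos|apply Cmod_ge_0]. }
    apply Rmult_le_compat; auto using Cmod_ge_0.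
    { left; apply exp_pos. }
    { apply exp_le. assert (h1 := abs_Re_mult_le p (w t)). apply Rabs_le_between in h1.
      replace (Re (- (p * w t))%C) with (- Re (p * w t)%C) by reflexivity.
      assert (Cmod p * Cmod (w t) <= Cmod p * W) by (apply Rmult_le_compat_l; auto using Cmod_ge_0). lra. }
    eapply Rle_trans; [apply Cexp_minus_1_lin|].
    rewrite Cmod_opp, Cmod_mult.
    assert (h1 : Cmod (q - p) * Cmod (w t) <= Cmod (q - p) * W) by (apply Rmult_le_compat_l; auto).
    assert (h2 : 0 <= Cmod (q - p) * Cmod (w t)) by (apply Rmult_le_pos; auto using Cmod_ge_0).
    apply Rmult_le_compat; try apply Rmult_le_compat; auto.
    { apply Rmult_le_pos; auto. }
    { left; apply exp_pos. }
    apply exp_le. apply Rle_trans with (Cmod (q - p) * W); auto. nra.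
- apply Rmult_le_compat_r; auto.
  apply Rle_trans with ((K + 1) * (eps / (K + 1))); [|right; field; lra].
  apply Rmult_le_compat; lra.
Qed.

Lemma lap_ray_differentiable (H : C -> Prop) (g : C -> C) (M : R) (w1 v p : C) (T : R) :
  E0_bound H g M -> (forall t, 0 <= t <= T -> closure H (w1 + RtoC t * v)%C) -> 0 <= T ->
  differentiable (fun q => lap_ray g w1 v q T) p.
Proof.
intros [_ [hg _]] hr hT.
set (phi := fun t => (g (w1 + RtoC t * v) * v)%C).
assert (h := cint_param_derive phi (fun t => w1 + RtoC t * v)%C 0 T p).
eexists. eapply cderiv_ext_loc with (r := 1) (3 := h _ _ hT); [lra|].
intros q _. unfold lap_ray. f_equal. apply functional_extensionality. intros t.
unfold lap_fun, phi. ring.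
Unshelve.
- apply rcont_mult; [|apply rcont_const]. apply rcont_comp with (E := closure H); auto.
  + apply rcont_line.
  + intros t ht. rewrite seg_le in ht by auto. auto.
- apply rcont_line.
Qed.

Lemma off_Rplus_open (p : C) : ~ on_Rplus p -> exists r, 0 < r /\ forall q, Cmod (q - p) < r -> ~ on_Rplus q.
Proof.
intros hp. destruct (Req_dec (Im p) 0) as [e|e].
- assert (hx : Re p < 0) by (apply Rnot_le_lt; intros hx; apply hp; split; auto).
  exists (- Re p). split; [lra|]. intros q hq [_ h2].
  assert (h := Cmod_ge_re (q - p)%C). replace (Re (q - p)%C) with (Re q - Re p) in h by reflexivity. lra.
- exists (Rabs (Im p)). split; [apply Rabs_pos_lt; auto|]. intros q hq [h1 _].
  assert (h := im_le_Cmod (q - p)%C). replace (Im (q - p)%C) with (Im q - Im p) in h by reflexivity.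
  rewrite h1, Rminus_0_l, Rabs_Ropp in h. lra.
Qed.

(** The v and L chosen for p serve on a whole disc, where Re (q v) >= Re (p v) / 2; there the
    truncations, entire in q, converge uniformly. *)
Lemma laplace_differentiable (H : C -> Prop) (rho : R -> R) (X k : R) (g : C -> C) (M : R) (w0 p : C) :
  log_domain H rho X k -> E0_bound H g M -> closure H w0 -> ~ on_Rplus p ->
  differentiable (laplace H g w0) p.
Proof.
intros hH hg hw0 hp.
destruct (admissible_direction p hp) as [v [hv hpv]].
destruct (admissible_start H rho X k w0 v hH hv) as [L [hL hr]].
destruct (off_Rplus_open p hp) as [r0 [hr0 hoff]].
set (s := Re (p * v)%C / 2).
assert (hs : 0 < s) by (unfold s; lra).
assert (hv0 := Cmod_ge_0 v).
set (r := Rmin r0 (s / (Cmod v + 1))).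
assert (hrp : 0 < r) by (apply Rmin_pos; [lra|apply Rdiv_lt_0_compat; lra]).
assert (hball : forall q, Cmod (q - p) < r -> ~ on_Rplus q /\ s <= Re (q * v)%C).
{ intros q hq. split; [apply hoff; exact (lt_Rmin_l hq)|].
  assert (h1 := lt_Rmin_r hq).
  assert (h2 := abs_Re_mult_le (q - p) v). apply Rabs_le_between in h2.
  replace (Re ((q - p) * v)%C) with (Re (q * v)%C - Re (p * v)%C) in h2 by (destruct q, p, v; simpl; ring).
  assert (h3 : Cmod (q - p) * Cmod v <= s / (Cmod v + 1) * (Cmod v + 1)).
  { apply Rmult_le_compat; try lra. apply Cmod_ge_0. }
  replace (s / (Cmod v + 1) * (Cmod v + 1)) with s in h3 by (field; lra).
  unfold s in *. lra. }
apply uniform_limit_differentiable with (fun n q => lap_trunc g w0 L v q (INR n)) r; auto.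
- intros n q _. apply differentiable_plus.
  + apply lap_ray_differentiable with H M; auto. intros t ht. apply (left_ray_in H rho X k w0 hH hw0); lra.
  + apply lap_ray_differentiable with H M; auto; [|apply pos_INR]. intros t ht. apply hr; lra.
- intros eps he.
  assert (hM0 : 0 <= M).
  { exact (E0_bound_pos _ _ _ _ hg hw0). }
  set (K := M * Cmod v * exp ((Cmod p + r) * Cmod (w0 - RtoC L)) / s).
  destruct (exp_decay K s eps hs he) as [T0 [hT0 hdec]].
  destruct (INR_unbounded T0) as [N hN]. exists N. intros n hn q hq.
  destruct (hball q hq) as [hq1 hq2].
  assert (hnN := le_INR N n hn).
  rewrite Cmod_minus_sym.
  eapply Rle_trans; [apply (lap_trunc_cv H rho X k g M); auto; try lra; apply pos_INR|].
  apply Rle_trans with (2 := hdec (INR n) ltac:(lra)). unfold K.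
  apply Rmult_le_compat.
  + apply Rdiv_le_0_compat; [|lra]. repeat apply Rmult_le_pos; auto. left; apply exp_pos.
  + left; apply exp_pos.
  + apply Rmult_le_compat.
    * repeat apply Rmult_le_pos; auto. left; apply exp_pos.
    * left; apply Rinv_0_lt_compat; lra.
    * apply Rmult_le_compat_l; [apply Rmult_le_pos; auto|]. apply exp_le.
      assert (h1 := abs_Re_mult_le q (w0 - RtoC L)). apply Rabs_le_between in h1.
      assert (h2 : Cmod q <= Cmod p + r).
      { assert (h3 := Cmod_rev_tri q p). lra. }
      assert (Cmod q * Cmod (w0 - RtoC L) <= (Cmod p + r) * Cmod (w0 - RtoC L))
        by (apply Rmult_le_compat_r; auto using Cmod_ge_0). lra.
    * apply Rinv_le_contravar; auto.
  + apply exp_le. assert (h := pos_INR n). nra.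
Qed.

(* Identities between Laplace transforms follow from the same identities
   between truncated integrals. *)
Lemma eq_of_exp_cv (z : C) (K s : R) : 0 < s -> (forall T, 0 <= T -> Cmod z <= K * exp (- s * T)) -> z = 0.
Proof.
intros hs h. apply Cmod_le_eps_eq. intros eps he.
replace (z - 0)%C with z by ring.
destruct (exp_decay K s eps hs he) as [T0 [hT0 h1]].
eapply Rle_trans; [apply (h T0); lra|]. apply h1; lra.
Qed.

Lemma E0_bound_minus (H : C -> Prop) (g1 g2 : C -> C) (M1 M2 M : R) : E0_bound H g1 M1 -> E0_bound H g2 M2 ->
  (forall w, closure H w -> Cmod (g1 w - g2 w) <= M) -> E0_bound H (fun w => g1 w - g2 w)%C M.
Proof.
intros [a1 [b1 _]] [a2 [b2 _]] hM. split; [|split]; auto.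
- intros z hz. apply differentiable_minus; auto.
- apply ccont_minus; auto.
Qed.

Lemma laplace_minus (H : C -> Prop) (rho : R -> R) (X k : R) (g1 g2 : C -> C) (M1 M2 : R) (w0 p : C) :
  log_domain H rho X k -> E0_bound H g1 M1 -> E0_bound H g2 M2 -> closure H w0 -> ~ on_Rplus p ->
  laplace H (fun w => g1 w - g2 w)%C w0 p = (laplace H g1 w0 p - laplace H g2 w0 p)%C.
Proof.
intros hH h1 h2 hw0 hp.
assert (h3 : E0_bound H (fun w => g1 w - g2 w)%C (M1 + M2)).
{ apply E0_bound_minus with M1 M2; auto. intros w hw.
  eapply Rle_trans; [apply Cmod_minus_le|]. destruct h1 as [_ [_ a]], h2 as [_ [_ b]].
  specialize (a w hw). specialize (b w hw). lra. }
destruct (admissible_direction p hp) as [v [hv hpv]].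
destruct (admissible_start H rho X k w0 v hH hv) as [L [hL hr]].
set (Q := Cmod v * exp (- Re (p * (w0 - RtoC L))%C) / Re (p * v)%C).
set (G := fun w => (g1 w - g2 w)%C) in *.
enough (e : (laplace H G w0 p - (laplace H g1 w0 p - laplace H g2 w0 p))%C = 0).
{ replace (laplace H G w0 p) with ((laplace H G w0 p - (laplace H g1 w0 p - laplace H g2 w0 p))
   + (laplace H g1 w0 p - laplace H g2 w0 p))%C by ring. rewrite e; ring. }
(* Three truncation errors add up, with bounds M1, M2 and M1 + M2. *)
apply eq_of_exp_cv with ((2 * (M1 + M2)) * Q) (Re (p * v)%C); auto. intros T hT.
assert (a1 := lap_trunc_cv H rho X k g1 M1 w0 p v L T hH h1 hw0 hp hL hr hv hpv hT).
assert (a2 := lap_trunc_cv H rho X k g2 M2 w0 p v L T hH h2 hw0 hp hL hr hv hpv hT).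
assert (a3 := lap_trunc_cv H rho X k G _ w0 p v L T hH h3 hw0 hp hL hr hv hpv hT).
assert (hray : forall w1 u S, 0 <= S -> ray_in H w1 u ->
  lap_ray G w1 u p S = (lap_ray g1 w1 u p S - lap_ray g2 w1 u p S)%C).
{ intros w1 u S hS hu. apply is_cint_cint.
  eapply is_cint_ext; [|apply is_cint_minus; eapply lap_ray_is_cint; eauto].
  intros t _. unfold lap_fun, G. ring. }
assert (e : lap_trunc G w0 L v p T = (lap_trunc g1 w0 L v p T - lap_trunc g2 w0 L v p T)%C).
{ unfold lap_trunc. rewrite !hray; auto; [ring|]. apply (left_ray_in H rho X k w0 hH hw0). }
rewrite e in a3.
replace (laplace H G w0 p - (laplace H g1 w0 p - laplace H g2 w0 p))%C with
  ((laplace H G w0 p - (lap_trunc g1 w0 L v p T - lap_trunc g2 w0 L v p T)) -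
   ((laplace H g1 w0 p - lap_trunc g1 w0 L v p T) - (laplace H g2 w0 p - lap_trunc g2 w0 L v p T)))%C by ring.
eapply Rle_trans; [apply Cmod_minus_le|].
eapply Rle_trans; [apply Rplus_le_compat_l; apply Cmod_minus_le|].
eapply Rle_trans; [apply Rplus_le_compat; [exact a3|apply Rplus_le_compat; [exact a1|exact a2]]|].
right. unfold Q, Rdiv. ring.
Qed.

(** * Translation and change of base point *)

Definition translate (tau : C) (g : C -> C) (w : C) : C := g (w + tau)%C.

Lemma E0_bound_translate (H : C -> Prop) (rho : R -> R) (X k : R) (g : C -> C) (M : R) (tau : C) :
  log_domain H rho X k -> E0_bound H g M -> (forall w, H w -> H (w + tau)%C) ->
  (forall w, closure H w -> closure H (w + tau)%C) -> E0_bound H (translate tau g) M.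
Proof.
intros hH [h1 [h2 h3]] ht htc. split; [|split].
- intros z hz. destruct (h1 _ (ht z hz)) as [l hl]. exists (l * (1 + 0))%C.
  apply (cderiv_comp (fun z => z + tau)%C g); auto.
  apply (cderiv_plus (fun z => z)); [apply cderiv_id|apply cderiv_const].
- intros p hp eps he. destruct (h2 _ (htc p hp) eps he) as [d [hd h]].
  exists d; split; auto. intros q hq hqp. apply h; auto.
  replace (q + tau - (p + tau))%C with (q - p)%C by ring. auto.
- intros w hw. apply h3; auto.
Qed.

(** The substitution w -> w + tau extracts the factor e^(p tau). The same v and L are admissible for
    both base points, so the truncated integrals correspond exactly. *)
Lemma laplace_translate (H : C -> Prop) (rho : R -> R) (X k : R) (g : C -> C) (M : R) (tau w0 p : C) :
  log_domain H rho X k -> E0_bound H g M -> (forall w, H w -> H (w + tau)%C) ->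
  (forall w, closure H w -> closure H (w + tau)%C) -> closure H w0 -> ~ on_Rplus p ->
  laplace H (translate tau g) w0 p = (Cexp (p * tau) * laplace H g (w0 + tau) p)%C.
Proof.
intros hH hg ht htc hw0 hp.
assert (hgt := E0_bound_translate H rho X k g M tau hH hg ht htc).
destruct (admissible_direction p hp) as [v [hv hpv]].
destruct (admissible_start H rho X k w0 v hH hv) as [L [hL hr]].
assert (hr' : ray_in H (w0 + tau - RtoC L) v).
{ intros t htp. replace (w0 + tau - RtoC L + RtoC t * v)%C with (w0 - RtoC L + RtoC t * v + tau)%C by ring.
  apply htc, hr; auto. }
set (e := Cexp (p * tau)).
enough (e0 : (laplace H (translate tau g) w0 p - e * laplace H g (w0 + tau) p)%C = 0).
{ replace (laplace H (translate tau g) w0 p) with ((laplace H (translate tau g) w0 p - e * laplace H g (w0 + tau) p)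
   + e * laplace H g (w0 + tau) p)%C by ring. rewrite e0; ring. }
set (Q1 := M * Cmod v * exp (- Re (p * (w0 - RtoC L))%C) / Re (p * v)%C).
set (Q2 := M * Cmod v * exp (- Re (p * (w0 + tau - RtoC L))%C) / Re (p * v)%C).
apply eq_of_exp_cv with (Q1 + Cmod e * Q2) (Re (p * v)%C); auto. intros T hT.
assert (a1 := lap_trunc_cv H rho X k _ M w0 p v L T hH hgt hw0 hp hL hr hv hpv hT).
assert (a2 := lap_trunc_cv H rho X k g M (w0 + tau)%C p v L T hH hg (htc w0 hw0) hp hL hr' hv hpv hT).
fold Q1 in a1. fold Q2 in a2.
assert (hray : forall w1 u S, 0 <= S -> ray_in H w1 u ->
  lap_ray (translate tau g) w1 u p S = (e * lap_ray g (w1 + tau) u p S)%C).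
{ intros w1 u S hS hu. apply is_cint_cint.
  eapply is_cint_ext; [|apply is_cint_scal; eapply lap_ray_is_cint; eauto].
  - intros t _. unfold lap_fun, translate, e.
    replace (w1 + tau + RtoC t * u)%C with (w1 + RtoC t * u + tau)%C by ring.
    replace (- (p * (w1 + RtoC t * u)))%C with (p * tau + - (p * (w1 + RtoC t * u + tau)))%C by ring.
    rewrite Cexp_plus. ring.
  - intros t htp. replace (w1 + tau + RtoC t * u)%C with (w1 + RtoC t * u + tau)%C by ring.
    apply htc, hu; auto. }
assert (et : lap_trunc (translate tau g) w0 L v p T = (e * lap_trunc g (w0 + tau) L v p T)%C).
{ unfold lap_trunc. rewrite !hray; auto; [|apply (left_ray_in H rho X k w0 hH hw0)].
  replace (w0 - RtoC L + tau)%C with (w0 + tau - RtoC L)%C by ring. ring. }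
rewrite et in a1.
replace (laplace H (translate tau g) w0 p - e * laplace H g (w0 + tau) p)%C with
  ((laplace H (translate tau g) w0 p - e * lap_trunc g (w0 + tau) L v p T) -
   e * (laplace H g (w0 + tau) p - lap_trunc g (w0 + tau) L v p T))%C by ring.
eapply Rle_trans; [apply Cmod_minus_le|]. rewrite Cmod_mult.
assert (Cmod e * Cmod (laplace H g (w0 + tau) p - lap_trunc g (w0 + tau) L v p T) <=
  Cmod e * (Q2 * exp (- Re (p * v)%C * T))) by (apply Rmult_le_compat_l; auto using Cmod_ge_0).
lra.
Qed.

(* Integral along the path w0 -> Re w0 -> a. *)
Definition base_change (g : C -> C) (w0 : C) (a : R) (p : C) : C :=
  (lap_ray g w0 (- (Ci * RtoC (Im w0))) p 1 + lap_ray g (RtoC (Re w0)) (RtoC (a - Re w0)) p 1)%C.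

(** The vertical move towards the axis stays in the closure because rho decreases; then both ends
    lie on the real half-line up to rho 0. *)
Lemma base_change_in (H : C -> Prop) (rho : R -> R) (X k : R) (w0 : C) (a : R) : log_domain H rho X k ->
  closure H w0 -> closure H (RtoC a) ->
  (forall t, 0 <= t <= 1 -> closure H (w0 + RtoC t * (- (Ci * RtoC (Im w0))))%C) /\
  (forall t, 0 <= t <= 1 -> closure H (RtoC (Re w0) + RtoC t * RtoC (a - Re w0))%C).
Proof.
intros hH hw ha. rewrite (ld_cl _ _ _ _ hH) in hw, ha. destruct w0 as [x y]. simpl in *.
rewrite Rabs_R0 in ha.
assert (h0 : rho (Rabs y) <= rho 0).
{ apply (ld_decr _ _ _ _ hH). split; [lra|apply Rabs_pos]. }
split; intros t ht; apply (ld_cl _ _ _ _ hH); simpl.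
- replace (y + (t * - (0 * 0 + 1 * y) + 0 * - (0 * y - 1 * 0))) with ((1 - t) * y) by ring.
  replace (x + (t * - (0 * y - 1 * 0) - 0 * - (0 * 0 + 1 * y))) with x by ring.
  eapply Rle_trans; [exact hw|]. apply (ld_decr _ _ _ _ hH). rewrite Rabs_mult, (Rabs_pos_eq (1 - t)) by lra. assert (h := Rabs_pos y). split; nra.
- replace (0 + (t * 0 + 0 * (a - x))) with 0 by ring. rewrite Rabs_R0.
  replace (x + (t * (a - x) - 0 * 0)) with ((1 - t) * x + t * a) by ring. nra.
Qed.

Lemma lap_ray_growth (H : C -> Prop) (g : C -> C) (M : R) (w1 v p : C) : E0_bound H g M ->
  (forall t, 0 <= t <= 1 -> closure H (w1 + RtoC t * v)%C) ->
  Cmod (lap_ray g w1 v p 1) <= M * Cmod v * exp ((Cmod w1 + Cmod v) * Cmod p).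
Proof.
intros hg hr.
assert (hI : is_cint (fun t => lap_fun g p (w1 + RtoC t * v) * v)%C 0 1 (lap_ray g w1 v p 1)).
{ apply rcont_ex, rcont_mult; [|apply rcont_const]. apply rcont_comp with (E := closure H).
  - apply rcont_line.
  - eapply lap_fun_ccont; eauto.
  - intros t ht. rewrite seg_le in ht by lra. auto. }
apply is_cint_bound_const with (m := M * Cmod v * exp ((Cmod w1 + Cmod v) * Cmod p)) in hI.
- rewrite Rminus_0_r, Rabs_R1, Rmult_1_l in hI. exact hI.
- intros t ht. rewrite seg_le in ht by lra. rewrite Cmod_mult.
  replace (M * Cmod v * exp ((Cmod w1 + Cmod v) * Cmod p)) with
    (M * exp ((Cmod w1 + Cmod v) * Cmod p) * Cmod v) by ring.
  apply Rmult_le_compat_r; [apply Cmod_ge_0|].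
  eapply Rle_trans; [apply (lap_fun_bound H g M); auto|].
  apply Rmult_le_compat_l.
  { exact (E0_bound_pos _ _ _ _ hg (hr t ht)). }
  apply exp_le. assert (h := abs_Re_mult_le p (w1 + RtoC t * v)). apply Rabs_le_between in h.
  assert (h1 : Cmod (w1 + RtoC t * v) <= Cmod w1 + Cmod v).
  { eapply Rle_trans; [apply Cmod_triangle|]. rewrite Cmod_mult, Cmod_R, Rabs_pos_eq by lra.
    assert (h2 := Cmod_ge_0 v). nra. }
  assert (Cmod p * Cmod (w1 + RtoC t * v) <= Cmod p * (Cmod w1 + Cmod v))
    by (apply Rmult_le_compat_l; auto using Cmod_ge_0). lra.
Qed.

Lemma base_change_entire (H : C -> Prop) (rho : R -> R) (X k : R) (g : C -> C) (M : R) (w0 : C) (a : R) :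
  log_domain H rho X k -> E0_bound H g M -> closure H w0 -> closure H (RtoC a) ->
  entire_exp_growth (base_change g w0 a).
Proof.
intros hH hg hw ha. destruct (base_change_in H rho X k w0 a hH hw ha) as [h1 h2]. split.
- intros p. apply holomorphic_at_iff, differentiable_plus; apply lap_ray_differentiable with H M; auto; lra.
- set (v1 := (- (Ci * RtoC (Im w0)))%C) in *. set (v2 := RtoC (a - Re w0)) in *.
  exists (M * Cmod v1 + M * Cmod v2), (Cmod w0 + Cmod v1 + Cmod (RtoC (Re w0)) + Cmod v2). intros p.
  unfold base_change. fold v1 v2.
  eapply Rle_trans; [apply Cmod_triangle|]. rewrite Rmult_plus_distr_r.
  assert (hM0 : 0 <= M).
  { exact (E0_bound_pos _ _ _ _ hg hw). }
  assert (hp := Cmod_ge_0 p). assert (n1 := Cmod_ge_0 w0). assert (n2 := Cmod_ge_0 v1).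
  assert (n3 := Cmod_ge_0 (RtoC (Re w0))). assert (n4 := Cmod_ge_0 v2).
  apply Rplus_le_compat; (eapply Rle_trans; [apply (lap_ray_growth H g M); auto|]);
  (apply Rmult_le_compat_l; [apply Rmult_le_pos; auto|apply exp_le; apply Rmult_le_compat_r; lra]).
Qed.

Lemma laplace_base_change (H : C -> Prop) (rho : R -> R) (X k : R) (g : C -> C) (M : R) (w0 : C) (a : R) (p : C) :
  log_domain H rho X k -> E0_bound H g M -> closure H w0 -> closure H (RtoC a) -> ~ on_Rplus p ->
  laplace H g w0 p = (base_change g w0 a p + laplace H g (RtoC a) p)%C.
Proof.
intros hH hg hw ha hp. destruct (base_change_in H rho X k w0 a hH hw ha) as [h1 h2].
apply laplace_value with rho X k M; auto.
destruct (laplace_lap_value H rho X k g M (RtoC a) p hH hg ha hp) as [w1 [v [A [J [hA [hc [hv [hpv [hJ e]]]]]]]]].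
exists w1, v, (base_change g w0 a p + A)%C, J.
split; [|split; [|split; [|split; [|split]]]]; auto.
2: { rewrite e. ring. }
apply inc_trans with (RtoC a); auto.
assert (hline : forall w u, (forall t, 0 <= t <= 1 -> closure H (w + RtoC t * u)%C) ->
  inc H (lap_fun g p) w (w + u)%C (lap_ray g w u p 1)).
{ intros w u hu. replace (w + u)%C with (w + RtoC 1 * u)%C by ring. apply inc_line with rho X k; auto; try lra.
  - intros; eapply lap_fun_differentiable; eauto.
  - eapply lap_fun_ccont; eauto.
  - apply rcont_ex, rcont_mult; [|apply rcont_const]. apply rcont_comp with (E := closure H).
    + apply rcont_line.
    + eapply lap_fun_ccont; eauto.
    + intros t ht. rewrite seg_le in ht by lra. auto. }
apply inc_trans with (RtoC (Re w0)).
- replace (RtoC (Re w0)) with (w0 + - (Ci * RtoC (Im w0)))%C.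
  + apply hline; auto.
  + destruct w0. apply C_eq_parts; simpl; ring.
- replace (RtoC a) with (RtoC (Re w0) + RtoC (a - Re w0))%C.
  + apply hline; auto.
  + rewrite RtoC_minus; ring.
Qed.

(* The tangent of slope d = |Im p| / (2 P) to the border of H is an admissible
   ray; it starts at a point of order k ln d, so that exp (- p w) grows there at
   most like a power of 1 / |Im p|. *)
Lemma laplace_axis_bound (H : C -> Prop) (rho : R -> R) (X k P : R) : log_domain H rho X k -> 0 < P ->
  exists K N, 0 <= K /\ forall g M p, E0_bound H g M -> Cmod p <= P -> Im p <> 0 ->
  Cmod (laplace H g (RtoC (X - 1)) p) * Rabs (Im p) ^ S N <= K * M.
Proof.
intros hH hP. assert (hk := ld_k _ _ _ _ hH).
(* At the start of the ray e^(-p w) is at most e^(P |a|) e^(P L), with e^(P L) = d^(-P k) for L = -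
   k ln d: a power N > P k of d compensates. *)
destruct (INR_unbounded (P * k)) as [N hN].
set (a := X - 1).
assert (haH : closure H (RtoC a)).
{ apply sector with rho X k 1; auto; [lra|]. simpl. rewrite Rabs_R0, ln_1. unfold a. lra. }
exists (exp (P * Rabs a) * (2 * P) ^ N * (2 * P * k + 4)), N.
split.
{ repeat apply Rmult_le_pos; [left; apply exp_pos|apply pow_le; lra|].
  assert (0 < P * k) by (apply Rmult_lt_0_compat; auto). lra. }
intros g M p hg hpP hy.
assert (hM0 : 0 <= M).
{ exact (E0_bound_pos _ _ _ _ hg haH). }
set (e := Rabs (Im p)).
assert (he : 0 < e) by (apply Rabs_pos_lt; auto).
assert (heP : e <= P) by (eapply Rle_trans; [apply im_le_Cmod|auto]).
set (d := e / (2 * P)).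
assert (hd : 0 < d <= 1).
{ split; [apply Rdiv_lt_0_compat; lra|]. apply Rmult_le_reg_r with (2 * P); [lra|].
  unfold d, Rdiv. rewrite Rmult_assoc, Rinv_l; lra. }
assert (hld : ln d <= 0) by (rewrite <- ln_1; apply ln_le; lra).
set (L := - (k * ln d)).
assert (hL : 0 <= L) by (unfold L; nra).
assert (hp : ~ on_Rplus p) by (intros [h _]; auto).
set (sg := Im p / e).
assert (hsg : Rabs sg = 1).
{ unfold sg, Rdiv. rewrite Rabs_mult, Rabs_inv. fold e. rewrite (Rabs_pos_eq e) by lra. field. lra. }
assert (hsy : sg * Im p = e).
{ unfold sg, Rdiv. replace (Im p * / e * Im p) with ((Im p * Im p) / e) by (field; lra).
  replace (Im p * Im p) with (e * e); [field; lra|]. unfold e. rewrite <- Rabs_mult. apply Rabs_pos_eq. nra. }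
(* The vertical part, opposite in sign to Im p, contributes |Im p| to Re (p v); the slope d = |Im p|
   / (2 P) takes back at most half of it. *)
set (v := (- d, - sg) : C).
assert (hpv : e / 2 <= Re (p * v)%C).
{ replace (Re (p * v)%C) with (e - Re p * d) by (rewrite <- hsy; destruct p; unfold v; simpl; ring).
  assert (h1 : Re p * d <= P * d).
  { apply Rmult_le_compat_r; [lra|]. eapply Rle_trans; [apply Cmod_ge_re|auto]. }
  replace (P * d) with (e / 2) in h1 by (unfold d; field; lra). lra. }
assert (hvm : Cmod v <= 2).
{ eapply Rle_trans; [apply Cmod_le_abs|]. rewrite !Rabs_Ropp, hsg, Rabs_pos_eq; lra. }
assert (hr : ray_in H (RtoC a - RtoC L) v).
{ intros t ht. apply sector with rho X k d; auto. unfold v, a, L. simpl.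
  replace (Rabs (0 + - 0 + (t * - sg + 0 * - d))) with t; [lra|].
  replace (0 + - 0 + (t * - sg + 0 * - d)) with (- (t * sg)) by ring.
  rewrite Rabs_Ropp, Rabs_mult, hsg, Rabs_pos_eq; lra. }
(* With T = 0 the truncation is the horizontal segment alone, and the error term bounds the whole
   ray. *)
assert (hT := lap_trunc_cv H rho X k g M (RtoC a) p v L 0 hH hg haH hp hL hr ltac:(simpl; lra) ltac:(lra) (Rle_refl 0)).
rewrite Rmult_0_r, exp_0, Rmult_1_r in hT.
unfold lap_trunc in hT. replace (lap_ray g (RtoC a - RtoC L) v p 0) with (RtoC 0) in hT.
2: { symmetry. apply is_cint_cint, is_cint_point. }
set (E := exp (P * (Rabs a + L))).
assert (hE : 0 < E) by apply exp_pos.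
assert (hexp : forall w, Cmod w <= Rabs a + L -> exp (- Re (p * w)%C) <= E).
{ intros w hw. apply exp_le. assert (h := abs_Re_mult_le p w). apply Rabs_le_between in h.
  assert (Cmod p * Cmod w <= P * (Rabs a + L)) by (apply Rmult_le_compat; auto using Cmod_ge_0). lra. }
assert (hA : Cmod (lap_ray g (RtoC a) (- (1)) p L) <= L * (M * E)).
{ assert (hl := left_ray_in H rho X k (RtoC a) hH haH).
  assert (hI := lap_ray_is_cint H g M (RtoC a) (- (1)) p L hg hl hL).
  apply is_cint_bound_const with (m := M * E) in hI.
  - rewrite Rminus_0_r, (Rabs_pos_eq L) in hI by auto. exact hI.
  - intros t ht. rewrite seg_le in ht by auto. rewrite Cmod_mult, Cmod_opp, Cmod_1, Rmult_1_r.
    eapply Rle_trans; [apply (lap_fun_bound H g M); auto; apply hl; lra|].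
    apply Rmult_le_compat_l; auto. apply hexp.
    replace (RtoC a + RtoC t * - (1))%C with (RtoC (a - t)) by (rewrite RtoC_minus; ring).
    rewrite Cmod_R. eapply Rle_trans; [apply Rabs_triang|]. rewrite Rabs_Ropp, (Rabs_pos_eq t); lra. }
assert (hJ : M * Cmod v * exp (- Re (p * (RtoC a - RtoC L))%C) / Re (p * v)%C <= M * 2 * E / (e / 2)).
{ assert (h1 : exp (- Re (p * (RtoC a - RtoC L))%C) <= E).
  { apply hexp. rewrite <- RtoC_minus, Cmod_R. eapply Rle_trans; [apply Rabs_triang|].
    rewrite Rabs_Ropp, (Rabs_pos_eq L); lra. }
  assert (h0 := Cmod_ge_0 v). assert (hx := exp_pos (- Re (p * (RtoC a - RtoC L))%C)).
  apply Rmult_le_compat.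
  - repeat apply Rmult_le_pos; auto; lra.
  - left; apply Rinv_0_lt_compat; lra.
  - apply Rmult_le_compat; try lra; [apply Rmult_le_pos; auto|]. apply Rmult_le_compat_l; auto.
  - apply Rinv_le_contravar; lra. }
assert (hEN : E * e ^ N <= exp (P * Rabs a) * (2 * P) ^ N).
{ unfold E. rewrite Rmult_plus_distr_l, exp_plus, Rmult_assoc.
  apply Rmult_le_compat_l; [left; apply exp_pos|].
  replace (e ^ N) with (d ^ N * (2 * P) ^ N).
  2: { rewrite <- Rpow_mult_distr. f_equal. unfold d; field; lra. }
  rewrite <- Rmult_assoc. rewrite <- (Rmult_1_l ((2 * P) ^ N)) at 2.
  apply Rmult_le_compat_r; [apply pow_le; lra|].
  rewrite <- (exp_ln (d ^ N)) by (apply pow_lt; lra). rewrite <- exp_plus, <- exp_0.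
  apply exp_le. rewrite ln_pow by lra. unfold L. nra. }
(* The extra power of |Im p| in [S N] pays for the length L, only logarithmic in d, and for the
   factor 1 / Re (p v). *)
assert (hLe : L * e <= 2 * P * k).
{ assert (hd' : 0 < / d) by (apply Rinv_0_lt_compat; lra).
  assert (h := ln_le_minus_1 (/ d) hd'). rewrite ln_Rinv in h by lra.
  assert (h1 : L <= k * / d) by (unfold L; nra).
  apply Rle_trans with (k * / d * e); [apply Rmult_le_compat_r; lra|].
  right. unfold d. field. lra. }
assert (hlap : Cmod (laplace H g (RtoC a) p) <= L * (M * E) + M * 2 * E / (e / 2)).
{ replace (laplace H g (RtoC a) p) with ((laplace H g (RtoC a) p - (lap_ray g (RtoC a) (- (1)) p L + 0)) +
    lap_ray g (RtoC a) (- (1)) p L)%C by ring.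
  eapply Rle_trans; [apply Cmod_triangle|]. lra. }
apply Rle_trans with ((L * (M * E) + M * 2 * E / (e / 2)) * e ^ S N).
- apply Rmult_le_compat_r; [apply pow_le; lra|exact hlap].
- replace ((L * (M * E) + M * 2 * E / (e / 2)) * e ^ S N) with (M * (E * e ^ N) * (L * e + 4))
    by (simpl; field; lra).
  replace (exp (P * Rabs a) * (2 * P) ^ N * (2 * P * k + 4) * M) with
    (M * (exp (P * Rabs a) * (2 * P) ^ N) * (2 * P * k + 4)) by ring.
  apply Rmult_le_compat.
  + repeat apply Rmult_le_pos; try lra. apply pow_le; lra.
  + assert (0 <= L * e) by (apply Rmult_le_pos; lra). lra.
  + apply Rmult_le_compat_l; auto.
  + lra.
Qed.

(** * Holomorphic extension across the real axis *)

(** A real p is approached vertically, by p + i s, and both functions are continuous there. *)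
Lemma agree_off_axis (F G : C -> C) (p : C) (r : R) : differentiable F p -> differentiable G p -> 0 < r ->
  (forall q, Cmod (q - p) < r -> Im q <> 0 -> F q = G q) -> F p = G p.
Proof.
intros [l hl] [m hm] hr h.
destruct (Req_dec (Im p) 0) as [e|e].
2: { apply h; auto. rewrite Cmod_diag; auto. }
apply Cmod_le_eps_eq. intros eps he.
destruct (cderiv_cont F p l hl (eps / 2)) as [d1 [hd1 k1]]; [lra|].
destruct (cderiv_cont G p m hm (eps / 2)) as [d2 [hd2 k2]]; [lra|].
set (s := Rmin r (Rmin d1 d2) / 2).
assert (hs : 0 < s /\ s < r /\ s < d1 /\ s < d2).
{ assert (a1 := Rmin_l r (Rmin d1 d2)). assert (a2 := Rmin_r r (Rmin d1 d2)).
  assert (a3 := Rmin_l d1 d2). assert (a4 := Rmin_r d1 d2).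
  assert (0 < Rmin r (Rmin d1 d2)) by (repeat apply Rmin_pos; lra). unfold s; lra. }
set (q := (p + Ci * RtoC s)%C).
assert (hq : Cmod (q - p) = s).
{ unfold q. replace (p + Ci * RtoC s - p)%C with (Ci * RtoC s)%C by ring.
  rewrite Cmod_mult, Cmod_Ci, Cmod_R, Rabs_pos_eq; lra. }
assert (hqi : Im q <> 0) by (unfold q; destruct p; simpl in *; lra).
specialize (k1 q ltac:(lra)). specialize (k2 q ltac:(lra)).
rewrite (h q ltac:(lra) hqi) in k1.
replace (F p - G p)%C with ((G q - G p) - (G q - F p))%C by ring.
eapply Rle_trans; [apply Cmod_minus_le|lra].
Qed.

Definition local_extension (f : C -> C) (p z : C) : Prop :=
  exists F r, 0 < r /\ differentiable F p /\
  (forall q, Cmod (q - p) < r -> ~ on_Rplus q -> F q = f q) /\ z = F p.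

(** The value at p is chosen among those of local extensions, and [agree_off_axis] makes it unique.
    Local extensions at different points therefore glue without any argument on overlaps. *)
Definition hol_ext (f : C -> C) (p : C) : C := epsilon (inhabits (RtoC 0)) (local_extension f p).

Lemma hol_ext_eq (f F : C -> C) (p : C) (r : R) : 0 < r -> differentiable F p ->
  (forall q, Cmod (q - p) < r -> ~ on_Rplus q -> F q = f q) -> hol_ext f p = F p.
Proof.
intros hr hF h.
assert (hex : exists z, local_extension f p z) by (exists (F p), F, r; auto).
destruct (epsilon_spec (inhabits (RtoC 0)) _ hex) as [G [r' [hr' [hG [h' e]]]]].
change (hol_ext f p = G p) in e. rewrite e.
apply agree_off_axis with (Rmin r r'); auto; [apply Rmin_pos; auto|].
intros q hq hi.
assert (hoff : ~ on_Rplus q) by (intros [h0 _]; auto).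
rewrite h', h; auto.
- exact (lt_Rmin_l hq).
- exact (lt_Rmin_r hq).
Qed.

Lemma hol_ext_off (f : C -> C) (p : C) : (forall q, ~ on_Rplus q -> differentiable f q) -> ~ on_Rplus p ->
  hol_ext f p = f p /\ differentiable (hol_ext f) p.
Proof.
intros hf hp.
assert (key : forall q, ~ on_Rplus q -> hol_ext f q = f q).
{ intros q hq. apply hol_ext_eq with 1; auto. lra. }
split; auto.
destruct (hf p hp) as [l hl]. destruct (off_Rplus_open p hp) as [r [hr h]].
exists l. apply cderiv_ext_loc with (r := r) (3 := hl); auto. intros q hq. symmetry; auto.
Qed.

Lemma ball_open (x q : C) (r : R) : Cmod (q - x) < r ->
  exists r', 0 < r' /\ forall z, Cmod (z - q) < r' -> Cmod (z - x) < r.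
Proof.
intros h. exists (r - Cmod (q - x)). split; [lra|]. intros z hz.
eapply Rle_lt_trans; [apply (Cmod_dist_tri z q x)|lra].
Qed.

Lemma hol_ext_extends (f : C -> C) (x : R) : extends_holomorphically_at f x ->
  exists r, 0 < r /\ forall q, Cmod (q - RtoC x) < r -> differentiable (hol_ext f) q.
Proof.
intros [F [[r1 [hr1 hF]] [r2 [hr2 he]]]].
exists (Rmin r1 r2). split; [apply Rmin_pos; auto|].
assert (hb : forall q, Cmod (q - RtoC x) < Rmin r1 r2 -> hol_ext f q = F q).
{ intros q hq. assert (h1 := lt_Rmin_l hq). assert (h2 := lt_Rmin_r hq).
  destruct (ball_open (RtoC x) q r2 h2) as [r' [hr' h]].
  apply hol_ext_eq with r'; auto. apply holomorphic_at_iff; auto. }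
intros q hq. destruct (ball_open (RtoC x) q _ hq) as [r' [hr' h]].
assert (h1 := hF q (lt_Rmin_l hq)). apply holomorphic_at_iff in h1. destruct h1 as [l hl].
exists l. apply cderiv_ext_loc with (r := r') (3 := hl); auto. intros z hz. symmetry; auto.
Qed.

Lemma hol_ext_ball (f : C -> C) (x r : R) : (forall q, ~ on_Rplus q -> differentiable f q) ->
  (forall y, 0 <= y -> Rabs (y - x) < r -> extends_holomorphically_at f y) ->
  forall q, Cmod (q - RtoC x) < r -> differentiable (hol_ext f) q.
Proof.
intros hf hx q hq. destruct (classic (on_Rplus q)) as [[hq1 hq2]|hq'].
- assert (e : q = RtoC (Re q)) by (apply C_eq_parts; auto).
  destruct (hol_ext_extends f (Re q)) as [r' [hr' h]].
  + apply hx; auto. rewrite e, <- RtoC_minus, Cmod_R in hq. exact hq.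
  + apply h. rewrite <- e. rewrite Cmod_diag; auto.
- apply hol_ext_off; auto.
Qed.

Lemma log_domain_base (H : C -> Prop) (rho : R -> R) (X k : R) : log_domain H rho X k -> H (RtoC (X - 1)).
Proof.
intros hH. apply (ld_in _ _ _ _ hH). simpl. rewrite Rabs_R0.
assert (h := ld_log _ _ _ _ hH 1 0 ltac:(lra) ltac:(lra)). rewrite ln_1 in h. lra.
Qed.

(** Not being in the support gives an extension for some base point w1. Both w0 and w1 are compared
    with the real base point X - 1, and the difference of the transforms is entire. *)
Lemma extends_of_not_support (H : C -> Prop) (rho : R -> R) (X k : R) (g : C -> C) (M : R) (w0 : C) (x : R) :
  log_domain H rho X k -> E0_bound H g M -> H w0 -> 0 <= x -> ~ laplace_support H g x ->
  extends_holomorphically_at (laplace H g w0) x.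
Proof.
intros hH hg hw0 hx hs.
assert (he : exists w1, H w1 /\ extends_holomorphically_at (laplace H g w1) x).
{ apply NNPP. intros hno. apply hs. split; auto. intros w1 hw1 hext. apply hno. eauto. }
destruct he as [w1 [hw1 [F [[r1 [hr1 hF]] [r2 [hr2 he]]]]]].
assert (ha := log_domain_left _ _ _ _ _ hH (log_domain_base H rho X k hH)).
assert (hc0 := log_domain_left _ _ _ _ _ hH hw0). assert (hc1 := log_domain_left _ _ _ _ _ hH hw1).
destruct (base_change_entire H rho X k g M w0 (X - 1) hH hg hc0 ha) as [b0 _].
destruct (base_change_entire H rho X k g M w1 (X - 1) hH hg hc1 ha) as [b1 _].
exists (fun p => F p + (base_change g w0 (X - 1) p - base_change g w1 (X - 1) p))%C. split.
- exists r1; split; auto. intros q hq. apply holomorphic_at_iff.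
  apply differentiable_plus; [|apply differentiable_minus]; apply holomorphic_at_iff; auto.
- exists r2; split; auto. intros p hp hoff. rewrite he by auto.
  rewrite (laplace_base_change H rho X k g M w0 (X - 1) p), (laplace_base_change H rho X k g M w1 (X - 1) p); auto.
  ring.
Qed.

Definition regular_near (H : C -> Prop) (g : C -> C) (x r : R) : Prop :=
  forall y, Rabs (y - x) < r -> ~ laplace_support H g y.

Lemma regular_hol_ext (H : C -> Prop) (rho : R -> R) (X k : R) (g : C -> C) (M : R) (w0 : C) (x r : R) :
  log_domain H rho X k -> E0_bound H g M -> H w0 -> regular_near H g x r ->
  forall q, Cmod (q - RtoC x) < r -> differentiable (hol_ext (laplace H g w0)) q.
Proof.
intros hH hg hw0 hr. apply hol_ext_ball.
- intros q hq. apply laplace_differentiable with rho X k M; auto. eapply log_domain_left; eauto.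
- intros y hy hyx. apply extends_of_not_support with rho X k M; auto.
Qed.

Lemma hol_ext_laplace_off (H : C -> Prop) (rho : R -> R) (X k : R) (g : C -> C) (M : R) (w0 p : C) :
  log_domain H rho X k -> E0_bound H g M -> H w0 -> ~ on_Rplus p ->
  hol_ext (laplace H g w0) p = laplace H g w0 p /\ differentiable (hol_ext (laplace H g w0)) p.
Proof.
intros hH hg hw0 hp. apply hol_ext_off; auto.
intros q hq. apply laplace_differentiable with rho X k M; auto. eapply log_domain_left; eauto.
Qed.

Lemma support_limit (H : C -> Prop) (rho : R -> R) (X k : R) (gn : nat -> C -> C) (g : C -> C)
  (Mn : nat -> R) (M : R) (x r : R) (N0 : nat) :
  log_domain H rho X k -> (forall n, E0_bound H (gn n) (Mn n)) -> E0_bound H g M ->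
  uniform_cv_on (closure H) gn g -> 0 < r -> (forall n, (N0 <= n)%nat -> regular_near H (gn n) x r) ->
  ~ laplace_support H g x.
Proof.
intros hH hgn hg hcv hr hreg [_ hsup].
set (a := RtoC (X - 1)).
assert (ha : H a) by apply (log_domain_base H rho X k hH).
assert (hac := log_domain_left _ _ _ _ _ hH ha).
set (P := Rabs x + r).
assert (hP : 0 < P) by (unfold P; assert (h := Rabs_pos x); lra).
destruct (laplace_axis_bound H rho X k P hH hP) as [K [N [hK hbd]]].
assert (hball : forall p, Cmod (p - RtoC x) < r -> Cmod p <= P).
{ intros p hp. assert (h := Cmod_rev_tri p (RtoC x)). rewrite Cmod_R in h. unfold P. lra. }
set (Fn := fun n => hol_ext (laplace H (gn n) a)).
assert (hoff : forall p, Im p <> 0 -> ~ on_Rplus p) by (intros p hp [h _]; auto).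
assert (hFn : forall n p, (N0 <= n)%nat -> Cmod (p - RtoC x) < r -> differentiable (Fn n) p).
{ intros n p hn hp. apply regular_hol_ext with rho X k (Mn n) x r; auto. }
assert (hcauchy : forall eps, 0 < eps -> exists N1, forall n m, (N1 <= n)%nat -> (N1 <= m)%nat ->
  forall w, closure H w -> Cmod (gn n w - gn m w) <= eps).
{ intros eps he. destruct (hcv (eps / 2)) as [N1 hN1]; [lra|]. exists N1. intros n m hn hm w hw.
  eapply Rle_trans; [apply (Cmod_dist_tri _ (g w))|]. rewrite (Cmod_minus_sym (g w)).
  assert (h1 := hN1 n hn w hw). assert (h2 := hN1 m hm w hw). lra. }
set (K' := K * (8 / r) ^ S N).
assert (hK' : 0 <= K').
{ apply Rmult_le_pos; auto. apply pow_le. apply Rlt_le, Rdiv_lt_0_compat; lra. }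
assert (hFc : forall eps, 0 < eps -> exists N1, forall n m, (N1 <= n)%nat -> (N1 <= m)%nat ->
  forall p, Cmod (p - RtoC x) < r / 2 -> Cmod (Fn n p - Fn m p) <= eps).
{ intros eps he. destruct (hcauchy (eps / (K' + 1))) as [N1 hN1]; [apply Rdiv_lt_0_compat; lra|].
  exists (max N0 N1). intros n m hn hm p hp.
  assert (hnm : E0_bound H (fun w => gn n w - gn m w)%C (eps / (K' + 1))).
  { apply E0_bound_minus with (Mn n) (Mn m); auto. apply hN1; lia. }
  apply Rle_trans with (K * (eps / (K' + 1)) * (8 / r) ^ S N).
  - apply real_axis_bound with (f := fun p => (Fn n p - Fn m p)%C) (b := x); auto.
    + intros z hz. apply differentiable_minus; apply hFn; auto; lia.
    (* On the axis the weight |Im z|^(S N) vanishes, its exponent being positive; off the axis the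
       extensions are the transforms themselves. *)
    + intros z hz. destruct (Req_dec (Im z) 0) as [e|e].
      * rewrite e, Rabs_R0. simpl. rewrite Rmult_0_l, Rmult_0_r.
        apply Rmult_le_pos; auto. left; apply Rdiv_lt_0_compat; lra.
      * unfold Fn. rewrite (proj1 (hol_ext_laplace_off H rho X k _ _ a z hH (hgn n) ha (hoff z e))),
          (proj1 (hol_ext_laplace_off H rho X k _ _ a z hH (hgn m) ha (hoff z e))).
        rewrite <- (laplace_minus H rho X k (gn n) (gn m) (Mn n) (Mn m)); auto.
  - replace (K * (eps / (K' + 1)) * (8 / r) ^ S N) with (K' * (eps / (K' + 1))) by (unfold K'; ring).
    apply Rle_trans with ((K' + 1) * (eps / (K' + 1))); [|right; field; lra].
    apply Rmult_le_compat_r; [|lra]. left; apply Rdiv_lt_0_compat; lra. }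
assert (hlim : forall p, exists l, Cmod (p - RtoC x) < r / 2 ->
  forall eps, 0 < eps -> exists N1, forall n, (N1 <= n)%nat -> Cmod (Fn n p - l) <= eps).
{ intros p. destruct (Rlt_dec (Cmod (p - RtoC x)) (r / 2)) as [hp|hp].
  - destruct (C_complete (fun n => Fn n p)) as [l hl].
    + intros eps he. destruct (hFc eps he) as [N1 hN1]. exists N1. intros n m hn hm. apply hN1; auto.
    + exists l. auto.
  - exists 0. tauto. }
apply choice in hlim. destruct hlim as [F hF].
assert (hdiff : forall p, Cmod (p - RtoC x) < r / 2 -> differentiable F p).
{ intros p hp. destruct (ball_open (RtoC x) p (r / 2) hp) as [r' [hr' hb]].
  (* Only from the index N0 on is [Fn n] known to be holomorphic on the disc. *)
  apply uniform_limit_differentiable with (fun n => Fn (n + N0)%nat) r'; auto.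
  - intros n q hq. apply hFn; [lia|]. specialize (hb q hq). lra.
  - intros eps he. destruct (hFc (eps / 2)) as [N1 hN1]; [lra|]. exists N1. intros n hn q hq.
    destruct (hF q (hb q hq) (eps / 2)) as [N2 hN2]; [lra|].
    assert (h1 := hN1 (n + N0)%nat (max N1 N2) ltac:(lia) ltac:(lia) q (hb q hq)).
    assert (h2 := hN2 (max N1 N2) ltac:(lia)).
    eapply Rle_trans; [apply (Cmod_dist_tri _ (Fn (max N1 N2) q))|]. lra. }
(* At a fixed height the bound near the axis, applied to gn - g, gives pointwise convergence of the
   transforms and identifies the limit. *)
assert (hval : forall p, Cmod (p - RtoC x) < r / 2 -> Im p <> 0 -> F p = laplace H g a p).
{ intros p hp hi. apply Cmod_le_eps_eq. intros eps he.
  assert (hie : 0 < Rabs (Im p) ^ S N) by (apply pow_lt, Rabs_pos_lt; auto).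
  set (e1 := eps / 2 * Rabs (Im p) ^ S N / (K + 1)).
  assert (he1 : 0 < e1).
  { apply Rdiv_lt_0_compat; [apply Rmult_lt_0_compat; lra|lra]. }
  destruct (hcv e1 he1) as [N1 hN1].
  destruct (hF p hp (eps / 2)) as [N2 hN2]; [lra|].
  set (n := max N1 N2).
  assert (hnb : E0_bound H (fun w => gn n w - g w)%C e1).
  { apply E0_bound_minus with (Mn n) M; auto. apply hN1; unfold n; lia. }
  assert (h1 := hbd _ _ p hnb (hball p ltac:(lra)) hi).
  rewrite (laplace_minus H rho X k (gn n) g (Mn n) M) in h1; auto.
  assert (h2 := hN2 n ltac:(unfold n; lia)).
  unfold Fn in h2. rewrite (proj1 (hol_ext_laplace_off H rho X k _ _ a p hH (hgn n) ha (hoff p hi))) in h2.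
  assert (h3 : Cmod (laplace H (gn n) a p - laplace H g a p) <= eps / 2).
  { apply Rmult_le_reg_r with (Rabs (Im p) ^ S N); auto. eapply Rle_trans; [exact h1|].
    apply Rle_trans with ((K + 1) * e1); [apply Rmult_le_compat_r; lra|].
    right. unfold e1. field. lra. }
  eapply Rle_trans; [apply (Cmod_dist_tri _ (laplace H (gn n) a p))|].
  rewrite (Cmod_minus_sym (F p)). lra. }
apply (hsup a ha). exists F. split.
- exists (r / 2). split; [lra|]. intros q hq. apply holomorphic_at_iff; auto.
- exists (r / 2). split; [lra|]. intros p hp hp'.
  (* A point off R^+ may still be a negative real, where the agreement follows by continuity. *)
  destruct (ball_open (RtoC x) p (r / 2) hp) as [r' [hr' hb]].
  apply agree_off_axis with r'; auto.
  apply laplace_differentiable with rho X k M; auto.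
Qed.

Lemma regular_near_minus (H : C -> Prop) (rho : R -> R) (X k : R) (g1 g2 : C -> C) (M1 M2 x r : R) :
  log_domain H rho X k -> E0_bound H g1 M1 -> E0_bound H g2 M2 -> regular_near H g1 x r -> regular_near H g2 x r ->
  regular_near H (fun w => g1 w - g2 w)%C x r.
Proof.
intros hH hg1 hg2 h1 h2 y hy [hy0 hs].
assert (ha := log_domain_base H rho X k hH).
destruct (extends_of_not_support H rho X k g1 M1 _ y hH hg1 ha hy0 (h1 y hy)) as [F1 [[s1 [hs1 d1]] [r1 [hr1 e1]]]].
destruct (extends_of_not_support H rho X k g2 M2 _ y hH hg2 ha hy0 (h2 y hy)) as [F2 [[s2 [hs2 d2]] [r2 [hr2 e2]]]].
apply (hs _ ha). exists (fun p => F1 p - F2 p)%C. split.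
- exists (Rmin s1 s2). split; [apply Rmin_pos; auto|]. intros q hq. apply holomorphic_at_iff.
  apply differentiable_minus; apply holomorphic_at_iff; [apply d1|apply d2]; eapply Rlt_le_trans; try apply hq;
  [apply Rmin_l|apply Rmin_r].
- exists (Rmin r1 r2). split; [apply Rmin_pos; auto|]. intros p hp hoff.
  rewrite e1, e2, (laplace_minus H rho X k g1 g2 M1 M2); auto.
  + eapply log_domain_left; eauto.
  + exact (lt_Rmin_r hp).
  + exact (lt_Rmin_l hp).
Qed.

(** * Loops around a real segment *)

Definition sgn (s : bool) : R := if s then 1 else -1.

(** Upper half-plane for [true], lower for [false], with discs added so that an arc of the loop is
    contained together with its real ends. *)
Definition half_nbhd (s : bool) (b1 b2 r : R) (z : C) : Prop :=
  0 < sgn s * Im z \/ Cmod (z - RtoC b1) < r \/ Cmod (z - RtoC b2) < r.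

Lemma ball_real_mono (x y t b r : R) : Cmod ((x, y) - RtoC b) < r -> Rabs t <= Rabs y -> Cmod ((x, t) - RtoC b) < r.
Proof.
intros h ht. eapply Rle_lt_trans; [|exact h]. unfold Cmod. apply sqrt_le_1_alt. simpl.
replace (t + - 0) with t by ring. replace (y + - 0) with y by ring.
assert (h2 := Rsqr_le_abs_1 t y ht). unfold Rsqr in h2. nra.
Qed.

(** The spine runs at distance r from the axis inside the half-plane. Where a tooth is outside the
    half-plane it is closer to the axis than its end, hence in the same disc. *)
Lemma half_nbhd_comb (s : bool) (b1 b2 r : R) : 0 < r -> comb 0 (sgn s * r) (half_nbhd s b1 b2 r).
Proof.
intros hr. split.
- intros w [h|[h|h]].
  + exists (sgn s * Im w). split; auto. intros z hz. left.
    assert (h1 := im_le_Cmod (z - w)%C). apply Rabs_le_between in h1.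
    replace (Im (z - w)%C) with (Im z - Im w) in h1 by reflexivity.
    destruct s; simpl in *; lra.
  + destruct (ball_open _ _ _ h) as [r' [hr' hb]]. exists r'; split; auto.
    intros z hz. right; left; auto.
  + destruct (ball_open _ _ _ h) as [r' [hr' hb]]. exists r'; split; auto.
    intros z hz. right; right; auto.
- intros x y h. split.
  + intros t ht.
    destruct (Rlt_dec 0 (sgn s * t)) as [h1|h1]; [left; exact h1|].
    assert (hty : Rabs t <= Rabs y /\ ~ 0 < sgn s * y).
    { destruct s; simpl in *; revert ht; unfold seg, Rmin, Rmax; destruct Rle_dec; intros ht; split; try lra;
      unfold Rabs; repeat destruct Rcase_abs; lra. }
    destruct hty as [hty hy].
    destruct h as [h|[h|h]]; [tauto| |]; right; [left|right]; apply ball_real_mono with y; auto.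
  + intros t _. left. simpl. destruct s; simpl; lra.
Qed.

Lemma half_primitive (s : bool) (b1 b2 r : R) (f : C -> C) : 0 < r ->
  (forall z, half_nbhd s b1 b2 r z -> differentiable f z) ->
  exists G, forall z, half_nbhd s b1 b2 r z -> cderiv G z (f z).
Proof. intros hr. apply (comb_primitive 0 (sgn s * r)). apply half_nbhd_comb; auto. Qed.

Lemma same_sign (gam : R -> C) (a b : R) : rcont (seg a b) gam -> (forall t, seg a b t -> Im (gam t) <> 0) ->
  0 < Im (gam a) * Im (gam b).
Proof.
assert (key : forall a b, a <= b -> rcont (seg a b) gam -> (forall t, seg a b t -> Im (gam t) <> 0) ->
  0 < Im (gam a) * Im (gam b)).
{ clear a b. intros a b hab hc hn.
  set (u := fun t => Im (gam (clamp a b t))).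
  assert (hu : Ranalysis1.continuity u).
  { intros t. apply continuity_pt_filterlim. apply (rcont_clamp a b gam t hab hc). }
  assert (ha : Im (gam a) <> 0) by (apply hn, seg_l). assert (hb : Im (gam b) <> 0) by (apply hn, seg_r).
  apply Rnot_le_lt. intros hle.
  destruct (IVT_gen u a b 0 hu) as [t [ht e]].
  - unfold u. rewrite !clamp_id by lra. unfold Rmin, Rmax; destruct Rle_dec; nra.
  - rewrite Rmin_left, Rmax_right in ht by lra. unfold u in e. rewrite clamp_id in e by auto.
    apply (hn t); auto. apply seg_le; auto. }
intros hc hn. destruct (Rle_dec a b) as [h|h]; [auto|].
rewrite Rmult_comm. apply key; [lra| |].
- apply rcont_sub with (2 := hc). intros t; apply seg_sym.
- intros t ht. apply hn, seg_sym; auto.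
Qed.

Definition bool_of_sign (x : R) : bool := if Rlt_dec 0 x then true else false.

Lemma bool_of_sign_pos (x y : R) : 0 < x * y -> 0 < sgn (bool_of_sign x) * y.
Proof.
intros h. unfold bool_of_sign. destruct (Rlt_dec 0 x) as [hx|hx]; simpl; nra.
Qed.

Definition jump (P : bool -> C -> C) (b1 b2 : R) (s : bool) : C := (P s (RtoC b2) - P s (RtoC b1))%C.

(** The loop meets the axis at ta and tb only, so Im keeps a constant sign on each of the two arcs.
    These signs are obtained before f is given: the same s and s' hold for 1 / (p - x), which will
    determine them. *)
Lemma loop_arcs_aux (b1 b2 c1 c2 : R) (gam : R -> C) (ta tb : R) : piecewise_C1 gam -> gam 0 = gam 1 ->
  0 <= ta -> ta < tb -> tb < 1 -> gam ta = RtoC c1 -> gam tb = RtoC c2 ->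
  (c1 = b1 /\ c2 = b2) \/ (c1 = b2 /\ c2 = b1) ->
  (forall t, 0 <= t < 1 -> Im (gam t) = 0 -> t = ta \/ t = tb) ->
  exists s s', forall r f P, 0 < r -> (forall s z, half_nbhd s b1 b2 r z -> differentiable f z) ->
  (forall s z, half_nbhd s b1 b2 r z -> cderiv (P s) z (f z)) ->
  is_cint (fun t => f (gam t) * path_derive gam t)%C 0 1 (jump P c1 c2 s - jump P c1 c2 s')%C.
Proof.
intros hg hclose ha hab hb ga gb hc hz.
assert (hcont : forall u v, 0 <= u <= 1 -> 0 <= v <= 1 -> rcont (seg u v) gam).
{ intros u v hu hv. destruct hg as [hgc _]. apply continuous_on_rcont in hgc.
  apply rcont_sub with (2 := hgc). intros t [h1 h2].
  split; [apply Rle_trans with (2 := h1); apply Rmin_glb; lra|apply Rle_trans with (1 := h2); apply Rmax_lub; lra]. }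
set (m := (ta + tb) / 2). set (m' := (tb + 1) / 2).
assert (hm : ta < m < tb) by (unfold m; lra). assert (hm' : tb < m' < 1) by (unfold m'; lra).
set (s := bool_of_sign (Im (gam m))). set (s' := bool_of_sign (Im (gam m'))).
assert (hin : forall t, ta < t < tb -> 0 < sgn s * Im (gam t)).
{ intros t ht. apply bool_of_sign_pos, same_sign; [apply hcont; lra|].
  intros u [hu1 hu2] e.
  assert (hu : ta < u < tb).
  { split; [apply Rlt_le_trans with (2 := hu1); apply Rmin_glb_lt; lra|
      apply Rle_lt_trans with (1 := hu2); apply Rmax_lub_lt; lra]. }
  destruct (hz u ltac:(lra) e); lra. }
assert (hout1 : forall t, tb < t < 1 -> 0 < sgn s' * Im (gam t)).
{ intros t ht. apply bool_of_sign_pos, same_sign; [apply hcont; lra|].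
  intros u [hu1 hu2] e.
  assert (hu : tb < u < 1).
  { split; [apply Rlt_le_trans with (2 := hu1); apply Rmin_glb_lt; lra|
      apply Rle_lt_trans with (1 := hu2); apply Rmax_lub_lt; lra]. }
  destruct (hz u ltac:(lra) e); lra. }
(* The second arc passes through the base point gam 0 = gam 1, so its sign is carried from ]tb, 1[
   over to [0, ta[. *)
assert (hout2 : forall t, 0 <= t < ta -> 0 < sgn s' * Im (gam t)).
{ intros t ht.
  assert (e1 : 0 < sgn s' * Im (gam 0)).
  { rewrite hclose. apply bool_of_sign_pos, same_sign; [apply hcont; lra|].
    intros u hu e. rewrite seg_le in hu by lra.
    destruct (Req_dec u 1) as [h1|h1].
    - rewrite h1, <- hclose in e. destruct (hz 0 ltac:(lra) e); lra.
    - destruct (hz u ltac:(lra) e); lra. }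
  assert (e2 : 0 < Im (gam 0) * Im (gam t)).
  { apply same_sign; [apply hcont; lra|]. intros u hu e. rewrite seg_le in hu by lra.
    destruct (hz u ltac:(lra) e); lra. }
  destruct s'; simpl in *; nra. }
exists s, s'. intros r f P hr hf hP.
assert (hball : forall s, half_nbhd s b1 b2 r (RtoC c1) /\ half_nbhd s b1 b2 r (RtoC c2)).
{ intros s0. assert (e0 : forall x : R, Cmod (RtoC x - RtoC x) < r).
  { intros x. rewrite Cmod_diag; auto. }
  destruct hc as [[-> ->]|[-> ->]]; split; right; auto. }
assert (arc : forall s u v, 0 <= u <= v -> v <= 1 -> (forall t, u <= t <= v -> half_nbhd s b1 b2 r (gam t)) ->
  is_cint (fun t => f (gam t) * path_derive gam t)%C u v (P s (gam v) - P s (gam u))%C).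
{ intros s0 u v huv hv1 hh. apply path_int_primitive; auto.
  apply rcont_comp with (E := half_nbhd s0 b1 b2 r).
  - apply hcont; lra.
  - apply differentiable_ccont. apply hf.
  - intros t ht. rewrite seg_le in ht by lra. auto. }
assert (a1 := arc s' 0 ta ltac:(lra) ltac:(lra)). assert (a2 := arc s ta tb ltac:(lra) ltac:(lra)).
assert (a3 := arc s' tb 1 ltac:(lra) ltac:(lra)).
rewrite ga in a1. rewrite ga, gb in a2. rewrite gb in a3. rewrite <- hclose in a3.
assert (h01 : half_nbhd s' b1 b2 r (gam 0)).
{ destruct (Req_dec ta 0) as [e|e]; [rewrite <- e, ga; apply hball|left; apply hout2; lra]. }
replace (jump P c1 c2 s - jump P c1 c2 s')%C with
  ((P s' (RtoC c1) - P s' (gam 0)) + (P s (RtoC c2) - P s (RtoC c1)) + (P s' (gam 0) - P s' (RtoC c2)))%C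
  by (unfold jump; ring).
apply is_cint_chasles with tb; [apply is_cint_chasles with ta|].
- apply a1. intros t ht. destruct (Req_dec t ta) as [e|e]; [rewrite e, ga; apply hball|left; apply hout2; lra].
- apply a2. intros t ht. destruct (Req_dec t ta) as [e|e]; [rewrite e, ga; apply hball|].
  destruct (Req_dec t tb) as [e'|e']; [rewrite e', gb; apply hball|left; apply hin; lra].
- apply a3. intros t ht. destruct (Req_dec t tb) as [e|e]; [rewrite e, gb; apply hball|].
  destruct (Req_dec t 1) as [e'|e']; [rewrite e', <- hclose; auto|left; apply hout1; lra].
Qed.

Lemma loop_arcs (b1 b2 : R) (gam : R -> C) : b1 < b2 -> simple_loop_around b1 b2 gam ->
  exists s s', forall r f P, 0 < r -> (forall s z, half_nbhd s b1 b2 r z -> differentiable f z) ->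
  (forall s z, half_nbhd s b1 b2 r z -> cderiv (P s) z (f z)) ->
  path_int f gam = (jump P b1 b2 s - jump P b1 b2 s')%C.
Proof.
intros hb [hg [hclose [hinj [hreal _]]]].
assert (hex : forall x, x = b1 \/ x = b2 -> exists t, 0 <= t < 1 /\ gam t = RtoC x).
{ intros x hx. destruct (proj2 (hreal x) hx) as [t [ht e]].
  (* The parameter 1 is replaced by 0, as injectivity is assumed on [0, 1[. *)
  destruct (Req_dec t 1) as [e1|e1].
  - exists 0. split; [lra|]. rewrite hclose, <- e1. auto.
  - exists t. split; [lra|auto]. }
destruct (hex b1 (or_introl eq_refl)) as [t1 [ht1 e1]]. destruct (hex b2 (or_intror eq_refl)) as [t2 [ht2 e2]].
assert (hz : forall t, 0 <= t < 1 -> Im (gam t) = 0 -> t = t1 \/ t = t2).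
{ intros t ht e.
  assert (e0 : gam t = RtoC (Re (gam t))) by (apply C_eq_parts; auto).
  destruct (proj1 (hreal (Re (gam t)))) as [h|h].
  - exists t. split; [lra|auto].
  - left. apply hinj; auto. rewrite e0, h; auto.
  - right. apply hinj; auto. rewrite e0, h; auto. }
assert (hne : t1 <> t2).
{ intros h. rewrite h, e2 in e1. apply (f_equal Re) in e1. simpl in e1. lra. }
destruct (Rlt_dec t1 t2) as [h|h].
- destruct (loop_arcs_aux b1 b2 b1 b2 gam t1 t2) as [s [s' hs]]; auto; try lra.
  exists s, s'. intros r f P hr hf hP. refine (is_cint_cint _ _ _ _ _). eapply hs; eauto.
- destruct (loop_arcs_aux b1 b2 b2 b1 gam t2 t1) as [s [s' hs]]; auto; try lra.
  { intros t ht e. destruct (hz t ht e); auto. }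
  exists s', s. intros r f P hr hf hP. refine (is_cint_cint _ _ _ _ _).
  replace (jump P b1 b2 s' - jump P b1 b2 s)%C with (jump P b2 b1 s - jump P b2 b1 s')%C by (unfold jump; ring).
  eapply hs; eauto.
Qed.

Lemma is_cint_real_Im (f : R -> C) (a b : R) (l : C) : (forall t, Rmin a b < t < Rmax a b -> Im (f t) = 0) ->
  is_cint f a b l -> Im l = 0.
Proof.
intros hf h. apply is_cint_parts in h. destruct h as [_ h].
assert (h2 : is_RInt (fun _ => 0) a b (Im l)) by (eapply is_RInt_ext; [|exact h]; auto).
assert (h3 := is_RInt_const (V := R_NormedModule) a b 0).
apply (is_RInt_unique (V := R_CompleteNormedModule)) in h2.
apply (is_RInt_unique (V := R_CompleteNormedModule)) in h3.
rewrite h2 in h3. rewrite h3. unfold scal; simpl; unfold mult; simpl. ring.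
Qed.

(** The plane without the closed vertical half-line going up from x; the spine passes below the
    slit. *)
Lemma slit_comb (x : R) : comb x (-1) (fun z => Re z <> x \/ Im z < 0).
Proof.
split.
- intros w h. destruct (Req_dec (Re w) x) as [e|e].
  + assert (hw : Im w < 0) by tauto. exists (- Im w). split; [lra|]. intros z hz. right.
    assert (h1 := im_le_Cmod (z - w)%C). apply Rabs_le_between in h1.
    replace (Im (z - w)%C) with (Im z - Im w) in h1 by reflexivity. lra.
  + exists (Rabs (Re w - x)). split; [apply Rabs_pos_lt; lra|]. intros z hz. left. intros ez.
    assert (h1 := re_le_Cmod (z - w)%C).
    replace (Re (z - w)%C) with (- (Re w - x)) in h1 by (rewrite <- ez; change (- (Re w - Re z) = Re z - Re w); ring).
    rewrite Rabs_Ropp in h1. lra.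
- intros y z h. simpl in *. split.
  + intros t ht. destruct h as [h|h]; [auto|right]. destruct ht as [_ ht].
    apply Rle_lt_trans with (1 := ht). apply Rmax_lub_lt; lra.
  + intros; right; lra.
Qed.

(* The argument of p - x increases by pi along the half-circle from 2 x - b2 to
   b2 in the lower half-plane, and is constant on the real axis left of x. *)
Lemma lower_log (b1 b2 x : R) : b1 < x < b2 -> exists P,
  (forall z, Re z <> x \/ Im z < 0 -> cderiv P z (/ (z - RtoC x))%C) /\ Im (P (RtoC b2) - P (RtoC b1))%C = PI.
Proof.
intros hx.
assert (hne : forall z, Re z <> x \/ Im z < 0 -> (z - RtoC x)%C <> 0).
{ intros z hz e. assert (e1 := f_equal Re e). assert (e2 := f_equal Im e). simpl in e1, e2.
  destruct z; simpl in *; lra. }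
assert (hdiff : forall z, Re z <> x \/ Im z < 0 -> differentiable (fun z => / (z - RtoC x))%C z).
{ intros z hz. eexists. apply (cderiv_comp (fun z => z - RtoC x)%C (fun z => / z)%C).
  - apply (cderiv_minus (fun z => z)); [apply cderiv_id|apply cderiv_const].
  - apply cderiv_inv; auto. }
destruct (comb_primitive x (-1) _ (fun z => / (z - RtoC x))%C (slit_comb x) hdiff) as [P hP].
exists P. split; auto.
set (R0 := b2 - x).
set (c := fun t => (RtoC x + - RtoC R0 * Cexp (RtoC t * (Ci * RtoC PI)))%C).
assert (hpi := PI_RGT_0).
assert (hc : forall t, c t = (x - R0 * cos (t * PI), - (R0 * sin (t * PI)))).
{ intros t. unfold c, Cexp. simpl.
  replace (t * (0 * PI - 1 * 0) - 0 * (0 * 0 + 1 * PI)) with 0 by ring.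
  replace (t * (0 * 0 + 1 * PI) + 0 * (0 * PI - 1 * 0)) with (t * PI) by ring.
  rewrite exp_0. apply C_eq_parts; simpl; ring. }
assert (hslit : forall t, 0 <= t <= 1 -> Re (c t) <> x \/ Im (c t) < 0).
{ intros t ht. rewrite hc. simpl. unfold R0.
  destruct (Req_dec t 0) as [e|e]; [left; rewrite e, Rmult_0_l, cos_0; lra|].
  destruct (Req_dec t 1) as [e'|e']; [left; rewrite e', Rmult_1_l, cos_PI; lra|].
  right. assert (0 < sin (t * PI)) by (apply sin_gt_0; nra). nra. }
assert (hcd : forall t, rderiv c t (- RtoC R0 * (Ci * RtoC PI * Cexp (RtoC t * (Ci * RtoC PI))))%C).
{ intros t. eapply rderiv_eq.
  - apply (rderiv_comp (fun z => RtoC x + - RtoC R0 * z)%C (fun t => Cexp (RtoC t * (Ci * RtoC PI))%C)).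
    + apply rderiv_Cexp_line.
    + apply cderiv_plus; [apply cderiv_const|apply cderiv_scal, cderiv_id].
  - ring. }
assert (e1 : (P (c 1) - P (c 0))%C = (Ci * RtoC PI)%C).
{ apply is_cint_unique with (fun _ => Ci * RtoC PI)%C 0 1.
  - assert (hd : forall t, 0 <= t <= 1 -> rderiv (fun t => P (c t)) t (Ci * RtoC PI)%C).
    { intros t ht. eapply rderiv_eq; [apply (rderiv_comp P c); [apply hcd|apply hP, hslit, ht]|].
      assert (hn : (c t - RtoC x)%C <> 0) by (apply hne, hslit, ht).
      replace (c t - RtoC x)%C with (- RtoC R0 * Cexp (RtoC t * (Ci * RtoC PI)))%C in * by (unfold c; ring).
      field. split.
      - intros e. apply hn. rewrite e. ring.
      - intros e. apply hn. rewrite e. ring. }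
    apply (FTC_C (fun t => P (c t))); [lra| |apply rcont_const|].
    + apply rderiv_rcont. intros t ht. rewrite seg_le in ht by lra. eexists; apply hd; auto.
    + intros t ht. apply hd; lra.
  - assert (h := is_cint_const (Ci * RtoC PI)%C 0 1).
    rewrite Rminus_0_r, Cmult_1_l in h. exact h. }
assert (c1 : c 1 = RtoC b2).
{ rewrite hc, Rmult_1_l, cos_PI, sin_PI. unfold R0. apply C_eq_parts; simpl; ring. }
assert (c0 : c 0 = RtoC (x - R0)).
{ rewrite hc, Rmult_0_l, cos_0, sin_0. apply C_eq_parts; simpl; ring. }
rewrite c1, c0 in e1.
(* Whatever their order, b1 and x - R0 are both left of x, so the real segment between them avoids
   the slit and the integrand is real on it. *)
assert (e2 : Im (P (RtoC (x - R0)) - P (RtoC b1))%C = 0).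
{ set (dl := (x - R0) - b1).
  set (l := fun t => (RtoC b1 + RtoC t * RtoC dl)%C).
  assert (hl : forall t, 0 <= t <= 1 -> Re (l t) <> x).
  { intros t ht. apply Rlt_not_eq. unfold l, dl, R0; simpl.
    assert (h1 : 0 <= t * (b2 - x)) by (apply Rmult_le_pos; lra).
    assert (h2 : 0 <= (1 - t) * (x - b1)) by (apply Rmult_le_pos; lra).
    destruct (Rle_dec t (1 / 2)); nra. }
  assert (hd : forall t, 0 <= t <= 1 -> rderiv (fun t => P (l t)) t (/ (l t - RtoC x) * RtoC dl)%C).
  { intros t ht. apply (rderiv_comp P l); [apply rderiv_line|apply hP; left; auto]. }
  replace (RtoC (x - R0)) with (l 1) by (unfold l, dl; apply C_eq_parts; simpl; ring).
  replace (RtoC b1) with (l 0) by (unfold l, dl; apply C_eq_parts; simpl; ring).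
  apply is_cint_real_Im with (fun t => / (l t - RtoC x) * RtoC dl)%C 0 1.
  - intros t ht. rewrite Rmin_left, Rmax_right in ht by lra.
    assert (hlt : (RtoC (b1 + t * dl - x)) = (l t - RtoC x)%C) by (unfold l; apply C_eq_parts; simpl; ring).
    rewrite <- hlt, <- RtoC_inv.
    2: { intros e0. apply (hl t ltac:(lra)). unfold l; simpl. lra. }
    rewrite <- RtoC_mult. reflexivity.
  - apply (FTC_C (fun t => P (l t))); [lra| | |].
    + apply rderiv_rcont. intros t ht. rewrite seg_le in ht by lra. eexists; apply hd; auto.
    + apply rcont_mult; [|apply rcont_const].
      apply (rcont_comp _ (fun z => Re z <> x \/ Im z < 0) l (fun z => / (z - RtoC x))%C).
      * apply rcont_line.
      * apply differentiable_ccont. auto.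
      * intros t ht. rewrite seg_le in ht by lra. auto.
    + intros t ht. apply hd; lra. }
replace (P (RtoC b2) - P (RtoC b1))%C with
  ((P (RtoC b2) - P (RtoC (x - R0))) + (P (RtoC (x - R0)) - P (RtoC b1)))%C by ring.
rewrite e1.
replace (Im (Ci * RtoC PI + (P (RtoC (x - R0)) - P (RtoC b1)))%C) with
  (Im (Ci * RtoC PI)%C + Im (P (RtoC (x - R0)) - P (RtoC b1))%C) by reflexivity.
rewrite e2. simpl. ring.
Qed.

Lemma cderiv_conj (f : C -> C) (p l : C) : cderiv f (Cconj p) l ->
  cderiv (fun z => Cconj (f (Cconj z))) p (Cconj l).
Proof.
intros h eps he. destruct (h eps he) as [d [hd h1]]. exists d; split; auto. intros q hq.
assert (e : forall z w : C, (Cconj z - Cconj w)%C = Cconj (z - w)) by (intros z w; destruct z, w; apply C_eq_parts; simpl; ring).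
rewrite e. specialize (h1 (Cconj q)). rewrite e, Cmod_conj in h1. specialize (h1 hq).
replace (Cconj l * (q - p))%C with (Cconj (l * Cconj (q - p))).
- rewrite e, Cmod_conj. exact h1.
- destruct l, q, p; apply C_eq_parts; simpl; ring.
Qed.

(* A determination of log (p - x) in the lower half-plane, and its conjugate in
   the upper half-plane. *)
Lemma half_logs (b1 b2 x r : R) : b1 < x < b2 -> r <= x - b1 -> r <= b2 - x -> exists P,
  (forall s z, half_nbhd s b1 b2 r z -> cderiv (P s) z (/ (z - RtoC x))%C) /\
  Im (jump P b1 b2 false) = PI /\ jump P b1 b2 true = Cconj (jump P b1 b2 false).
Proof.
intros hx hr1 hr2. destruct (lower_log b1 b2 x hx) as [P [hP hi]].
exists (fun (s : bool) => if s then fun z => Cconj (P (Cconj z)) else P).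
assert (hre : forall z s, half_nbhd s b1 b2 r z -> Re z <> x \/ 0 < sgn s * Im z).
{ intros z s [h|[h|h]]; auto; left; intros e.
  - assert (h1 := Cmod_ge_re (z - RtoC b1)%C).
    replace (Re (z - RtoC b1)%C) with (x - b1) in h1 by (rewrite <- e; reflexivity). lra.
  - assert (h1 := re_le_Cmod (z - RtoC b2)%C). apply Rabs_le_between in h1.
    replace (Re (z - RtoC b2)%C) with (x - b2) in h1 by (rewrite <- e; reflexivity). lra. }
split; [|split].
- intros s z hz. specialize (hre z s hz). destruct s; simpl in hre.
  + replace (/ (z - RtoC x))%C with (Cconj (/ (Cconj z - RtoC x))).
    * apply cderiv_conj, hP. destruct z; simpl in *. destruct hre; [auto|right; lra].
    * destruct z as [u v]. unfold Cinv. apply C_eq_parts; simpl;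
      replace ((- v + - 0) * ((- v + - 0) * 1)) with ((v + - 0) * ((v + - 0) * 1)) by ring; unfold Rdiv; ring.
  + apply hP. destruct hre; [auto|right; lra].
- exact hi.
- unfold jump.
  assert (e : forall y : R, Cconj (RtoC y) = RtoC y) by (intros; apply C_eq_parts; simpl; ring).
  rewrite !e. destruct (P (RtoC b2)), (P (RtoC b1)); apply C_eq_parts; simpl; ring.
Qed.

Lemma half_nbhd_avoids (b1 b2 x r : R) (s : bool) (z : C) : b1 < x < b2 -> r <= x - b1 -> r <= b2 - x ->
  half_nbhd s b1 b2 r z -> differentiable (fun z => / (z - RtoC x))%C z.
Proof.
intros hx h1 h2 hz.
assert (hne : (z - RtoC x)%C <> 0).
{ intros e. assert (ez : z = RtoC x) by (replace z with ((z - RtoC x) + RtoC x)%C by ring; rewrite e; ring).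
  rewrite ez in hz. destruct hz as [h|[h|h]].
  - simpl in h. lra.
  - rewrite <- RtoC_minus, Cmod_R, Rabs_pos_eq in h; lra.
  - rewrite <- RtoC_minus, Cmod_R, Rabs_left in h; lra. }
eexists. apply (cderiv_comp (fun z => z - RtoC x)%C (fun z => / z)%C).
- apply (cderiv_minus (fun z => z)); [apply cderiv_id|apply cderiv_const].
- apply cderiv_inv; auto.
Qed.

(* The winding number determines the orientation of the two arcs. *)
Lemma loop_int (b1 b2 : R) (gam : R -> C) (r : R) (f : C -> C) (P : bool -> C -> C) : b1 < b2 ->
  simple_loop_around b1 b2 gam -> 0 < r -> (forall s z, half_nbhd s b1 b2 r z -> differentiable f z) ->
  (forall s z, half_nbhd s b1 b2 r z -> cderiv (P s) z (f z)) ->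
  path_int f gam = (jump P b1 b2 false - jump P b1 b2 true)%C.
Proof.
intros hb hloop hr hf hP.
destruct (loop_arcs b1 b2 gam hb hloop) as [s [s' hs]].
rewrite (hs r f P hr hf hP).
set (x := (b1 + b2) / 2). set (r0 := (b2 - b1) / 2).
destruct (half_logs b1 b2 x r0) as [Q [hQ [hi hc]]]; try (unfold x, r0; lra).
assert (e := hs r0 (fun z => / (z - RtoC x))%C Q ltac:(unfold r0; lra)
  ltac:(intros s0 z hz; apply half_nbhd_avoids with b1 b2 r0 s0; auto; unfold x, r0; lra) hQ).
destruct hloop as [_ [_ [_ [_ hw]]]].
rewrite (hw x) in e by (unfold x; lra).
assert (hpi := PI_RGT_0).
apply (f_equal Im) in e.
replace (Im (jump Q b1 b2 s - jump Q b1 b2 s')%C) with (Im (jump Q b1 b2 s) - Im (jump Q b1 b2 s')) in e by reflexivity.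
assert (ht : Im (jump Q b1 b2 true) = - PI) by (rewrite hc; simpl; rewrite <- hi; reflexivity).
replace (Im (2 * Ci * RtoC PI)%C) with (2 * PI) in e by (simpl; ring).
(* The jumps have imaginary parts pi (lower) and - pi (upper): a difference of 2 pi leaves only s
   lower and s' upper. *)
destruct s, s'; try rewrite ht in e; try rewrite hi in e; try lra. reflexivity.
Qed.

(** The circle on the diameter [b1, b2]. The minus sign makes it start at b1 and go first through
    the lower half-plane to b2. *)
Definition std_loop (b1 b2 t : R) : C :=
  (RtoC ((b1 + b2) / 2) + - RtoC ((b2 - b1) / 2) * Cexp (RtoC t * (2 * Ci * RtoC PI)))%C.

Definition std_loop_derive (b1 b2 t : R) : C :=
  (- RtoC ((b2 - b1) / 2) * (2 * Ci * RtoC PI * Cexp (RtoC t * (2 * Ci * RtoC PI))))%C.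

Lemma std_loop_rderiv (b1 b2 t : R) : rderiv (std_loop b1 b2) t (std_loop_derive b1 b2 t).
Proof.
eapply rderiv_eq.
- apply (rderiv_comp (fun z => RtoC ((b1 + b2) / 2) + - RtoC ((b2 - b1) / 2) * z)%C
    (fun t => Cexp (RtoC t * (2 * Ci * RtoC PI))%C)).
  + apply rderiv_Cexp_line.
  + apply cderiv_plus; [apply cderiv_const|apply cderiv_scal, cderiv_id].
- unfold std_loop_derive. ring.
Qed.

Lemma std_loop_parts (b1 b2 t : R) : std_loop b1 b2 t =
  ((b1 + b2) / 2 - (b2 - b1) / 2 * cos (2 * PI * t), - ((b2 - b1) / 2 * sin (2 * PI * t))).
Proof.
unfold std_loop, Cexp. 
replace (Re (RtoC t * (2 * Ci * RtoC PI))%C) with 0 by (simpl; ring).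
replace (Im (RtoC t * (2 * Ci * RtoC PI))%C) with (2 * PI * t) by (simpl; ring).
rewrite exp_0. apply C_eq_parts; simpl; ring.
Qed.

Lemma std_loop_rcont (b1 b2 : R) (D : R -> Prop) : rcont D (std_loop b1 b2).
Proof. apply rderiv_rcont. intros t _. eexists; apply std_loop_rderiv. Qed.

Lemma std_loop_piecewise (b1 b2 : R) : piecewise_C1 (std_loop b1 b2).
Proof.
split.
- apply continuous_on_rcont, std_loop_rcont.
- exists 1%nat, INR, (fun _ => std_loop_derive b1 b2). split; [reflexivity|]. split; [reflexivity|].
  intros i hi. replace i with 0%nat by lia. simpl. split; [lra|]. split.
  + apply continuous_on_rcont. apply rcont_mult; [apply rcont_const|].
    apply rcont_mult; [apply rcont_const|]. apply rderiv_rcont. intros t _. eexists; apply rderiv_Cexp_line.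
  + intros t _. apply std_loop_rderiv.
Qed.

(** Computed directly rather than by [loop_int], since the winding number of the circle is itself
    derived from this formula. *)
Lemma std_loop_int (b1 b2 r : R) (f : C -> C) (P : bool -> C -> C) : b1 < b2 -> 0 < r ->
  (forall s z, half_nbhd s b1 b2 r z -> differentiable f z) ->
  (forall s z, half_nbhd s b1 b2 r z -> cderiv (P s) z (f z)) ->
  path_int f (std_loop b1 b2) = (jump P b1 b2 false - jump P b1 b2 true)%C.
Proof.
intros hb hr hf hP. assert (hpi := PI_RGT_0).
assert (e0 : std_loop b1 b2 0 = RtoC b1).
{ rewrite std_loop_parts, Rmult_0_r, cos_0, sin_0. apply C_eq_parts; simpl; field. }
assert (e1 : std_loop b1 b2 1 = RtoC b1).
{ rewrite std_loop_parts, Rmult_1_r, cos_2PI, sin_2PI. apply C_eq_parts; simpl; field. }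
assert (e2 : std_loop b1 b2 (1 / 2) = RtoC b2).
{ rewrite std_loop_parts. replace (2 * PI * (1 / 2)) with PI by field. rewrite cos_PI, sin_PI.
  apply C_eq_parts; simpl; field. }
assert (hb1 : forall s, half_nbhd s b1 b2 r (RtoC b1)).
{ intros s. right; left. rewrite Cmod_diag; auto. }
assert (hb2 : forall s, half_nbhd s b1 b2 r (RtoC b2)).
{ intros s. right; right. rewrite Cmod_diag; auto. }
assert (arc : forall s u v, 0 <= u <= v -> v <= 1 ->
  (forall t, u <= t <= v -> half_nbhd s b1 b2 r (std_loop b1 b2 t)) ->
  is_cint (fun t => f (std_loop b1 b2 t) * path_derive (std_loop b1 b2) t)%C u v
    (P s (std_loop b1 b2 v) - P s (std_loop b1 b2 u))%C).
{ intros s0 u v huv hv1 hh. apply path_int_primitive; auto using std_loop_piecewise.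
  apply rcont_comp with (E := half_nbhd s0 b1 b2 r).
  - apply std_loop_rcont.
  - apply differentiable_ccont. apply hf.
  - intros t ht. rewrite seg_le in ht by lra. auto. }
unfold path_int. refine (is_cint_cint _ _ _ _ _).
replace (jump P b1 b2 false - jump P b1 b2 true)%C with
  ((P false (std_loop b1 b2 (1 / 2)) - P false (std_loop b1 b2 0)) +
   (P true (std_loop b1 b2 1) - P true (std_loop b1 b2 (1 / 2))))%C
  by (rewrite e0, e1, e2; unfold jump; ring).
apply is_cint_chasles with (1 / 2); apply arc; try lra; intros t ht.
- destruct (Req_dec t 0) as [e|e]; [rewrite e, e0; auto|].
  destruct (Req_dec t (1 / 2)) as [e'|e']; [rewrite e', e2; auto|].
  left. rewrite std_loop_parts. simpl. assert (0 < sin (2 * PI * t)) by (apply sin_gt_0; nra). nra.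
- destruct (Req_dec t 1) as [e|e]; [rewrite e, e1; auto|].
  destruct (Req_dec t (1 / 2)) as [e'|e']; [rewrite e', e2; auto|].
  left. rewrite std_loop_parts. simpl. assert (sin (2 * PI * t) < 0) by (apply sin_lt_0; nra). nra.
Qed.

(** From 1 - cos x = 2 sin^2 (x / 2), with x / 2 strictly between - pi and pi; it gives the
    injectivity of the circle. *)
Lemma cos_1_small (x : R) : - (2 * PI) < x < 2 * PI -> cos x = 1 -> x = 0.
Proof.
intros hx hc. assert (hpi := PI_RGT_0).
assert (hs : sin (x / 2) = 0).
{ replace x with (2 * (x / 2)) in hc by field. rewrite cos_2a_sin in hc.
  assert (sin (x / 2) * sin (x / 2) = 0) by lra. nra. }
destruct (Rtotal_order x 0) as [h|[h|h]]; auto.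
- assert (h1 : 0 < sin (- (x / 2))) by (apply sin_gt_0; lra). rewrite sin_neg in h1. lra.
- assert (h1 : 0 < sin (x / 2)) by (apply sin_gt_0; lra). lra.
Qed.

Lemma std_loop_simple (b1 b2 : R) : b1 < b2 -> simple_loop_around b1 b2 (std_loop b1 b2).
Proof.
intros hb. assert (hpi := PI_RGT_0). split; [apply std_loop_piecewise|].
split; [|split; [|split]].
- rewrite !std_loop_parts, Rmult_0_r, Rmult_1_r, cos_2PI, sin_2PI, cos_0, sin_0. reflexivity.
- intros s t hs ht e. rewrite !std_loop_parts in e.
  assert (e1 := f_equal Re e). assert (e2 := f_equal Im e). simpl in e1, e2.
  assert (hcos : cos (2 * PI * s) = cos (2 * PI * t)).
  { apply Rmult_eq_reg_l with ((b2 - b1) / 2); lra. }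
  assert (hsin : sin (2 * PI * s) = sin (2 * PI * t)).
  { apply Rmult_eq_reg_l with ((b2 - b1) / 2); lra. }
  assert (h : 2 * PI * s - 2 * PI * t = 0).
  { apply cos_1_small; [nra|]. rewrite cos_minus, hcos, hsin.
    rewrite <- (sin2_cos2 (2 * PI * t)). unfold Rsqr. ring. }
  apply Rmult_eq_reg_l with (2 * PI); lra.
- intros x. split.
  + intros [t [ht e]]. rewrite std_loop_parts in e.
    assert (e1 := f_equal Re e). assert (e2 := f_equal Im e). simpl in e1, e2.
    assert (hs : sin (2 * PI * t) = 0).
    { apply Rmult_eq_reg_l with ((b2 - b1) / 2); lra. }
    destruct (sin_eq_O_2PI_0 (2 * PI * t)) as [h|[h|h]]; auto; try nra; rewrite h in e1.
    * rewrite cos_0 in e1. left; lra.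
    * rewrite cos_PI in e1. right; lra.
    * rewrite cos_2PI in e1. left; lra.
  + intros [-> | ->].
    * exists 0. split; [lra|]. rewrite std_loop_parts, Rmult_0_r, cos_0, sin_0. apply C_eq_parts; simpl; field.
    * exists (1 / 2). split; [lra|]. rewrite std_loop_parts. replace (2 * PI * (1 / 2)) with PI by field.
      rewrite cos_PI, sin_PI. apply C_eq_parts; simpl; field.
- intros x hx.
  set (r := Rmin (x - b1) (b2 - x)).
  assert (hr : 0 < r) by (apply Rmin_pos; lra).
  destruct (half_logs b1 b2 x r hx) as [Q [hQ [hi hc]]]; [apply Rmin_l|apply Rmin_r|].
  rewrite (std_loop_int b1 b2 r _ Q hb hr).
  + rewrite hc. destruct (jump Q b1 b2 false) as [u v]. simpl in hi. rewrite hi. apply C_eq_parts; simpl; ring.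
  + intros s z hz. apply half_nbhd_avoids with b1 b2 r s; auto; [apply Rmin_l|apply Rmin_r].
  + exact hQ.
Qed.

(** * Partial sums *)

Lemma Cexp_mult_differentiable (w p : C) : differentiable (fun p => Cexp (p * w)%C) p.
Proof.
destruct (Cexp_lin_differentiable (- w) p) as [l hl]. exists l.
apply cderiv_ext_loc with (r := 1) (3 := hl); [lra|]. intros q _. f_equal. ring.
Qed.

Lemma represents_differentiable (H : C -> Prop) (rho : R -> R) (X k : R) (g F : C -> C) (M b1 b2 : R) :
  log_domain H rho X k -> E0_bound H g M -> represents_laplace H g F ->
  holomorphic_near F (RtoC b1) -> holomorphic_near F (RtoC b2) ->
  exists r, 0 < r /\ forall s z, half_nbhd s b1 b2 r z -> differentiable F z.
Proof.
intros hH hg [w0 [E [hw0 [[hE _] hF]]]] [r1 [hr1 h1]] [r2 [hr2 h2]].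
exists (Rmin r1 r2). split; [apply Rmin_pos; auto|]. intros s z [hz|[hz|hz]].
- assert (hoff : ~ on_Rplus z) by (intros [h _]; rewrite h in hz; lra).
  destruct (off_Rplus_open z hoff) as [r [hr hb]].
  assert (hd : differentiable (fun p => laplace H g w0 p + E p)%C z).
  { apply differentiable_plus; [|apply holomorphic_at_iff; auto].
    apply laplace_differentiable with rho X k M; auto. eapply log_domain_left; eauto. }
  destruct hd as [l hl]. exists l. apply cderiv_ext_loc with (r := r) (3 := hl); auto.
  intros q hq. symmetry; auto.
- apply holomorphic_at_iff, h1. exact (lt_Rmin_l hz).
- apply holomorphic_at_iff, h2. exact (lt_Rmin_r hz).
Qed.

Lemma represents_difference (H : C -> Prop) (rho : R -> R) (X k : R) (g F F' : C -> C) (M : R) :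
  log_domain H rho X k -> E0_bound H g M -> represents_laplace H g F -> represents_laplace H g F' ->
  exists D, (forall p, differentiable D p) /\ forall p, Im p <> 0 -> F' p = (F p + D p)%C.
Proof.
intros hH hg [w0 [E [hw0 [[hE _] hF]]]] [w1 [E' [hw1 [[hE' _] hF']]]].
assert (ha := log_domain_left _ _ _ _ _ hH (log_domain_base H rho X k hH)).
assert (hc0 := log_domain_left _ _ _ _ _ hH hw0). assert (hc1 := log_domain_left _ _ _ _ _ hH hw1).
destruct (base_change_entire H rho X k g M w0 (X - 1) hH hg hc0 ha) as [b0 _].
destruct (base_change_entire H rho X k g M w1 (X - 1) hH hg hc1 ha) as [b1 _].
exists (fun p => (base_change g w1 (X - 1) p - base_change g w0 (X - 1) p) + (E' p - E p))%C. split.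
- intros p. apply differentiable_plus; apply differentiable_minus; apply holomorphic_at_iff; auto.
- intros p hp. assert (hoff : ~ on_Rplus p) by (intros [h _]; auto).
  rewrite hF, hF' by auto.
  rewrite (laplace_base_change H rho X k g M w0 (X - 1) p), (laplace_base_change H rho X k g M w1 (X - 1) p); auto.
  ring.
Qed.

Lemma half_nbhd_mono (s : bool) (b1 b2 r r' : R) (z : C) : r <= r' -> half_nbhd s b1 b2 r z -> half_nbhd s b1 b2 r' z.
Proof. intros h [h1|[h1|h1]]; unfold half_nbhd; [left|right; left|right; right]; lra. Qed.

(** Two representatives differ by an entire function D. A primitive of D e^(z w) on the whole plane
    has the same jump in both half-planes, so it cancels; and neither loop appears in the formula of
    [loop_int]. *)
Lemma is_partial_sum_unique (H : C -> Prop) (rho : R -> R) (X k : R) (g : C -> C) (M b1 b2 : R) (w z z' : C) :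
  log_domain H rho X k -> E0_bound H g M -> b1 < b2 ->
  is_partial_sum H g b1 b2 w z -> is_partial_sum H g b1 b2 w z' -> z = z'.
Proof.
intros hH hg hb [F [gam [hF [h1 [h2 [hl ->]]]]]] [F' [gam' [hF' [h1' [h2' [hl' ->]]]]]].
destruct (represents_differentiable H rho X k g F M b1 b2 hH hg hF h1 h2) as [r1 [hr1 hd1]].
destruct (represents_differentiable H rho X k g F' M b1 b2 hH hg hF' h1' h2') as [r2 [hr2 hd2]].
destruct (represents_difference H rho X k g F F' M hH hg hF hF') as [D [hD hDe]].
set (r := Rmin r1 r2).
assert (hr : 0 < r) by (apply Rmin_pos; auto).
assert (hdF : forall s z, half_nbhd s b1 b2 r z -> differentiable F z).
{ intros s z hz. apply (hd1 s). apply half_nbhd_mono with (2 := hz). apply Rmin_l. }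
assert (hdF' : forall s z, half_nbhd s b1 b2 r z -> differentiable F' z).
{ intros s z hz. apply (hd2 s). apply half_nbhd_mono with (2 := hz). apply Rmin_r. }
(* In the discs the relation extends to the axis by continuity; elsewhere on R^+ representatives are
   arbitrary. *)
assert (he : forall s z, half_nbhd s b1 b2 r z -> F' z = (F z + D z)%C).
{ intros s z hz. apply (agree_off_axis F' (fun z => F z + D z)%C z 1); auto.
  - eapply hdF'; eauto.
  - apply differentiable_plus; eauto.
  - lra. }
assert (hP : exists P, forall s z, half_nbhd s b1 b2 r z -> cderiv (P s) z (F z * Cexp (z * w))%C).
{ apply (choice (fun s G => forall z, half_nbhd s b1 b2 r z -> cderiv G z (F z * Cexp (z * w))%C)).
  intros s. apply half_primitive with (f := fun z => (F z * Cexp (z * w))%C); auto.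
  intros z hz. apply differentiable_mult; eauto. apply Cexp_mult_differentiable. }
destruct hP as [P hP].
(* The whole plane is a comb. *)
destruct (comb_primitive 0 0 (fun _ => True) (fun z => D z * Cexp (z * w))%C) as [Q hQ].
{ split; [intros u _; exists 1; split; [lra|auto]|auto]. }
{ intros z _. apply differentiable_mult; auto. apply Cexp_mult_differentiable. }
f_equal.
rewrite (loop_int b1 b2 gam r (fun p => F p * Cexp (p * w))%C P hb hl hr); auto.
2: { intros s z hz. apply differentiable_mult; eauto. apply Cexp_mult_differentiable. }
rewrite (loop_int b1 b2 gam' r (fun p => F' p * Cexp (p * w))%C (fun s z => P s z + Q z)%C hb hl' hr).
- unfold jump. ring.
- intros s z hz. apply differentiable_mult; eauto. apply Cexp_mult_differentiable.
- intros s z hz. apply cderiv_eq with (F z * Cexp (z * w) + D z * Cexp (z * w))%C.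
  + apply cderiv_plus; auto.
  + rewrite (he s z hz). ring.
Qed.

Lemma hol_ext_represents (H : C -> Prop) (rho : R -> R) (X k : R) (g : C -> C) (M : R) (w0 : C) :
  log_domain H rho X k -> E0_bound H g M -> H w0 -> represents_laplace H g (hol_ext (laplace H g w0)).
Proof.
intros hH hg hw0. exists w0, (fun _ => RtoC 0). split; auto. split.
- split.
  + intros p. apply holomorphic_at_iff. exists (RtoC 0). apply cderiv_const.
  + exists 0, 0. intros p. rewrite Cmod_0. lra.
- intros p hp. rewrite (proj1 (hol_ext_laplace_off H rho X k g M w0 p hH hg hw0 hp)). ring.
Qed.

Definition partial_sum_integral (F : C -> C) (b1 b2 : R) (w : C) : C :=
  (/ (2 * Ci * RtoC PI) * path_int (fun p => F p * Cexp (p * w)) (std_loop b1 b2))%C.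

Lemma partial_sum_value (H : C -> Prop) (rho : R -> R) (X k : R) (g F : C -> C) (M b1 b2 : R) (w : C) :
  log_domain H rho X k -> E0_bound H g M -> b1 < b2 -> represents_laplace H g F ->
  holomorphic_near F (RtoC b1) -> holomorphic_near F (RtoC b2) ->
  is_partial_sum H g b1 b2 w (partial_sum_integral F b1 b2 w) /\
  partial_sum H g b1 b2 w = partial_sum_integral F b1 b2 w.
Proof.
intros hH hg hb hF h1 h2.
assert (h : is_partial_sum H g b1 b2 w (partial_sum_integral F b1 b2 w)).
{ exists F, (std_loop b1 b2). repeat split; auto; apply std_loop_simple; auto. }
split; auto. apply (iota_unique (V := C_R_CompleteNormedModule)); auto.
intros y hy. apply is_partial_sum_unique with H rho X k g M b1 b2 w; auto.
Qed.

Lemma regular_holomorphic_near (H : C -> Prop) (rho : R -> R) (X k : R) (g : C -> C) (M : R) (w0 : C) (b r : R) :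
  log_domain H rho X k -> E0_bound H g M -> H w0 -> 0 < r -> regular_near H g b r ->
  holomorphic_near (hol_ext (laplace H g w0)) (RtoC b).
Proof.
intros hH hg hw0 hr hreg. exists r. split; auto. intros q hq. apply holomorphic_at_iff.
apply regular_hol_ext with rho X k M b r; auto.
Qed.

Lemma regular_well_defined (H : C -> Prop) (rho : R -> R) (X k : R) (g : C -> C) (M b1 b2 r : R) :
  log_domain H rho X k -> E0_bound H g M -> b1 < b2 -> 0 < r -> regular_near H g b1 r -> regular_near H g b2 r ->
  partial_sum_well_defined H g b1 b2.
Proof.
intros hH hg hb hr h1 h2.
assert (ha := log_domain_base H rho X k hH).
assert (h0 : forall b, Rabs (b - b) < r) by (intros b; rewrite Rminus_diag, Rabs_R0; auto).
split; auto. split; [apply h1, h0|]. split; [apply h2, h0|]. intros w.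
eexists. split.
- apply (partial_sum_value H rho X k g (hol_ext (laplace H g (RtoC (X - 1)))) M); auto.
  + apply hol_ext_represents with rho X k M; auto.
  + apply regular_holomorphic_near with rho X k M r; auto.
  + apply regular_holomorphic_near with rho X k M r; auto.
- intros y hy. apply is_partial_sum_unique with H rho X k g M b1 b2 w; auto.
  apply (partial_sum_value H rho X k g (hol_ext (laplace H g (RtoC (X - 1)))) M); auto.
  + apply hol_ext_represents with rho X k M; auto.
  + apply regular_holomorphic_near with rho X k M r; auto.
  + apply regular_holomorphic_near with rho X k M r; auto.
Qed.

Lemma std_loop_real (b1 b2 t : R) : b1 < b2 -> 0 <= t <= 1 -> Im (std_loop b1 b2 t) = 0 ->
  std_loop b1 b2 t = RtoC b1 \/ std_loop b1 b2 t = RtoC b2.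
Proof.
intros hb ht e. destruct (std_loop_simple b1 b2 hb) as [_ [_ [_ [hreal _]]]].
assert (e0 : std_loop b1 b2 t = RtoC (Re (std_loop b1 b2 t))) by (apply C_eq_parts; auto).
destruct (proj1 (hreal (Re (std_loop b1 b2 t)))) as [h|h].
- exists t; auto.
- left. rewrite e0, h. auto.
- right. rewrite e0, h. auto.
Qed.

Lemma std_loop_integrable (f : C -> C) (b1 b2 r : R) : b1 < b2 -> 0 < r ->
  (forall s z, half_nbhd s b1 b2 r z -> differentiable f z) ->
  is_cint (fun t => f (std_loop b1 b2 t) * path_derive (std_loop b1 b2) t)%C 0 1 (path_int f (std_loop b1 b2)).
Proof.
intros hb hr hf.
assert (hin : forall t, seg 0 1 t -> differentiable f (std_loop b1 b2 t)).
{ intros t ht. rewrite seg_le in ht by lra.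
  assert (h0 : forall x : R, Cmod (RtoC x - RtoC x) < r).
  { intros x. rewrite Cmod_diag; auto. }
  destruct (Req_dec (Im (std_loop b1 b2 t)) 0) as [e|e].
  - destruct (std_loop_real b1 b2 t hb ht e) as [h|h]; rewrite h; apply (hf true); right; auto.
  - destruct (Rlt_dec 0 (Im (std_loop b1 b2 t))) as [h|h].
    + apply (hf true). left. unfold sgn. lra.
    + apply (hf false). left. unfold sgn. lra. }
assert (hc : rcont (seg 0 1) (fun t => f (std_loop b1 b2 t))).
{ apply (rcont_comp _ (differentiable f) (std_loop b1 b2) f); auto using std_loop_rcont.
  apply differentiable_ccont. auto. }
destruct (piecewise_weight _ (std_loop_piecewise b1 b2)) as [B [_ hB]].
destruct (rcont_bounded 0 1 _ ltac:(lra) hc) as [m hm].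
destruct (hB _ m hc hm) as [J [hJ _]].
replace (path_int f (std_loop b1 b2)) with J; auto. symmetry. apply (is_cint_cint _ _ _ _ hJ).
Qed.

Lemma std_loop_speed (b1 b2 t : R) : b1 < b2 -> Cmod (path_derive (std_loop b1 b2) t) = PI * (b2 - b1).
Proof.
intros hb. assert (hpi := PI_RGT_0). rewrite (path_derive_eq _ _ _ (std_loop_rderiv b1 b2 t)). unfold std_loop_derive.
rewrite !Cmod_mult, Cmod_opp, Cmod_Cexp, Cmod_Ci, !Cmod_R, !Rabs_pos_eq by lra.
replace (Re (RtoC t * (2 * Ci * RtoC PI))%C) with 0 by (simpl; ring).
rewrite exp_0. field.
Qed.

Lemma partial_sum_integral_bound (F : C -> C) (b1 b2 r m : R) (w : C) : b1 < b2 -> 0 < r ->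
  (forall s z, half_nbhd s b1 b2 r z -> differentiable F z) ->
  (forall t, 0 <= t <= 1 -> Cmod (F (std_loop b1 b2 t) * Cexp (std_loop b1 b2 t * w)) <= m) ->
  Cmod (partial_sum_integral F b1 b2 w) <= (b2 - b1) * m.
Proof.
intros hb hr hF hm. assert (hpi := PI_RGT_0).
assert (hI : is_cint (fun t => F (std_loop b1 b2 t) * Cexp (std_loop b1 b2 t * w) * path_derive (std_loop b1 b2) t)%C
  0 1 (path_int (fun p => F p * Cexp (p * w))%C (std_loop b1 b2))).
{ apply (std_loop_integrable (fun p => F p * Cexp (p * w))%C b1 b2 r); auto.
  intros s z hz. apply differentiable_mult; eauto. apply Cexp_mult_differentiable. }
assert (hm0 : 0 <= m) by (eapply Rle_trans; [apply Cmod_ge_0|apply (hm 0); lra]).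
apply is_cint_bound_const with (m := m * (PI * (b2 - b1))) in hI.
- unfold partial_sum_integral. rewrite Cmod_mult.
  assert (h2 : (2 * Ci * RtoC PI)%C <> 0).
  { apply Cmod_gt_0. rewrite !Cmod_mult, Cmod_Ci, !Cmod_R, !Rabs_pos_eq; lra. }
  rewrite Cmod_inv by auto. rewrite !Cmod_mult, Cmod_Ci, !Cmod_R, !Rabs_pos_eq by lra.
  rewrite Rminus_0_r, Rabs_R1, Rmult_1_l in hI.
  apply Rle_trans with (/ (2 * 1 * PI) * (m * (PI * (b2 - b1)))).
  + apply Rmult_le_compat_l; [left; apply Rinv_0_lt_compat; lra|exact hI].
  (* The length pi (b2 - b1) divided by 2 pi gives half of the stated factor. *)
  + replace (/ (2 * 1 * PI) * (m * (PI * (b2 - b1)))) with ((b2 - b1) * m / 2) by (field; lra).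
    assert (0 <= (b2 - b1) * m) by (apply Rmult_le_pos; lra). lra.
- intros t ht. rewrite seg_le in ht by lra. rewrite Cmod_mult, std_loop_speed by auto.
  apply Rmult_le_compat_r; auto. apply Rmult_le_pos; lra.
Qed.

Lemma regular_half_differentiable (H : C -> Prop) (rho : R -> R) (X k : R) (g : C -> C) (M : R) (w0 : C) (b1 b2 r : R) :
  log_domain H rho X k -> E0_bound H g M -> H w0 -> regular_near H g b1 r -> regular_near H g b2 r ->
  forall s z, half_nbhd s b1 b2 r z -> differentiable (hol_ext (laplace H g w0)) z.
Proof.
intros hH hg hw0 h1 h2 s z [h|[h|h]].
- apply (hol_ext_laplace_off H rho X k g M w0 z); auto. intros [e _]. rewrite e in h. lra.
- apply regular_hol_ext with rho X k M b1 r; auto.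
- apply regular_hol_ext with rho X k M b2 r; auto.
Qed.

(** The difference of the two extensions is itself a representative for g1 - g2, holomorphic near
    the cutting points, and any representative computes the partial sum. *)
Lemma partial_sum_minus (H : C -> Prop) (rho : R -> R) (X k : R) (g1 g2 : C -> C) (M1 M2 : R) (b1 b2 r : R) (w : C) :
  log_domain H rho X k -> E0_bound H g1 M1 -> E0_bound H g2 M2 -> b1 < b2 -> 0 < r ->
  regular_near H g1 b1 r -> regular_near H g1 b2 r -> regular_near H g2 b1 r -> regular_near H g2 b2 r ->
  partial_sum H (fun w => g1 w - g2 w)%C b1 b2 w = (partial_sum H g1 b1 b2 w - partial_sum H g2 b1 b2 w)%C.
Proof.
intros hH hg1 hg2 hb hr h11 h12 h21 h22.
set (a := RtoC (X - 1)). assert (ha : H a) by apply (log_domain_base H rho X k hH).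
assert (hc := log_domain_left _ _ _ _ _ hH ha).
assert (hg : E0_bound H (fun w => g1 w - g2 w)%C (M1 + M2)).
{ apply E0_bound_minus with M1 M2; auto. intros u hu.
  eapply Rle_trans; [apply Cmod_minus_le|]. destruct hg1 as [_ [_ k1]], hg2 as [_ [_ k2]].
  specialize (k1 u hu). specialize (k2 u hu). lra. }
set (F1 := hol_ext (laplace H g1 a)). set (F2 := hol_ext (laplace H g2 a)).
assert (r1 : represents_laplace H g1 F1) by (apply hol_ext_represents with rho X k M1; auto).
assert (r2 : represents_laplace H g2 F2) by (apply hol_ext_represents with rho X k M2; auto).
assert (n1 : forall b, regular_near H g1 b r -> holomorphic_near F1 (RtoC b)).
{ intros b hb'. apply regular_holomorphic_near with rho X k M1 r; auto. }
assert (n2 : forall b, regular_near H g2 b r -> holomorphic_near F2 (RtoC b)).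
{ intros b hb'. apply regular_holomorphic_near with rho X k M2 r; auto. }
rewrite (proj2 (partial_sum_value H rho X k g1 F1 M1 b1 b2 w hH hg1 hb r1 (n1 _ h11) (n1 _ h12))).
rewrite (proj2 (partial_sum_value H rho X k g2 F2 M2 b1 b2 w hH hg2 hb r2 (n2 _ h21) (n2 _ h22))).
assert (d1 := regular_half_differentiable H rho X k g1 M1 a b1 b2 r hH hg1 ha h11 h12).
assert (d2 := regular_half_differentiable H rho X k g2 M2 a b1 b2 r hH hg2 ha h21 h22).
assert (hnear : forall b, b = b1 \/ b = b2 -> holomorphic_near (fun p => F1 p - F2 p)%C (RtoC b)).
{ intros b hb'. exists r. split; auto. intros q hq. apply holomorphic_at_iff.
  assert (hh : half_nbhd true b1 b2 r q) by (right; destruct hb' as [-> | ->]; auto).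
  apply differentiable_minus; [apply (d1 true)|apply (d2 true)]; auto. }
assert (r12 : represents_laplace H (fun w => g1 w - g2 w)%C (fun p => F1 p - F2 p)%C).
{ exists a, (fun _ => RtoC 0). split; auto. split.
  - split.
    + intros p. apply holomorphic_at_iff. exists (RtoC 0). apply cderiv_const.
    + exists 0, 0. intros p. rewrite Cmod_0. lra.
  - intros p hp. unfold F1, F2.
    rewrite (proj1 (hol_ext_laplace_off H rho X k g1 M1 a p hH hg1 ha hp)),
      (proj1 (hol_ext_laplace_off H rho X k g2 M2 a p hH hg2 ha hp)),
      (laplace_minus H rho X k g1 g2 M1 M2 a p); auto. ring. }
rewrite (proj2 (partial_sum_value H rho X k _ _ _ b1 b2 w hH hg hb r12 (hnear b1 (or_introl eq_refl))
  (hnear b2 (or_intror eq_refl)))).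
assert (i1 := std_loop_integrable (fun p => F1 p * Cexp (p * w))%C b1 b2 r hb hr
  ltac:(intros s z hz; apply differentiable_mult; [apply (d1 s z hz)|apply Cexp_mult_differentiable])).
assert (i2 := std_loop_integrable (fun p => F2 p * Cexp (p * w))%C b1 b2 r hb hr
  ltac:(intros s z hz; apply differentiable_mult; [apply (d2 s z hz)|apply Cexp_mult_differentiable])).
unfold partial_sum_integral.
replace (path_int (fun p => (F1 p - F2 p) * Cexp (p * w))%C (std_loop b1 b2)) with
  (path_int (fun p => F1 p * Cexp (p * w))%C (std_loop b1 b2) - path_int (fun p => F2 p * Cexp (p * w))%C (std_loop b1 b2))%C.
- ring.
- symmetry. unfold path_int at 1. apply is_cint_cint.
  eapply is_cint_ext; [|apply (is_cint_minus _ _ _ _ _ _ i1 i2)]. intros t _. simpl. ring.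
Qed.

(* Uses the convexity of the border, through [ld_shift]. *)
Lemma translate_in (H : C -> Prop) (rho : R -> R) (X k : R) (w u : C) : log_domain H rho X k -> shift_m1 H w ->
  closure H u -> H (u + (w + 1 - RtoC (rho 0)))%C.
Proof.
intros hH hw hu. unfold shift_m1 in hw. rewrite (ld_in _ _ _ _ hH) in hw. rewrite (ld_cl _ _ _ _ hH) in hu.
apply (ld_in _ _ _ _ hH). destruct w as [x y], u as [x' y']. simpl in *.
replace (y + 0) with y in hw by ring. replace (y' + (y + 0 + - 0)) with (y' + y) by ring.
assert (h1 := ld_shift _ _ _ _ hH (Rabs y') (Rabs y) (Rabs_pos _) (Rabs_pos _)).
assert (h2 : rho (Rabs y' + Rabs y) <= rho (Rabs (y' + y))).
{ apply (ld_decr _ _ _ _ hH). split; [apply Rabs_pos|apply Rabs_triang]. }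
lra.
Qed.

(* With tau = w + 1 - rho 0, the transform of g (. + tau) is exp (p tau) times
   that of [g], hence S g (w) is the value at the fixed point rho 0 - 1 of the
   partial sum of g (. + tau), whose bound does not depend on w. *)
Lemma partial_sum_bound (H : C -> Prop) (rho : R -> R) (X k b1 b2 r : R) : log_domain H rho X k -> b1 < b2 -> 0 < r ->
  exists K, 0 <= K /\ forall g M w, E0_bound H g M -> regular_near H g b1 r -> regular_near H g b2 r ->
  shift_m1 H w -> Cmod (partial_sum H g b1 b2 w) <= K * M.
Proof.
intros hH hb hr.
set (P := Rabs b1 + Rabs b2 + (b2 - b1) + r).
assert (hP : 0 < P) by (unfold P; assert (h1 := Rabs_pos b1); assert (h2 := Rabs_pos b2); lra).
destruct (laplace_axis_bound H rho X k P hH hP) as [K [N [hK hbd]]].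
set (R0 := (b2 - b1) / 2).
assert (hR0 : 0 < R0) by (unfold R0; lra).
(* The first term serves the points of the circle within r / 2 of b1 or b2, by [real_axis_bound];
   the second the remaining ones, where |Im p| >= r^2 / (8 R0). *)
set (B := (8 / r) ^ S N + (8 * R0 / (r * r)) ^ S N).
assert (hB1 : 0 <= (8 / r) ^ S N) by (apply pow_le; left; apply Rdiv_lt_0_compat; lra).
assert (hrr : 0 < r * r) by (apply Rmult_lt_0_compat; auto).
assert (hB2 : 0 <= (8 * R0 / (r * r)) ^ S N) by (apply pow_le; left; apply Rdiv_lt_0_compat; lra).
set (a := RtoC (X - 1)). assert (ha : H a) by apply (log_domain_base H rho X k hH).
assert (hac := log_domain_left _ _ _ _ _ hH ha).
set (E := exp (P * Rabs (rho 0 - 1))).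
assert (hE : 0 < E) by apply exp_pos.
exists ((b2 - b1) * (K * B * E)). split.
{ apply Rmult_le_pos; [lra|]. apply Rmult_le_pos; [|lra]. apply Rmult_le_pos; auto. unfold B; lra. }
intros g M w hg h1 h2 hw.
assert (hM : 0 <= M).
{ exact (E0_bound_pos _ _ _ _ hg hac). }
set (tau := (w + 1 - RtoC (rho 0))%C).
assert (ht : forall u, closure H u -> H (u + tau)%C) by (intros; eapply translate_in; eauto).
assert (ht1 : forall u, H u -> H (u + tau)%C) by (intros u hu; apply ht; eapply log_domain_left; eauto).
assert (ht2 : forall u, closure H u -> closure H (u + tau)%C) by (intros u hu; eapply log_domain_left; eauto).
assert (hgt := E0_bound_translate H rho X k g M tau hH hg ht1 ht2).
(* The base point follows w, so that F(p) e^(p tau) is the transform of the translate at the fixed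
   base point a; the partial sum does not depend on this choice. *)
set (F := hol_ext (laplace H g (a + tau)%C)).
assert (hF : forall s z, half_nbhd s b1 b2 r z -> differentiable F z).
{ apply (regular_half_differentiable H rho X k g M); auto. }
rewrite (proj2 (partial_sum_value H rho X k g F M b1 b2 w hH hg hb
  (hol_ext_represents H rho X k g M _ hH hg (ht1 a ha))
  (regular_holomorphic_near H rho X k g M _ b1 r hH hg (ht1 a ha) hr h1)
  (regular_holomorphic_near H rho X k g M _ b2 r hH hg (ht1 a ha) hr h2))).
rewrite Rmult_assoc. apply partial_sum_integral_bound with r; auto.
set (Psi := fun p => (F p * Cexp (p * tau))%C).
assert (hPsi : forall p, Cmod p <= P -> Cmod (Psi p) * Rabs (Im p) ^ S N <= K * M).
{ intros p hp. destruct (Req_dec (Im p) 0) as [e|e].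
  - rewrite e, Rabs_R0. simpl. rewrite Rmult_0_l, Rmult_0_r. apply Rmult_le_pos; auto.
  - assert (hoff : ~ on_Rplus p) by (intros [h0 _]; auto).
    unfold Psi, F. rewrite (proj1 (hol_ext_laplace_off H rho X k g M (a + tau)%C p hH hg (ht1 a ha) hoff)).
    rewrite Cmult_comm, <- (laplace_translate H rho X k g M tau a p); auto. }
assert (hdisc : forall b, b = b1 \/ b = b2 -> forall q, Cmod (q - RtoC b) < r / 2 -> Cmod (Psi q) <= K * M * (8 / r) ^ S N).
{ intros b hb' q hq. apply real_axis_bound with (b := b); auto.
  - intros p hp. apply differentiable_mult; [|apply Cexp_mult_differentiable].
    apply (hF true). right. destruct hb' as [-> | ->]; auto.
  - intros p hp. apply hPsi. assert (h0 := Cmod_rev_tri p (RtoC b)). rewrite Cmod_R in h0.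
    unfold P. assert (n1 := Rabs_pos b1). assert (n2 := Rabs_pos b2). destruct hb' as [-> | ->]; lra. }
intros t htt. set (p := std_loop b1 b2 t).
set (m := (b1 + b2) / 2).
assert (hcirc : Cmod (p - (m, 0)) = R0).
{ unfold p. unfold std_loop. fold m. fold R0. change ((m, 0) : C) with (RtoC m).
  replace (RtoC m + - RtoC R0 * Cexp (RtoC t * (2 * Ci * RtoC PI)) - RtoC m)%C with
    (- RtoC R0 * Cexp (RtoC t * (2 * Ci * RtoC PI)))%C by ring.
  rewrite Cmod_mult, Cmod_opp, Cmod_R, Cmod_Cexp, Rabs_pos_eq by lra.
  replace (Re (RtoC t * (2 * Ci * RtoC PI))%C) with 0 by (simpl; ring). rewrite exp_0. ring. }
assert (hpP : Cmod p <= P).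
{ assert (h0 := Cmod_rev_tri p (RtoC m)). change (RtoC m) with ((m, 0) : C) in h0 at 2. rewrite hcirc in h0.
  rewrite Cmod_R in h0.
  assert (h3 : Rabs m <= Rabs b1 + Rabs b2).
  { unfold m, Rdiv. rewrite Rabs_mult, (Rabs_pos_eq (/ 2)) by lra.
    assert (h4 := Rabs_triang b1 b2). assert (n1 := Rabs_pos b1). assert (n2 := Rabs_pos b2). lra. }
  unfold P, R0 in *. lra. }
assert (hKM : 0 <= K * M) by (apply Rmult_le_pos; auto).
assert (hPs : Cmod (Psi p) <= K * M * B).
{ unfold B. rewrite Rmult_plus_distr_l.
  assert (p1 : 0 <= K * M * (8 / r) ^ S N) by (apply Rmult_le_pos; auto).
  assert (p2 : 0 <= K * M * (8 * R0 / (r * r)) ^ S N) by (apply Rmult_le_pos; auto).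
  destruct (Rlt_dec (Cmod (p - RtoC b1)) (r / 2)) as [c1|c1].
  { assert (h0 := hdisc b1 (or_introl eq_refl) p c1). lra. }
  destruct (Rlt_dec (Cmod (p - RtoC b2)) (r / 2)) as [c2|c2].
  { assert (h0 := hdisc b2 (or_intror eq_refl) p c2). lra. }
  (* On this circle |p - b1| |p - b2| = 2 R0 |Im p|, and both factors are now at least r / 2. *)
  assert (hch := circle_chords m 0 R0 p ltac:(lra) hcirc).
  replace ((p - RtoC m) * (p - RtoC m) - RtoC (R0 * R0 - 0 * 0))%C with ((p - RtoC b1) * (p - RtoC b2))%C in hch.
  2: { destruct p as [x y]. unfold m, R0. apply C_eq_parts; simpl; field. }
  rewrite Cmod_mult in hch.
  assert (hi : r * r / (8 * R0) <= Rabs (Im p)).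
  { apply Rmult_le_reg_l with (2 * R0); [lra|]. rewrite <- hch.
    apply Rle_trans with (r / 2 * (r / 2)); [right; field; lra|]. apply Rmult_le_compat; lra. }
  assert (hip : 0 < r * r / (8 * R0)) by (apply Rdiv_lt_0_compat; lra).
  assert (h0 := hPsi p hpP).
  apply Rle_trans with (K * M * (8 * R0 / (r * r)) ^ S N); [|lra].
  apply Rle_trans with (Cmod (Psi p) * Rabs (Im p) ^ S N * (8 * R0 / (r * r)) ^ S N).
  - rewrite Rmult_assoc, <- Rpow_mult_distr. rewrite <- (Rmult_1_r (Cmod (Psi p))) at 1.
    apply Rmult_le_compat_l; [apply Cmod_ge_0|]. apply pow_R1_Rle.
    apply Rle_trans with (r * r / (8 * R0) * (8 * R0 / (r * r))); [right; field; lra|].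
    apply Rmult_le_compat_r; auto. left; apply Rdiv_lt_0_compat; lra.
  - apply Rmult_le_compat_r; auto. }
replace (F p * Cexp (p * w))%C with (Psi p * Cexp (p * RtoC (rho 0 - 1)))%C.
2: { unfold Psi. rewrite <- Cmult_assoc, <- Cexp_plus. do 2 f_equal. unfold tau. rewrite RtoC_minus. ring. }
rewrite Cmod_mult, Cmod_Cexp.
replace (K * B * E * M) with (K * M * B * E) by ring.
apply Rmult_le_compat; try apply Cmod_ge_0; auto; [left; apply exp_pos|].
apply exp_le. assert (h0 := abs_Re_mult_le p (RtoC (rho 0 - 1))). apply Rabs_le_between in h0.
rewrite Cmod_R in h0.
assert (Cmod p * Rabs (rho 0 - 1) <= P * Rabs (rho 0 - 1)) by (apply Rmult_le_compat_r; auto; apply Rabs_pos).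
lra.
Qed.

(** * Gaps in the enumerated sets *)

Lemma enumerates_mono (b : nat -> Rbar) (A : R -> Prop) (i j : nat) : enumerates b A -> (i <= j)%nat ->
  Rbar_le (b i) (b j).
Proof.
intros [_ [h _]] hij. induction hij as [|j hij IH]; [apply Rbar_le_refl|].
apply Rbar_le_trans with (1 := IH). destruct (h j) as [h1|[-> ->]]; [apply Rbar_lt_le; auto|apply Rbar_le_refl].
Qed.

(** A real number strictly between b and the limit eventually separates b from the sequence;
    infinite limits are included because of padded enumerations. *)
Lemma terms_avoid (bn : nat -> Rbar) (l : Rbar) (b : R) : Rbar_cv bn l -> l <> Finite b ->
  exists r N, 0 < r /\ forall n, (N <= n)%nat -> forall x, Rabs (x - b) < r -> bn n <> Finite x.
Proof.
intros [hlow hup] hl.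
assert (key1 : forall a, b < a -> Rbar_lt a l ->
  exists r N, 0 < r /\ forall n, (N <= n)%nat -> forall x, Rabs (x - b) < r -> bn n <> Finite x).
{ intros a hab hal. destruct (hlow a hal) as [N hN]. exists (a - b), N. split; [lra|].
  intros n hn x hx e. specialize (hN n hn). rewrite e in hN. simpl in hN. apply Rabs_def2 in hx. lra. }
assert (key2 : forall a, a < b -> Rbar_lt l a ->
  exists r N, 0 < r /\ forall n, (N <= n)%nat -> forall x, Rabs (x - b) < r -> bn n <> Finite x).
{ intros a hab hal. destruct (hup a hal) as [N hN]. exists (b - a), N. split; [lra|].
  intros n hn x hx e. specialize (hN n hn). rewrite e in hN. simpl in hN. apply Rabs_def2 in hx. lra. }
destruct l as [c| |].
- destruct (Rtotal_order b c) as [h|[h|h]].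
  + apply (key1 ((b + c) / 2)); simpl; lra.
  + subst c; tauto.
  + apply (key2 ((b + c) / 2)); simpl; lra.
- apply (key1 (b + 1)); simpl; auto; lra.
- apply (key2 (b - 1)); simpl; auto; lra.
Qed.

(** Some [beta K] exceeds b + 1, hence so does [betan n K] for n large, and by monotonicity all
    later terms of that row. Only the finitely many k < K are separated from b one by one. *)
Lemma enumerated_gap (Rn : nat -> R -> Prop) (R0 : R -> Prop) (betan : nat -> nat -> Rbar) (beta : nat -> Rbar) (b : R) :
  (forall n, enumerates (betan n) (Rn n)) -> enumerates beta R0 -> Rbar_cv beta p_infty ->
  (forall k, Rbar_cv (fun n => betan n k) (beta k)) -> ~ R0 b ->
  exists r N, 0 < r /\ forall n, (N <= n)%nat -> forall x, Rabs (x - b) < r -> ~ Rn n x.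
Proof.
intros hRn hR0 hinf hcv hb.
destruct (proj1 hinf (b + 1)) as [K hK]; [simpl; auto|].
destruct (proj1 (hcv K) (b + 1) (hK K (le_n _))) as [N1 hN1].
assert (hfin : forall m, exists r N, 0 < r /\ forall n, (N <= n)%nat -> forall k, (k < m)%nat ->
  forall x, Rabs (x - b) < r -> betan n k <> Finite x).
{ induction m as [|m [r1 [M1 [hr1 h1]]]].
  - exists 1, 0%nat. split; [lra|]. intros; lia.
  - destruct (terms_avoid (fun n => betan n m) (beta m) b (hcv m)) as [r2 [M2 [hr2 h2]]].
    { intros e. apply hb. apply hR0. exists m. exact e. }
    exists (Rmin r1 r2), (max M1 M2). split; [apply Rmin_pos; auto|]. intros n hn k hk x hx.
    destruct (Nat.eq_dec k m) as [->|hkm].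
    + apply (h2 n); [lia|]. exact (lt_Rmin_r hx).
    + apply (h1 n); [lia|lia|]. exact (lt_Rmin_l hx). }
destruct (hfin K) as [r [N2 [hr h2]]].
exists (Rmin r 1), (max N1 N2). split; [apply Rmin_pos; lra|]. intros n hn x hx hRx.
apply (hRn n) in hRx. destruct hRx as [k e].
destruct (Nat.lt_ge_cases k K) as [hk|hk].
- apply (h2 n ltac:(lia) k hk x); auto. exact (lt_Rmin_l hx).
- assert (h3 := hN1 n ltac:(lia)). assert (h4 := enumerates_mono _ _ K k (hRn n) hk).
  assert (h5 := Rbar_lt_le_trans _ _ _ h3 h4). rewrite e in h5. simpl in h5.
  assert (h6 := lt_Rmin_r hx). apply Rabs_def2 in h6. lra.
Qed.

Theorem corollary2 (Rn : nat -> R -> Prop) (R0 : R -> Prop)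
    (betan : nat -> nat -> Rbar) (beta : nat -> Rbar)
    (H : C -> Prop) (gn : nat -> C -> C) (g : C -> C)
    (enum_Rn : forall n : nat, enumerates (betan n) (Rn n))
    (enum_R0 : enumerates beta R0)
    (beta_infty : Rbar_cv beta p_infty)
    (H_log : log_half_plane H)
    (gn_E0 : forall n : nat, E0 H (gn n))
    (g_E0 : E0 H g)
    (gn_cv : uniform_cv_on H gn g)
    (betan_cv : forall k : nat, Rbar_cv (fun n => betan n k) (beta k))
    (supp_gn : forall (n : nat) (x : R), laplace_support H (gn n) x -> Rn n x) :
  (forall x : R, laplace_support H g x -> R0 x) /\
  (forall b1 b2 : R, b1 < b2 -> ~ R0 b1 -> ~ R0 b2 ->
     (exists N : nat, forall n : nat, (N <= n)%nat ->
        partial_sum_well_defined H (gn n) b1 b2) /\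
     partial_sum_well_defined H g b1 b2 /\
     uniform_cv_on (shift_m1 H)
       (fun n => partial_sum H (gn n) b1 b2) (partial_sum H g b1 b2)).
Proof.
destruct (log_half_plane_domain H H_log) as [rho [X [k hH]]].
destruct (E0_bound_ex H rho X k g hH g_E0) as [M hg].
destruct (choice (fun n Mn => E0_bound H (gn n) Mn)
  (fun n => E0_bound_ex H rho X k (gn n) hH (gn_E0 n))) as [Mn hgn].
(* Admissible paths and rays run in the closure of H, so the bound on differences is carried there
   by continuity. *)
assert (hcv : uniform_cv_on (closure H) gn g).
{ intros eps he. destruct (gn_cv eps he) as [N hN]. exists N. intros n hn.
  apply (closure_bound H rho X k (fun w => gn n w - g w)%C eps hH).
  - apply ccont_minus; [apply (hgn n)|apply hg].
  - apply hN; auto. }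
assert (hgap : forall b, ~ R0 b -> exists r N, 0 < r /\ forall n, (N <= n)%nat -> regular_near H (gn n) b r).
{ intros b hb.
  destruct (enumerated_gap Rn R0 betan beta b enum_Rn enum_R0 beta_infty betan_cv hb) as [r [N [hr h]]].
  exists r, N. split; auto. intros n hn y hy hs. apply (h n hn y hy). apply supp_gn; auto. }
assert (hsupp : forall x, laplace_support H g x -> R0 x).
{ intros x hx. apply NNPP. intros hno. destruct (hgap x hno) as [r [N [hr h]]].
  apply (support_limit H rho X k gn g Mn M x r N hH hgn hg hcv hr h hx). }
assert (hgapg : forall b, ~ R0 b -> exists r, 0 < r /\ regular_near H g b r).
{ intros b hb.
  (* The constant sequence of enumerations gives an interval around b free of R0 itself. *)
  destruct (enumerated_gap (fun _ => R0) R0 (fun _ => beta) beta b) as [r [N [hr h]]]; auto.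
  - intros j. split; intros a ha; exists 0%nat; auto.
  - exists r. split; auto. intros y hy hs. apply (h N (le_n _) y hy). auto. }
split; auto.
intros b1 b2 hb hb1 hb2.
destruct (hgap b1 hb1) as [r1 [N1 [hr1 h1]]]. destruct (hgap b2 hb2) as [r2 [N2 [hr2 h2]]].
destruct (hgapg b1 hb1) as [r3 [hr3 h3]]. destruct (hgapg b2 hb2) as [r4 [hr4 h4]].
set (r := Rmin (Rmin r1 r2) (Rmin r3 r4)).
assert (hr : 0 < r) by (repeat apply Rmin_pos; auto).
assert (q1 : r <= r1) by (eapply Rle_trans; [apply Rmin_l|apply Rmin_l]).
assert (q2 : r <= r2) by (eapply Rle_trans; [apply Rmin_l|apply Rmin_r]).
assert (q3 : r <= r3) by (eapply Rle_trans; [apply Rmin_r|apply Rmin_l]).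
assert (q4 : r <= r4) by (eapply Rle_trans; [apply Rmin_r|apply Rmin_r]).
assert (mono : forall f b s, r <= s -> regular_near H f b s -> regular_near H f b r).
{ intros f b s hs hf y hy. apply hf. lra. }
assert (hn1 : forall n, (max N1 N2 <= n)%nat -> regular_near H (gn n) b1 r).
{ intros n hn. apply (mono _ _ r1); auto. apply h1; lia. }
assert (hn2 : forall n, (max N1 N2 <= n)%nat -> regular_near H (gn n) b2 r).
{ intros n hn. apply (mono _ _ r2); auto. apply h2; lia. }
assert (hg1 := mono _ _ _ q3 h3). assert (hg2 := mono _ _ _ q4 h4).
split; [|split].
- exists (max N1 N2). intros n hn.
  exact (regular_well_defined H rho X k (gn n) (Mn n) b1 b2 r hH (hgn n) hb hr (hn1 n hn) (hn2 n hn)).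
- exact (regular_well_defined H rho X k g M b1 b2 r hH hg hb hr hg1 hg2).
- destruct (partial_sum_bound H rho X k b1 b2 r hH hb hr) as [K [hK hbd]].
  (* [K] may be 0, hence K + 1. It depends on b1, b2 and r but not on w, which gives uniformity on
     -1 + H. *)
  intros eps he. destruct (hcv (eps / (K + 1))) as [N hN]; [apply Rdiv_lt_0_compat; lra|].
  exists (max N (max N1 N2)). intros n hn w hw.
  assert (k1 := hn1 n ltac:(lia)). assert (k2 := hn2 n ltac:(lia)).
  rewrite <- (partial_sum_minus H rho X k (gn n) g (Mn n) M b1 b2 r w hH (hgn n) hg hb hr k1 k2 hg1 hg2).
  eapply Rle_trans; [apply (hbd _ (eps / (K + 1)) w)|].
  + exact (E0_bound_minus H _ _ _ _ _ (hgn n) hg (hN n ltac:(lia))).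
  + exact (regular_near_minus H rho X k (gn n) g (Mn n) M b1 r hH (hgn n) hg k1 hg1).
  + exact (regular_near_minus H rho X k (gn n) g (Mn n) M b2 r hH (hgn n) hg k2 hg2).
  + exact hw.
  + apply Rle_trans with ((K + 1) * (eps / (K + 1))); [|right; field; lra].
    apply Rmult_le_compat_r; [|lra]. left; apply Rdiv_lt_0_compat; lra.
Qed.
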